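(* Let $\Gamma=\Gamma_\Phi$ be a four block operator with superoptimal singular values $t_0,\dots,t_{d-1}$ such that $\|\Gamma_\Phi\|_{\rm e}$ is less than the smallest nonzero superoptimal singular value. Let $t'_0,t'_1,t'_2,\dots$ be the extended $t$-sequence of $\Gamma_\Phi$. Then $$t'_j\le s_j(\Gamma_\Phi),\qquad j\ge0$$ (for all $j$ for which $t_j'$ is defined).
   Context: $\mathbb T$ is the unit circle; $H^2_-=L^2\ominus H^2$; $M_{k,l}$ is the space of $k\times l$ matrices; $\|F\|_\infty=\operatorname{ess\,sup}_{\zeta\in\mathbb T}\|F(\zeta)\|$. $s_j(A)$ is the distance from $A$ to the matrices (operators) of rank at most $j$; $\|T\|_{\rm e}$ is the essential norm. For $\varphi\in L^\infty$, $T_\varphi:H^2\to H^2$, $T_\varphi f=\mathbb P_+\varphi f$. Four block operator: $m=m_1+m_2$, $n=n_1+n_2$, $d=\min\{m_1,n_1\}$. For $\Phi=\begin{pmatrix}\Phi_{11}&\Phi_{12}\\ \Phi_{21}&\Phi_{22}\end{pmatrix}\in L^\infty(M_{m,n})$ with $\Phi_{11}$ of size $m_1\times n_1$ and $\Phi_{22}$ of size $m_2\times n_2$, $\Gamma_\Phi:H^2(\mathbb C^{n_1})\oplus L^2(\mathbb C^{n_2})\to H^2_-(\mathbb C^{m_1})\oplus L^2(\mathbb C^{m_2})$ is $\Gamma_\Phi f=\mathbb P^-\Phi f$, $\mathbb P^-$ the orthogonal projection onto $H^2_-(\mathbb C^{m_1})\oplus L^2(\mathbb C^{m_2})$. $\Phi$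 is a symbol of $\Gamma$ if $\Gamma=\Gamma_\Phi$. Superoptimality: for $Q\in H^\infty(M_{m_1,n_1})$ put $\Phi_Q=\begin{pmatrix}\Phi_{11}-Q&\Phi_{12}\\ \Phi_{21}&\Phi_{22}\end{pmatrix}$. $\Omega_0$ is the set of $Q$ minimizing $\|\Phi_Q\|_\infty$, $\Omega_j$ the set of $Q\in\Omega_{j-1}$ minimizing $\operatorname{ess\,sup}_\zeta s_j(\Phi_Q(\zeta))$ over $\Omega_{j-1}$; superoptimal solutions are the elements of $\Omega_{d-1}$; $t_j=\operatorname{ess\,sup}_\zeta s_j(\Phi_Q(\zeta))$, $Q\in\Omega_j$, $0\le j\le d-1$, are the superoptimal singular values (depending only on $\Gamma_\Phi$). A superoptimal symbol of $\Gamma$ is a symbol for which $0$ is a superoptimal solution (unique under the hypotheses here). The hypothesis on $\|\Gamma_\Phi\|_{\rm e}$ means $\|\Gamma_\Phi\|_{\rm e}<t_j$ for every $j$ with $t_j\ne0$. Inner/outer: $\Theta\in H^\infty$ is inner if $\Theta(\zeta)$ is isometric a.e.; $F\in H^\infty(M_{k,l})$ is outer if $FH^2(\mathbb C^l)$ is dense in $H^2(\mathbb C^k)$, co-outer if $F^t$ is outer. Thematic functions: a thematic function with block sizes $(p,q)$ is a unitary-valued measurable $(p+q)\times(p+q)$ matrix function of the form $\begin{pmatrix}v_1&\overline{V_c}&\star\\ v_2&0&\star\end{pmatrix}$, where $v_1\in H^\infty(\mathbb C^p)$ is a co-outer column, $v_2\in L^\infty(\mathbb C^q)$, $V_c\in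 H^\infty(M_{p,p-1})$ is inner and co-outer (empty if $p=1$), and the last $q$ columns are arbitrary. Thematic factorization of the superoptimal symbol $\Psi$ of $\Gamma$: a factorization $\Psi=W_0^*W_1^*\cdots W_{d-1}^*\,D\,V_{d-1}^*\cdots V_1^*V_0^*$ with $D=\begin{pmatrix}\operatorname{diag}(t_0u_0,\dots,t_{d-1}u_{d-1})&0\\ 0&\star\end{pmatrix}$ ($\star$ a bounded function of size $(m-d)\times(n-d)$), $u_j$ unimodular functions with $T_{u_j}$ Fredholm and $\operatorname{ind}T_{u_j}>0$, $V_j=\begin{pmatrix}I_j&0\\0&\breve V_j\end{pmatrix}$, $W_j=\begin{pmatrix}I_j&0\\0&\breve W_j\end{pmatrix}$, where $\breve V_j$ is thematic with block sizes $(n_1-j,n_2)$ and $\breve W_j^t$ has the form of a thematic function with block sizes $(m_1-j,m_2)$. Its indices are $k_j=\operatorname{ind}T_{u_j}=\dim\operatorname{Ker}T_{u_j}$, defined for $t_j\neq0$. Extended $t$-sequence: the sequence $t'_0,t_1',\dots$ is $t_0,\dots,t_0,t_1,\dots,t_1,\dots$, where each nonzero $t_j$ is repeated $k_j$ times; it does not depend on the choice of thematic factorization (the sums of the $k_j$ over equal $t_j$ are invariant). It has $\sum_{t_j\ne0}k_j$ terms. *)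

(* Defs.v *)
From HB Require Import structures.
From mathcomp Require Import all_boot all_order all_algebra.
From mathcomp Require Import sesquilinear spectral.
From mathcomp Require Import all_classical all_reals all_analysis.
From mathcomp Require Import ess_sup_inf hoelder.
From mathcomp Require Import complex.

Set Implicit Arguments.
Unset Strict Implicit.
Unset Printing Implicit Defensive.

Import Order.TTheory GRing.Theory Num.Theory.
Import numFieldNormedType.Exports.

Local Open Scope classical_set_scope.
Local Open Scope sesquilinear_scope.
Local Open Scope ring_scope.

Section Matrices.
Context {R : realType}.
Local Notation C := R[i].

Definition enorm n (x : 'cV[C]_n) : R :=
  Num.sqrt (\sum_(i < n) ComplexField.Normc.normc (x i 0) ^+ 2).

Definition mx_norm2 m n (A : 'M[C]_(m, n)) : \bar R :=
  ereal_sup [set (enorm (A *m x))%:E | x in [set x | enorm x <= 1]].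

Definition mx_sv j m n (A : 'M[C]_(m, n)) : \bar R :=
  ereal_inf [set mx_norm2 (A - B) | B in [set B | (\rank B <= j)%N]].

Definition cjmx m n (A : 'M[C]_(m, n)) : 'M[C]_(m, n) := map_mx Num.conj A.

End Matrices.

(* A function on the unit circle is represented by the function
   t |-> f (exp (2 pi i t)) of a real variable. It only matters for t in
   [0, 1], which is where the measure below, corresponding to the normalized
   arc length, lives. The elements of L^p spaces are functions, compared
   by equality almost everywhere. *)
Section Circle.
Context {R : realType}.
Local Notation C := R[i].

Definition arc_length := uniform_prob (@ltr01 R).
Local Notation mu := arc_length.

Definition zeta (t : R) : C := Complex (cos (2 * pi * t)) (sin (2 * pi * t)).

Definition integralC (f : R -> C) : C :=
  Complex (Rintegral mu setT (fun t => complex.Re (f t)))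
          (Rintegral mu setT (fun t => complex.Im (f t))).

Definition fourier (f : R -> C) (k : int) : C :=
  integralC (fun t => f t * zeta t ^ (- k)).

Definition measurable_mxfun m n (F : R -> 'M[C]_(m, n)) : Prop :=
  forall i j, measurable_fun setT (fun t => complex.Re (F t i j)) /\
              measurable_fun setT (fun t => complex.Im (F t i j)).

Definition ess_sup_sv j m n (F : R -> 'M[C]_(m, n)) : \bar R :=
  ess_sup mu (fun t => mx_sv j (F t)).

Definition Linf_norm m n (F : R -> 'M[C]_(m, n)) : \bar R :=
  ess_sup mu (fun t => mx_norm2 (F t)).

Definition Linf m n : set (R -> 'M[C]_(m, n)) :=
  [set F | measurable_mxfun F /\ (Linf_norm F < +oo)%E].

Definition Hinf m n : set (R -> 'M[C]_(m, n)) :=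
  [set F | Linf F /\
    forall i j (k : int), k < 0 -> fourier (fun t => F t i j) k = 0].

Definition L2norm n (f : R -> 'cV[C]_n) : \bar R :=
  Lnorm mu 2%:E (fun t => (enorm (f t))%:E).

Definition L2dist n (f g : R -> 'cV[C]_n) : \bar R :=
  L2norm (fun t => f t - g t).

Definition L2 n : set (R -> 'cV[C]_n) :=
  [set f | measurable_mxfun f /\ (L2norm f < +oo)%E].

Definition inner2 n (f g : R -> 'cV[C]_n) : C :=
  integralC (fun t => \sum_(i < n) f t i 0 * (g t i 0)^*).

Definition H2 n : set (R -> 'cV[C]_n) :=
  [set f | L2 f /\
    forall i (k : int), k < 0 -> fourier (fun t => f t i 0) k = 0].

Definition H2minus n : set (R -> 'cV[C]_n) :=
  [set f | L2 f /\ forall g, H2 g -> inner2 f g = 0].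

Definition H2_L2 n1 n2 : set (R -> 'cV[C]_(n1 + n2)) :=
  [set f | L2 f /\ H2 (fun t => usubmx (f t))].

Definition H2minus_L2 n1 n2 : set (R -> 'cV[C]_(n1 + n2)) :=
  [set f | L2 f /\ H2minus (fun t => usubmx (f t))].

(* The orthogonal projection onto a closed subspace E of L^2; its value is
   determined up to equality almost everywhere. *)
Definition orth_proj n (E : set (R -> 'cV[C]_n)) (f : R -> 'cV[C]_n) :
    R -> 'cV[C]_n :=
  xget (fun=> 0) [set g | E g /\
    forall h, E h -> inner2 (fun t => f t - g t) h = 0].

End Circle.

Notation "f =ae g" := (ae_eq arc_length setT f g) (at level 70).

(* Operators from a subspace X of L^2(C^n) to a subspace Y of L^2(C^m). Their
   values outside X are irrelevant, and their values on X matter only up to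
   equality almost everywhere. *)
Section Operators.
Context {R : realType} (n m : nat).
Local Notation C := R[i].
Implicit Types (X : set (R -> 'cV[C]_n)) (Y : set (R -> 'cV[C]_m)).
Implicit Types A K : (R -> 'cV[C]_n) -> (R -> 'cV[C]_m).

Definition op_norm X A : \bar R :=
  ereal_sup [set L2norm (A f) | f in [set f | X f /\ (L2norm f <= 1)%E]].

Definition bounded_op X Y A : Prop :=
  [/\ forall f, X f -> Y (A f),
      forall (c : C) f g, X f -> X g ->
        A (fun t => c *: f t + g t) =ae (fun t => c *: A f t + A g t) &
      (op_norm X A < +oo)%E].

Definition rank_le_op j X Y K : Prop :=
  bounded_op X Y K /\
  exists g : 'I_j -> R -> 'cV[C]_m, (forall i, Y (g i)) /\
    forall f, X f -> exists c : 'I_j -> C,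
      K f =ae (fun t => \sum_(i < j) c i *: g i t).

Definition compact_op X Y K : Prop :=
  bounded_op X Y K /\
  forall f : nat -> R -> 'cV[C]_n,
    (forall k, X (f k) /\ (L2norm (f k) <= 1)%E) ->
    exists (s : nat -> nat) (g : R -> 'cV[C]_m),
      [/\ forall k, (s k < s k.+1)%N, Y g &
          (fun k => L2dist (K (f (s k))) g) @ \oo --> 0%E].

Definition op_sub A K : (R -> 'cV[C]_n) -> (R -> 'cV[C]_m) :=
  fun f t => A f t - K f t.

Definition op_sv j X Y A : \bar R :=
  ereal_inf [set op_norm X (op_sub A K) | K in rank_le_op j X Y].

Definition ess_norm X Y A : \bar R :=
  ereal_inf [set op_norm X (op_sub A K) | K in compact_op X Y].

End Operators.

Section Fredholm.
Context {R : realType}.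
Local Notation C := R[i].

(* The quotient of the subspace X by its subspace Z has dimension k. *)
Definition quot_dim n (X Z : set (R -> 'cV[C]_n)) (k : nat) : Prop :=
  exists e : 'I_k -> R -> 'cV[C]_n, (forall i, X (e i)) /\
    forall f, X f -> exists! c : 'rV[C]_k,
      Z (fun t => f t - \sum_(i < k) c 0 i *: e i t).

Definition op_ker n m (X : set (R -> 'cV[C]_n))
    (A : (R -> 'cV[C]_n) -> (R -> 'cV[C]_m)) : set (R -> 'cV[C]_n) :=
  [set f | X f /\ A f =ae (fun=> 0)].

Definition op_range n m (X : set (R -> 'cV[C]_n)) (Y : set (R -> 'cV[C]_m))
    (A : (R -> 'cV[C]_n) -> (R -> 'cV[C]_m)) : set (R -> 'cV[C]_m) :=
  [set g | Y g /\ exists2 f, X f & A f =ae g].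

Definition L2dense m (Z Y : set (R -> 'cV[C]_m)) : Prop :=
  forall g, Y g -> forall eps : R, 0 < eps ->
    exists2 f, Z f & (L2dist f g < eps%:E)%E.

Definition L2closed_in m (Z Y : set (R -> 'cV[C]_m)) : Prop :=
  forall g, Y g ->
    (forall eps : R, 0 < eps ->
      exists2 f, Z f & (L2dist f g < eps%:E)%E) -> Z g.

Definition fredholm_of_index n m (X : set (R -> 'cV[C]_n))
    (Y : set (R -> 'cV[C]_m)) (A : (R -> 'cV[C]_n) -> (R -> 'cV[C]_m))
    (i : int) : Prop :=
  [/\ bounded_op X Y A, L2closed_in (op_range X Y A) Y &
      exists a b : nat,
        [/\ quot_dim (op_ker X A) [set f | f =ae (fun=> 0)] a,
            quot_dim Y (op_range X Y A) b & i = a%:Z - b%:Z]].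

Definition toeplitz (phi : R -> C) (f : R -> 'cV[C]_1) : R -> 'cV[C]_1 :=
  orth_proj (H2 (n := 1)) (fun t => phi t *: f t).

End Fredholm.

Section FourBlock.
Context {R : realType} (m1 m2 n1 n2 : nat).
Local Notation C := R[i].
Implicit Types (Phi Psi : R -> 'M[C]_(m1 + m2, n1 + n2)).
Implicit Types (Q : R -> 'M[C]_(m1, n1)).

Definition Gamma Phi (f : R -> 'cV[C]_(n1 + n2)) : R -> 'cV[C]_(m1 + m2) :=
  orth_proj (H2minus_L2 (n1 := m1) (n2 := m2)) (fun t => Phi t *m f t).

Definition Gamma_sv j Phi : \bar R :=
  op_sv j (H2_L2 (n1 := n1) (n2 := n2)) (H2minus_L2 (n1 := m1) (n2 := m2))
    (Gamma Phi).

Definition Gamma_ess_norm Phi : \bar R :=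
  ess_norm (H2_L2 (n1 := n1) (n2 := n2)) (H2minus_L2 (n1 := m1) (n2 := m2))
    (Gamma Phi).

Definition is_symbol Phi Psi : Prop :=
  Linf Psi /\ forall f, H2_L2 f -> Gamma Psi f =ae Gamma Phi f.

Definition sub_block Phi Q : R -> 'M[C]_(m1 + m2, n1 + n2) :=
  fun t => block_mx (ulsubmx (Phi t) - Q t) (ursubmx (Phi t))
                    (dlsubmx (Phi t)) (drsubmx (Phi t)).

Fixpoint Omega j Phi : set (R -> 'M[C]_(m1, n1)) :=
  if j is j'.+1 then
    [set Q | Omega j' Phi Q /\ forall Q', Omega j' Phi Q' ->
      (ess_sup_sv j'.+1 (sub_block Phi Q)
         <= ess_sup_sv j'.+1 (sub_block Phi Q'))%E]
  else
    [set Q | Hinf Q /\ forall Q', Hinf Q' ->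
      (Linf_norm (sub_block Phi Q) <= Linf_norm (sub_block Phi Q'))%E].

Let d := minn m1 n1.

Definition superopt_sv Phi (t : nat -> R) : Prop :=
  forall j, (j < d)%N ->
    exists2 Q, Omega j Phi Q & (t j)%:E = ess_sup_sv j (sub_block Phi Q).

Definition superopt_symbol Phi Psi : Prop :=
  is_symbol Phi Psi /\ Omega d.-1 Psi (fun=> 0).

End FourBlock.

Section Thematic.
Context {R : realType}.
Local Notation C := R[i].

Definition inner_fun k l (F : R -> 'M[C]_(k, l)) : Prop :=
  Hinf F /\ {ae arc_length, forall t, forall x, enorm (F t *m x) = enorm x}.

Definition outer_fun k l (F : R -> 'M[C]_(k, l)) : Prop :=
  Hinf F /\
  L2dense [set g | exists2 f, H2 f & g = (fun t => F t *m f t)] (H2 (n := k)).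

Definition coouter_fun k l (F : R -> 'M[C]_(k, l)) : Prop :=
  outer_fun (fun t => (F t)^T).

(* Here and below, conform_mx 0 B is B, regarded as a matrix whose dimensions
   are equal but not convertible to those of B (1 + p.-1 + q = p + q here). *)
Definition thematic p q (V : R -> 'M[C]_(p + q)) : Prop :=
  [/\ (0 < p)%N, measurable_mxfun V,
      {ae arc_length, forall t, V t \is unitarymx} &
      exists (v1 : R -> 'cV[C]_p) (v2 : R -> 'cV[C]_q)
             (Vc : R -> 'M[C]_(p, p.-1)) (E : R -> 'M[C]_(p + q, q)),
        [/\ Hinf v1 /\ coouter_fun v1, Linf v2,
            inner_fun Vc /\ coouter_fun Vc &
            V =ae (fun t => conform_mx 0
              (row_mx (block_mx (v1 t) (cjmx (Vc t)) (v2 t) 0) (E t)))]].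

Definition id_block j n m (V : R -> 'M[C]_m) : R -> 'M[C]_n :=
  fun t => conform_mx 0 (block_mx (1%:M : 'M[C]_j) 0 0 (V t)).

(* (u t)%:M is the 1 x 1 matrix (u t). *)
Definition unimodular_fun (u : R -> C) : Prop :=
  measurable_mxfun (fun t => (u t)%:M : 'M[C]_1) /\
  {ae arc_length, forall t, `|u t| = 1}.

Definition thematic_factorization m1 m2 n1 n2
    (Psi : R -> 'M[C]_(m1 + m2, n1 + n2)) (t : nat -> R) (k : nat -> nat) :
    Prop :=
  let d := minn m1 n1 in
  exists (V : forall j, R -> 'M[C]_(n1 - j + n2))
         (W : forall j, R -> 'M[C]_(m1 - j + m2))
         (u : nat -> R -> C)
         (E : R -> 'M[C]_(m1 + m2 - d, n1 + n2 - d)),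
    [/\ forall j, (j < d)%N -> thematic (V j),
        forall j, (j < d)%N -> thematic (fun z => (W j z)^T),
        forall j, (j < d)%N ->
          [/\ unimodular_fun (u j),
              fredholm_of_index (H2 (n := 1)) (H2 (n := 1)) (toeplitz (u j))
                (k j)%:Z &
              (0 < k j)%N],
        Linf E &
        Psi =ae (fun z =>
          (\prod_(j < d) (id_block j (m1 + m2) (W j) z)^t*)
          *m conform_mx 0
               (block_mx (diag_mx (\row_(j < d) ((t j)%:C%C * u j z))) 0
                         0 (E z))
          *m (\prod_(j < d)
                (id_block (rev_ord j) (n1 + n2) (V (rev_ord j)) z)^t*))].

Definition extend_seq d (t : nat -> R) (k : nat -> nat) : seq R :=
  flatten [seq nseq (k j) (t j) | j <- iota 0 d & t j != 0].

Definition extended_t_sequence m1 m2 n1 n2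
    (Phi : R -> 'M[C]_(m1 + m2, n1 + n2)) (t : nat -> R) (t' : seq R) : Prop :=
  exists (Psi : R -> 'M[C]_(m1 + m2, n1 + n2)) (k : nat -> nat),
    [/\ superopt_symbol Phi Psi, thematic_factorization Psi t k &
        t' = extend_seq (minn m1 n1) t k].

End Thematic.

(* Main.v *)
(* The lower bound is obtained by exhibiting, for every eps > 0, a subspace of
   dimension k_0 + ... + k_r on which |Gamma f| >= (t_r - eps) |f|. It consists
   of functions f with a partner g in H^2_- + L^2 of almost the same norm and
   Re <Psi f, g> >= (t_r - eps) |f|^2, since <Gamma f, g> = <Psi f, g>.
   The pairs (f, g) are built from the inside of the thematic factorization
   outwards: if V^* f = (a, h) and W g = (b, l) with b = u a, then
   <Psi f, g> = t |a|^2 + <Psi' h, l>, where Psi' is the function left after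
   removing this layer. Co-outerness makes the tails h of functions f in
   H^2 + L^2 dense, so given pairs (h, l) lift approximately; changing f by v x
   and g by conj(w) y does not affect the tails, and b = u a becomes the Toeplitz
   equation T_u x = P_+ rho. Solving it loses at most dim coker T_u dimensions,
   and the kernel of T_u supplies dim ker T_u new ones, so that the dimension
   grows by ind T_u. No bounded inverse of the lifting is needed, because the
   estimate is insensitive to the size of a. *)
Require Import Defs.
From mathcomp Require Import all_boot all_order all_algebra.
From mathcomp Require Import sesquilinear spectral.
From mathcomp Require Import all_classical all_reals all_analysis.
From mathcomp Require Import measurable_realfun ess_sup_inf hoelder complex.
From mathcomp Require Import ring lra zify.

Set Implicit Arguments.
Unset Strict Implicit.
Unset Printing Implicit Defensive.

Import Order.TTheory GRing.Theory Num.Theory.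
Import numFieldNormedType.Exports.

Local Open Scope classical_set_scope.
Local Open Scope sesquilinear_scope.
Local Open Scope ring_scope.

(** * Integrals of complex-valued functions over the circle *)

Section ComplexIntegral.
Context {R : realType}.
Local Notation C := R[i].
Local Notation mu := (@arc_length R).
Local Notation normc := (@ComplexField.Normc.normc R).
Implicit Types (f g : R -> C) (c : C).

(** A subspace of dimension larger than $j$ bounds $s_j$ from below because an operator of rank at
    most $j$ kills a unit vector of it. The norm of $\Gamma f$ cannot be read off the factorization,
    since $\mathbb P^-$ does not commute with the factors; this is why a partner $g$ is carried
    along. The antiunitary involution $f\mapsto\overline{\zeta f}$ exchanges $H^2\oplus L^2$ with
    $H^2_-\oplus L^2$ and turns statements about $V$ into statements about $W$.

    Only the finitely many members of a basis are lifted; it is kept orthonormal, so that errors on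
    its members control those on all combinations. Each layer doubles the error. A layer contributes
    $t_j|a|^2\ge t_r|a|^2$, the $t_j$ being nonincreasing, and layers beyond $r$ are never opened:
    the construction starts there from the empty family.

    The analytic input is that a product of two $H^2$ functions has no negative Fourier
    coefficients. With $H^2$ defined by Fourier coefficients, this is derived from their uniqueness
    theorem, which is proved by approximating indicators of arcs by trigonometric polynomials. *)

Definition cmeas f : Prop :=
  measurable_fun setT (fun t => complex.Re (f t)) /\
  measurable_fun setT (fun t => complex.Im (f t)).

Definition cintg f : Prop :=
  mu.-integrable setT (EFin \o (fun t => complex.Re (f t))) /\
  mu.-integrable setT (EFin \o (fun t => complex.Im (f t))).

Lemma cmeas_cst c : cmeas (fun=> c).
Proof. by split; exact: measurable_cst. Qed.

Lemma cmeasD f g : cmeas f -> cmeas g -> cmeas (fun t => f t + g t).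
Proof.
move=> [f1 f2] [g1 g2]; split.
- rewrite (_ : (fun _ => _) = (fun t => complex.Re (f t) + complex.Re (g t))).
    exact: measurable_funD.
  by apply/funext => t; case: (f t) (g t) => a b [].
- rewrite (_ : (fun _ => _) = (fun t => complex.Im (f t) + complex.Im (g t))).
    exact: measurable_funD.
  by apply/funext => t; case: (f t) (g t) => a b [].
Qed.

Lemma cmeasM f g : cmeas f -> cmeas g -> cmeas (fun t => f t * g t).
Proof.
move=> [f1 f2] [g1 g2]; split.
- rewrite (_ : (fun _ => _) = (fun t => complex.Re (f t) * complex.Re (g t)
      - complex.Im (f t) * complex.Im (g t))).
    by apply: measurable_funB; apply: measurable_funM.
  by apply/funext => t; case: (f t) (g t) => a b [].
- rewrite (_ : (fun _ => _) = (fun t => complex.Re (f t) * complex.Im (g t)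
      + complex.Im (f t) * complex.Re (g t))).
    by apply: measurable_funD; apply: measurable_funM.
  by apply/funext => t; case: (f t) (g t) => a b [].
Qed.

Lemma cmeasJ f : cmeas f -> cmeas (fun t => (f t)^*).
Proof.
move=> [f1 f2]; split.
- rewrite (_ : (fun _ => _) = (fun t => complex.Re (f t))) //.
  by apply/funext => t; case: (f t) => a b.
- rewrite (_ : (fun _ => _) = (fun t => - complex.Im (f t))).
    exact: measurableT_comp.
  by apply/funext => t; case: (f t) => a b.
Qed.

Lemma cmeas_sum (I : Type) (s : seq I) (P : pred I) (F : I -> R -> C) :
  (forall i, cmeas (F i)) -> cmeas (fun t => \sum_(i <- s | P i) F i t).
Proof.
move=> mF; elim: s => [|i s IH].
  rewrite (_ : (fun _ => _) = fun=> 0); first exact: cmeas_cst.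
  by apply/funext => t; rewrite big_nil.
have [Pi|nPi] := boolP (P i).
  rewrite (_ : (fun _ => _) = fun t => F i t + \sum_(i <- s | P i) F i t).
    exact: cmeasD.
  by apply/funext => t; rewrite big_cons Pi.
rewrite (_ : (fun _ => _) = fun t => \sum_(i <- s | P i) F i t) //.
by apply/funext => t; rewrite big_cons (negbTE nPi).
Qed.

Lemma ReD (x y : C) : complex.Re (x + y) = complex.Re x + complex.Re y.
Proof. by case: x y => a b []. Qed.

Lemma ImD (x y : C) : complex.Im (x + y) = complex.Im x + complex.Im y.
Proof. by case: x y => a b []. Qed.

Lemma ReN (x : C) : complex.Re (- x) = - complex.Re x.
Proof. by case: x. Qed.

Lemma ImN (x : C) : complex.Im (- x) = - complex.Im x.
Proof. by case: x. Qed.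

Lemma ReM (x y : C) : complex.Re (x * y) =
  complex.Re x * complex.Re y - complex.Im x * complex.Im y.
Proof. by case: x y => a b []. Qed.

Lemma ImM (x y : C) : complex.Im (x * y) =
  complex.Re x * complex.Im y + complex.Im x * complex.Re y.
Proof. by case: x y => a b []. Qed.

Lemma ReJ (x : C) : complex.Re (x^*) = complex.Re x.
Proof. by case: x. Qed.

Lemma ImJ (x : C) : complex.Im (x^*) = - complex.Im x.
Proof. by case: x. Qed.

Lemma Re_sum (I : Type) (s : seq I) (P : pred I) (F : I -> C) :
  complex.Re (\sum_(i <- s | P i) F i) = \sum_(i <- s | P i) complex.Re (F i).
Proof. by rewrite (big_morph (@complex.Re R) ReD (erefl _)). Qed.

Lemma Re_mulJ (x : C) : complex.Re (x * x^*) = normc x ^+ 2.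
Proof.
case: x => a b /=; rewrite sqr_sqrtr ?addr_ge0 ?sqr_ge0 //.
by rewrite mulrN opprK !expr2.
Qed.

Lemma normc_sq (x : C) : normc x ^+ 2 = complex.Re x ^+ 2 + complex.Im x ^+ 2.
Proof. by case: x => a b /=; rewrite sqr_sqrtr ?addr_ge0 ?sqr_ge0. Qed.

Lemma mulJ_normc (x : C) : x * x^* = (normc x ^+ 2)%:C%C.
Proof.
apply/eqP; rewrite eq_complex Re_mulJ /= eqxx /=.
by case: x => a b /=; apply/eqP; ring.
Qed.

Lemma normcE (x : C) : `|x| = (normc x)%:C%C.
Proof. by case: x. Qed.

Lemma normc_ge0 (x : C) : 0 <= normc x.
Proof. by case: x => a b; exact: sqrtr_ge0. Qed.

Lemma abs_Re_le (x : C) : `|complex.Re x| <= normc x.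
Proof.
rewrite -(@ler_pXn2r _ 2) ?nnegrE ?normc_ge0 // normc_sq.
by rewrite real_normK ?num_real // lerDl sqr_ge0.
Qed.

Lemma abs_Im_le (x : C) : `|complex.Im x| <= normc x.
Proof.
rewrite -(@ler_pXn2r _ 2) ?nnegrE ?normc_ge0 // normc_sq.
by rewrite real_normK ?num_real // lerDr sqr_ge0.
Qed.

Lemma normc_mul (x y : C) : normc (x * y) = normc x * normc y.
Proof. exact: ComplexField.Normc.normcM. Qed.

Lemma normcJ (x : C) : normc (x^*) = normc x.
Proof. by case: x => a b /=; rewrite sqrrN. Qed.

Lemma normc_add (x y : C) : normc (x + y) <= normc x + normc y.
Proof. by have := ler_normD x y; rewrite !normcE -rmorphD lecR. Qed.

Lemma cintg_le f (h : R -> R) : cmeas f -> mu.-integrable setT (EFin \o h) ->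
  (forall t, normc (f t) <= h t) -> cintg f.
Proof.
move=> [mf1 mf2] ih fh; split.
- apply: le_integrable ih => //; first exact/measurable_EFinP.
  move=> t _ /=; rewrite lee_fin.
  exact: le_trans (abs_Re_le _) (le_trans (fh t) (ler_norm _)).
- apply: le_integrable ih => //; first exact/measurable_EFinP.
  move=> t _ /=; rewrite lee_fin.
  exact: le_trans (abs_Im_le _) (le_trans (fh t) (ler_norm _)).
Qed.

Lemma cintgD f g : cintg f -> cintg g -> cintg (fun t => f t + g t).
Proof.
move=> [f1 f2] [g1 g2]; split.
- rewrite (_ : _ \o _ = (EFin \o (fun t => complex.Re (f t))) \+
      (EFin \o (fun t => complex.Re (g t))))%E; first exact: integrableD.
  by apply/funext => t /=; rewrite ReD.
- rewrite (_ : _ \o _ = (EFin \o (fun t => complex.Im (f t))) \+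
      (EFin \o (fun t => complex.Im (g t))))%E; first exact: integrableD.
  by apply/funext => t /=; rewrite ImD.
Qed.

Lemma integralCD f g : cintg f -> cintg g ->
  integralC (fun t => f t + g t) = integralC f + integralC g.
Proof.
move=> [f1 f2] [g1 g2]; rewrite /integralC.
apply/eqP; rewrite eq_complex /=; apply/andP; split; apply/eqP.
- by rewrite -RintegralD //; apply: eq_Rintegral => t _; rewrite ReD.
- by rewrite -RintegralD //; apply: eq_Rintegral => t _; rewrite ImD.
Qed.

Lemma integrableZr (r : R) (h : R -> R) : mu.-integrable setT (EFin \o h) ->
  mu.-integrable setT (EFin \o (fun t => r * h t)).
Proof. by move=> ih; exact: (integrableZl measurableT r ih). Qed.

Lemma cintgZ c f : cintg f -> cintg (fun t => c * f t).
Proof.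
move=> [f1 f2]; split.
- rewrite (_ : _ \o _ = (EFin \o (fun t => (complex.Re c * complex.Re (f t))%R)) \+
      (EFin \o (fun t => ((- complex.Im c) * complex.Im (f t))%R)))%E.
    by apply: integrableD => //; exact: integrableZr.
  by apply/funext => t /=; rewrite ReM -EFinD mulNr.
- rewrite (_ : _ \o _ = (EFin \o (fun t => (complex.Re c * complex.Im (f t))%R)) \+
      (EFin \o (fun t => (complex.Im c * complex.Re (f t))%R)))%E.
    by apply: integrableD => //; exact: integrableZr.
  by apply/funext => t /=; rewrite ImM -EFinD.
Qed.

Lemma integralCZ c f : cintg f ->
  integralC (fun t => c * f t) = c * integralC f.
Proof.
move=> [f1 f2]; rewrite /integralC.
apply/eqP; rewrite eq_complex ReM ImM /=; apply/andP; split; apply/eqP.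
- rewrite -!RintegralZl //= -RintegralB //; try exact: integrableZr.
  by apply: eq_Rintegral => t _; rewrite ReM.
- rewrite -!RintegralZl //= -RintegralD //; try exact: integrableZr.
  by apply: eq_Rintegral => t _; rewrite ImM.
Qed.

Lemma integralCJ f : cintg f -> integralC (fun t => (f t)^*) = (integralC f)^*.
Proof.
move=> [f1 f2]; rewrite /integralC.
apply/eqP; rewrite eq_complex ReJ ImJ /=; apply/andP; split; apply/eqP.
- by apply: eq_Rintegral => t _; rewrite ReJ.
- rewrite -mulN1r -RintegralZl //.
  by apply: eq_Rintegral => t _; rewrite ImJ mulN1r.
Qed.

Lemma cintg0 : cintg (fun=> 0).
Proof. by split; apply: integrable0. Qed.

Lemma integralC0 : integralC (fun=> 0 : C) = 0.
Proof.
rewrite /integralC; apply/eqP; rewrite eq_complex /=.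
by rewrite !Rintegral_cst //= mul0r eqxx.
Qed.

Lemma cintg_sum (I : Type) (s : seq I) (P : pred I) (F : I -> R -> C) :
  (forall i, cintg (F i)) -> cintg (fun t => \sum_(i <- s | P i) F i t).
Proof.
move=> mF; elim: s => [|i s IH].
  rewrite (_ : (fun _ => _) = fun=> 0); first exact: cintg0.
  by apply/funext => t; rewrite big_nil.
have [Pi|nPi] := boolP (P i).
  rewrite (_ : (fun _ => _) = fun t => F i t + \sum_(i <- s | P i) F i t).
    exact: cintgD.
  by apply/funext => t; rewrite big_cons Pi.
rewrite (_ : (fun _ => _) = fun t => \sum_(i <- s | P i) F i t) //.
by apply/funext => t; rewrite big_cons (negbTE nPi).
Qed.

Lemma integralC_sum (I : Type) (s : seq I) (P : pred I) (F : I -> R -> C) :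
  (forall i, cintg (F i)) ->
  integralC (fun t => \sum_(i <- s | P i) F i t) =
  \sum_(i <- s | P i) integralC (F i).
Proof.
move=> mF; elim: s => [|i s IH].
  rewrite big_nil (_ : (fun _ => _) = fun=> 0); first exact: integralC0.
  by apply/funext => t; rewrite big_nil.
rewrite big_cons; case: ifPn => [Pi|nPi]; rewrite -IH.
  rewrite -integralCD //; last exact: cintg_sum.
  by congr integralC; apply/funext => t; rewrite big_cons Pi.
by congr integralC; apply/funext => t; rewrite big_cons (negbTE nPi).
Qed.

#[global] Instance arc_length_ae_filter : Filter (almost_everywhere mu).
Proof. exact: ae_filter_ringOfSetsType. Qed.

Lemma ae_eqP (T : Type) (F G : R -> T) :
  ae_eq mu setT F G <-> {ae mu, forall t, F t = G t}.
Proof.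
by split; apply: filterS => t FG //; exact: FG.
Qed.

Lemma Rintegral_ae (f g : R -> R) :
  measurable_fun setT f -> measurable_fun setT g ->
  {ae mu, forall t, f t = g t} -> Rintegral mu setT f = Rintegral mu setT g.
Proof.
move=> mf mg fg; congr fine; apply: ae_eq_integral => //.
- exact/measurable_EFinP.
- exact/measurable_EFinP.
- by apply: filterS fg => t /= -> _.
Qed.

Lemma integralC_ae f g : cmeas f -> cmeas g ->
  {ae mu, forall t, f t = g t} -> integralC f = integralC g.
Proof.
move=> [f1 f2] [g1 g2] fg; congr Complex; apply: Rintegral_ae => //.
- by apply: filterS fg => t ->.
- by apply: filterS fg => t ->.
Qed.

End ComplexIntegral.

(** * Square-integrable functions, the inner product and the norm of $L^2(\mathbb C^n)$ *)

Section InnerProduct.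
Context {R : realType}.
Local Notation C := R[i].
Local Notation mu := (@arc_length R).
Local Notation normc := (@ComplexField.Normc.normc R).

Definition sqint (f : R -> C) : Prop :=
  cmeas f /\ mu.-integrable setT (EFin \o (fun t => normc (f t) ^+ 2)).

Lemma cmeas_normc (f : R -> C) : cmeas f ->
  measurable_fun setT (fun t => normc (f t) ^+ 2).
Proof.
move=> [f1 f2]; under eq_fun do rewrite normc_sq.
by apply: measurable_funD; exact: measurable_funX.
Qed.

Lemma sqint_le (f : R -> C) (h : R -> R) : cmeas f ->
  mu.-integrable setT (EFin \o h) ->
  (forall t, normc (f t) ^+ 2 <= h t) -> sqint f.
Proof.
move=> mf ih fh; split=> //; apply: le_integrable ih => //.
  by apply/measurable_EFinP; exact: cmeas_normc.
move=> t _ /=; rewrite lee_fin ger0_norm ?sqr_ge0 //.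
exact: le_trans (fh t) (ler_norm _).
Qed.

Lemma normc_addsq (x y : C) :
  normc (x + y) ^+ 2 <= 2 * normc x ^+ 2 + 2 * normc y ^+ 2.
Proof.
rewrite !normc_sq ReD ImD -subr_ge0.
rewrite (_ : _ - _ = (complex.Re x - complex.Re y) ^+ 2 +
  (complex.Im x - complex.Im y) ^+ 2); last by ring.
by rewrite addr_ge0 ?sqr_ge0.
Qed.

Lemma normc_mul_le (x y : C) : normc (x * y) <= normc x ^+ 2 + normc y ^+ 2.
Proof.
rewrite normc_mul; have := normc_ge0 x; have := normc_ge0 y.
move: (normc x) (normc y) => a b b0 a0; nra.
Qed.

Lemma integrableDR (h k : R -> R) : mu.-integrable setT (EFin \o h) ->
  mu.-integrable setT (EFin \o k) ->
  mu.-integrable setT (EFin \o (fun t => h t + k t)).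
Proof. by move=> ih ik; exact: (integrableD measurableT ih ik). Qed.

Lemma sqintD (f g : R -> C) : sqint f -> sqint g -> sqint (fun t => f t + g t).
Proof.
move=> [mf jf] [mg ig]; apply: (@sqint_le _ (fun t => 2 * normc (f t) ^+ 2 + 2 * normc (g t) ^+ 2)).
- exact: cmeasD.
- by apply: integrableDR; exact: integrableZr.
- by move=> t; exact: normc_addsq.
Qed.

Lemma sqintJ (f : R -> C) : sqint f -> sqint (fun t => (f t)^*).
Proof.
move=> [mf jf]; apply: sqint_le (cmeasJ mf) jf _ => t.
by rewrite normcJ.
Qed.

Lemma sqintM_bd (f g : R -> C) (M : R) : sqint f -> cmeas g ->
  (forall t, normc (g t) <= M) -> sqint (fun t => g t * f t).
Proof.
move=> [mf jf] mg gM; apply: (@sqint_le _ (fun t => M ^+ 2 * normc (f t) ^+ 2)).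
- exact: cmeasM.
- exact: integrableZr.
- move=> t; rewrite normc_mul exprMn ler_wpM2r ?sqr_ge0 //.
  by rewrite lerXn2r ?nnegrE ?normc_ge0 // (le_trans (normc_ge0 _) (gM t)).
Qed.

Lemma sqintZ c (f : R -> C) : sqint f -> sqint (fun t => c * f t).
Proof. by move=> sf; apply: (sqintM_bd sf (cmeas_cst c) (M := normc c)). Qed.

Lemma sqintN (f : R -> C) : sqint f -> sqint (fun t => - f t).
Proof.
by move=> /(sqintZ (-1)); congr sqint; apply/funext => t; rewrite mulN1r.
Qed.

Lemma sqint0 : sqint (fun=> 0).
Proof.
split; first exact: cmeas_cst.
rewrite (_ : _ \o _ = cst 0%E); first exact: integrable0.
by apply/funext => t; rewrite /comp normc_sq /= expr0n addr0.
Qed.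

Lemma integrable_cst (r : R) : mu.-integrable setT (EFin \o (fun=> r)).
Proof.
apply/integrableP; split; first exact/measurable_EFinP/measurable_cst.
rewrite integral_cst //.
have m1 : (mu setT = 1)%E by exact: probability_setT.
by apply: (@eq_ind_r _ _ (fun x => `|r%:E| * x < +oo)%E _ _ m1); rewrite mule1 ltry.
Qed.

Lemma sqint_bd (g : R -> C) (M : R) : cmeas g -> (forall t, normc (g t) <= M) ->
  sqint g.
Proof.
move=> mg gM; apply: (sqint_le mg (integrable_cst (M ^+ 2))) => t.
by rewrite lerXn2r ?nnegrE ?normc_ge0 // (le_trans (normc_ge0 _) (gM t)).
Qed.

Lemma sqint_cst c : sqint (fun=> c).
Proof. exact: (sqint_bd (cmeas_cst c) (M := normc c)). Qed.

Lemma sqint_sum (I : Type) (s : seq I) (P : pred I) (F : I -> R -> C) :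
  (forall i, sqint (F i)) -> sqint (fun t => \sum_(i <- s | P i) F i t).
Proof.
move=> mF; elim: s => [|i s IH].
  rewrite (_ : (fun _ => _) = fun=> 0); first exact: sqint0.
  by apply/funext => t; rewrite big_nil.
have [Pi|nPi] := boolP (P i).
  rewrite (_ : (fun _ => _) = fun t => F i t + \sum_(i <- s | P i) F i t).
    exact: sqintD.
  by apply/funext => t; rewrite big_cons Pi.
rewrite (_ : (fun _ => _) = fun t => \sum_(i <- s | P i) F i t) //.
by apply/funext => t; rewrite big_cons (negbTE nPi).
Qed.

Lemma cintgM (f g : R -> C) : sqint f -> sqint g -> cintg (fun t => f t * g t).
Proof.
move=> [mf jf] [mg ig]; apply: (@cintg_le _ _ (fun t => normc (f t) ^+ 2 + normc (g t) ^+ 2)).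
- exact: cmeasM.
- exact: integrableDR.
- by move=> t; exact: normc_mul_le.
Qed.

Lemma cintgMJ (f g : R -> C) : sqint f -> sqint g -> cintg (fun t => f t * (g t)^*).
Proof. by move=> sf /sqintJ; exact: cintgM. Qed.

Lemma sqint_cintg (f : R -> C) : sqint f -> cintg f.
Proof.
move=> sf; have := cintgM sf (sqint_cst 1); congr cintg.
by apply/funext => t; rewrite mulr1.
Qed.

Section Vector.
Context {n : nat}.
Implicit Types (f g h : R -> 'cV[C]_n).

Lemma enorm_sq (x : 'cV[C]_n) : enorm x ^+ 2 = \sum_i normc (x i 0) ^+ 2.
Proof. by rewrite sqr_sqrtr // sumr_ge0 // => i _; exact: sqr_ge0. Qed.

Lemma enorm_ge0 (x : 'cV[C]_n) : 0 <= enorm x.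
Proof. exact: sqrtr_ge0. Qed.

Lemma mxmeasP f : measurable_mxfun f <-> forall i, cmeas (fun t => f t i 0).
Proof.
split=> [mf i|mf i j]; first exact: mf.
by rewrite ord1; exact: mf.
Qed.

Lemma measurable_enorm_sq f : measurable_mxfun f ->
  measurable_fun setT (fun t => enorm (f t) ^+ 2).
Proof.
move=> /mxmeasP mf; under eq_fun do rewrite enorm_sq.
by apply: measurable_sum => i; exact: cmeas_normc.
Qed.

Lemma L2normE_int f : measurable_mxfun f ->
  L2norm f = poweR (\int[mu]_t (enorm (f t) ^+ 2)%:E) 2^-1.
Proof.
move=> mf; rewrite /L2norm unlock /=; congr poweR.
apply: eq_integral => t _ /=.
by rewrite ger0_norm ?enorm_ge0 // powR_mulrn ?enorm_ge0.
Qed.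

Lemma L2P f : L2 f <-> measurable_mxfun f /\
  mu.-integrable setT (EFin \o (fun t => enorm (f t) ^+ 2)).
Proof.
split=> -[mf fi]; split=> //; last first.
  rewrite L2normE_int //.
  have /integrableP[_] := fi.
  under eq_integral do rewrite /= ger0_norm ?sqr_ge0 //.
  by move=> h; exact: poweR_lty.
apply/integrableP; split.
  by apply/measurable_EFinP; exact: measurable_enorm_sq.
under eq_integral do rewrite /= ger0_norm ?sqr_ge0 //.
by move: fi; rewrite L2normE_int // => /(lty_poweRy _); apply; rewrite invr_eq0.
Qed.

Lemma L2_sqint f : L2 f <-> forall i, sqint (fun t => f t i 0).
Proof.
split=> [/L2P[/mxmeasP mf fi] i|sf].
  apply: sqint_le (mf i) fi _ => t /=.
  by rewrite enorm_sq (bigD1 i) //= lerDl sumr_ge0 // => j _; exact: sqr_ge0.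
apply/L2P; split; first by apply/mxmeasP => i; have [] := sf i.
rewrite (_ : _ \o _ = fun t => \sum_(i < n) (normc (f t i 0) ^+ 2)%:E)%E.
  by apply: integrable_sum => // i _; have [] := sf i.
by apply/funext => t /=; rewrite enorm_sq sumEFin.
Qed.

Lemma L2_cintg f g : L2 f -> L2 g ->
  cintg (fun t => \sum_(i < n) f t i 0 * (g t i 0)^*).
Proof.
move=> /L2_sqint sf /L2_sqint sg; apply: cintg_sum => i.
exact: cintgMJ.
Qed.

Lemma inner2E f g : L2 f -> L2 g -> inner2 f g =
  \sum_(i < n) integralC (fun t => f t i 0 * (g t i 0)^*).
Proof.
move=> /L2_sqint sf /L2_sqint sg; rewrite /inner2 integralC_sum // => i.
exact: cintgMJ.
Qed.

Lemma L2_0 : L2 (fun=> 0 : 'cV[C]_n).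
Proof.
apply/L2_sqint => i; rewrite (_ : (fun _ => _) = fun=> 0); first exact: sqint0.
by apply/funext => t; rewrite mxE.
Qed.

Lemma L2D f g : L2 f -> L2 g -> L2 (fun t => f t + g t).
Proof.
move=> /L2_sqint sf /L2_sqint sg; apply/L2_sqint => i.
by under eq_fun do rewrite mxE; exact: sqintD.
Qed.

Lemma L2Z c f : L2 f -> L2 (fun t => c *: f t).
Proof.
move=> /L2_sqint sf; apply/L2_sqint => i.
by under eq_fun do rewrite mxE; exact: sqintZ.
Qed.

Lemma L2N f : L2 f -> L2 (fun t => - f t).
Proof.
by move=> /(L2Z (-1)); congr (L2 _); apply/funext => t; rewrite scaleN1r.
Qed.

Lemma L2B f g : L2 f -> L2 g -> L2 (fun t => f t - g t).
Proof. by move=> Lf /L2N; exact: L2D. Qed.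

Lemma L2_lin c f g : L2 f -> L2 g -> L2 (fun t => c *: f t + g t).
Proof. by move=> /(L2Z c); exact: L2D. Qed.

Lemma inner2Dl f g h : L2 f -> L2 g -> L2 h ->
  inner2 (fun t => f t + g t) h = inner2 f h + inner2 g h.
Proof.
move=> Lf Lg Lh; rewrite /inner2 -integralCD; try exact: L2_cintg.
congr integralC; apply/funext => t; rewrite -big_split /=.
by apply: eq_bigr => i _; rewrite mxE mulrDl.
Qed.

Lemma inner2Zl c f h : L2 f -> L2 h ->
  inner2 (fun t => c *: f t) h = c * inner2 f h.
Proof.
move=> Lf Lh; rewrite /inner2 -integralCZ; try exact: L2_cintg.
congr integralC; apply/funext => t; rewrite mulr_sumr /=.
by apply: eq_bigr => i _; rewrite mxE mulrA.
Qed.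

Lemma inner2_conj f g : L2 f -> L2 g -> inner2 g f = (inner2 f g)^*.
Proof.
move=> Lf Lg; rewrite /inner2 -integralCJ; last exact: L2_cintg.
congr integralC; apply/funext => t; rewrite rmorph_sum /=.
by apply: eq_bigr => i _; rewrite rmorphM /= mulrC conjCK.
Qed.

Lemma inner2Dr f g h : L2 f -> L2 g -> L2 h ->
  inner2 h (fun t => f t + g t) = inner2 h f + inner2 h g.
Proof.
move=> Lf Lg Lh; have LD := L2D Lf Lg.
by rewrite inner2_conj // inner2Dl // rmorphD /= -!inner2_conj.
Qed.

Lemma inner2Zr c f h : L2 f -> L2 h ->
  inner2 h (fun t => c *: f t) = c^* * inner2 h f.
Proof.
move=> Lf Lh; have LD := L2Z c Lf.
by rewrite inner2_conj // inner2Zl // rmorphM /= -!inner2_conj.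
Qed.

Lemma inner2Nl f h : L2 f -> L2 h -> inner2 (fun t => - f t) h = - inner2 f h.
Proof.
move=> Lf Lh; rewrite -mulN1r -inner2Zl //; congr inner2.
by apply/funext => t; rewrite scaleN1r.
Qed.

Lemma inner2Nr f h : L2 f -> L2 h -> inner2 h (fun t => - f t) = - inner2 h f.
Proof.
by move=> Lf Lh; rewrite inner2_conj ?inner2Nl ?rmorphN /= -?inner2_conj //; exact: L2N.
Qed.

Lemma inner2Bl f g h : L2 f -> L2 g -> L2 h ->
  inner2 (fun t => f t - g t) h = inner2 f h - inner2 g h.
Proof. by move=> Lf Lg Lh; rewrite inner2Dl ?inner2Nl //; exact: L2N. Qed.

Lemma inner20l h : inner2 (fun=> 0 : 'cV[C]_n) h = 0.
Proof.
rewrite /inner2 -[RHS](@integralC0 R); congr integralC; apply/funext => t.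
by rewrite big1 // => i _; rewrite mxE mul0r.
Qed.

Lemma inner2_ae f f' g : measurable_mxfun f -> measurable_mxfun f' ->
  measurable_mxfun g -> f =ae f' -> inner2 f g = inner2 f' g.
Proof.
move=> /mxmeasP mf /mxmeasP mf' /mxmeasP mg /ae_eqP ff'; apply: integralC_ae.
- by apply: cmeas_sum => i; apply: cmeasM => //; exact: cmeasJ.
- by apply: cmeas_sum => i; apply: cmeasM => //; exact: cmeasJ.
- by apply: filterS ff' => t ->.
Qed.

(** The squared norm as a real number, so that ring and order reasoning applies where [L2norm] takes
    extended real values; by [inner2ff] the real part loses nothing. *)
Definition nsq f : R := complex.Re (inner2 f f).

Lemma nsqE f : nsq f = Rintegral mu setT (fun t => enorm (f t) ^+ 2).
Proof.
rewrite /nsq /inner2 /=; apply: eq_Rintegral => t _.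
by rewrite Re_sum enorm_sq; apply: eq_bigr => i _; rewrite Re_mulJ.
Qed.

Lemma nsq_ge0 f : 0 <= nsq f.
Proof. by rewrite nsqE; apply: Rintegral_ge0 => t _; exact: sqr_ge0. Qed.

Lemma inner2ff f : inner2 f f = (nsq f)%:C%C.
Proof.
apply/eqP; rewrite eq_complex /= eqxx /=.
rewrite (_ : (fun _ => _) = fun=> 0) ?Rintegral_cst ?mul0r //.
apply/funext => t; under eq_bigr do rewrite mulJ_normc.
by elim/big_ind : _ => // x y x0 y0; rewrite ImD x0 y0 addr0.
Qed.

Lemma L2norm_nsq f : L2 f -> L2norm f = (Num.sqrt (nsq f))%:E.
Proof.
move=> /L2P[mf fi]; rewrite L2normE_int // nsqE /Rintegral.
rewrite poweR12_sqrt; last by apply: integral_ge0 => t _; rewrite lee_fin sqr_ge0.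
have := integrable_fin_num measurableT fi.
by rewrite /=; case: (integral _ _ _).
Qed.

Lemma nsq_eq0 f : L2 f -> nsq f = 0 -> f =ae (fun=> 0).
Proof.
move=> /L2P[mf fi]; rewrite nsqE => f0.
have : (\int[mu]_t `|(enorm (f t) ^+ 2)%:E| = 0)%E.
  under eq_integral do rewrite /= ger0_norm ?sqr_ge0 //.
  have := integrable_fin_num measurableT fi.
  by move: f0; rewrite /Rintegral /=; case: (integral _ _ _) => //= r ->.
move=> /ae_eq_integral_abs /= h.
have {}h := h measurableT (measurable_int _ fi).
apply/ae_eqP; apply: filterS h => t /(_ I) /= [].
rewrite enorm_sq => /eqP; rewrite psumr_eq0 => [/allP ft|i _]; last exact: sqr_ge0.
apply/matrixP => i j; rewrite mxE ord1.
have := ft i (mem_index_enum i); rewrite /= sqrf_eq0 => /eqP.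
exact: ComplexField.Normc.eq0_normc.
Qed.

Lemma nsq_ae f g : measurable_mxfun f -> measurable_mxfun g ->
  f =ae g -> nsq f = nsq g.
Proof.
move=> mf mg /ae_eqP fg; rewrite !nsqE; apply: Rintegral_ae.
- exact: measurable_enorm_sq.
- exact: measurable_enorm_sq.
- by apply: filterS fg => t ->.
Qed.

Lemma nsqZ c f : L2 f -> nsq (fun t => c *: f t) = normc c ^+ 2 * nsq f.
Proof.
move=> Lf; rewrite /nsq inner2Zl ?inner2Zr //; last exact: L2Z.
by rewrite mulrA mulJ_normc ReM /= mul0r subr0.
Qed.

Lemma nsqD f g : L2 f -> L2 g ->
  nsq (fun t => f t + g t) = nsq f + nsq g + 2 * complex.Re (inner2 f g).
Proof.
move=> Lf Lg; have LD := L2D Lf Lg.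
rewrite /nsq inner2Dl // !inner2Dr // (inner2_conj Lf Lg) !ReD ReJ; ring.
Qed.

Lemma nsqB f g : L2 f -> L2 g ->
  nsq (fun t => f t - g t) = nsq f + nsq g - 2 * complex.Re (inner2 f g).
Proof.
move=> Lf Lg; rewrite nsqD ?inner2Nr ?ReN //; last exact: L2N.
rewrite (_ : nsq (fun t => - g t) = nsq g); first ring.
by rewrite /nsq inner2Nl ?inner2Nr ?opprK //; exact: L2N.
Qed.

(* The discriminant of the nonnegative quadratic r |-> nsq (r f - g). *)
Lemma cauchy_schwarz f g : L2 f -> L2 g ->
  complex.Re (inner2 f g) ^+ 2 <= nsq f * nsq g.
Proof.
move=> Lf Lg.
have q (r : R) : 0 <= r ^+ 2 * nsq f + nsq g - 2 * r * complex.Re (inner2 f g).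
  have := nsq_ge0 (fun t => r%:C%C *: f t - g t).
  rewrite nsqB ?nsqZ ?inner2Zl //; last exact: L2Z.
  by rewrite ReM /= mul0r subr0 expr0n /= addr0 sqrtr_sqr real_normK ?num_real // mulrA.
have := nsq_ge0 f; rewrite le_eqVlt => /orP[/eqP f0|f0]; last first.
  (* The minimizer of the quadratic. *)
  have := q (complex.Re (inner2 f g) / nsq f).
  set p := complex.Re _; set a := nsq f in f0 *; set b := nsq g => h.
  have -> : p ^+ 2 = a * b - a * ((p / a) ^+ 2 * a + b - 2 * (p / a) * p).
    by field; rewrite gt_eqF.
  by rewrite gerBl mulr_ge0 // ltW.
rewrite -f0 mul0r.
set p := complex.Re _ in q *; have [->|p0] := eqVneq p 0; first by rewrite expr0n.
(* With [nsq f = 0] the quadratic is affine, and at this point it would equal [- nsq g - 2], which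
   is negative. *)
have := q ((nsq g + 1) / p); rewrite -f0 mulr0 add0r.
rewrite (_ : _ - _ = - nsq g - 2); last by field.
by have := nsq_ge0 g; lra.
Qed.

Definition l2 f : R := Num.sqrt (nsq f).

Lemma l2_ge0 f : 0 <= l2 f. Proof. exact: sqrtr_ge0. Qed.

Lemma l2_sq f : l2 f ^+ 2 = nsq f.
Proof. by rewrite sqr_sqrtr ?nsq_ge0. Qed.

Lemma Re_inner2_le f g : L2 f -> L2 g -> complex.Re (inner2 f g) <= l2 f * l2 g.
Proof.
move=> Lf Lg; apply: le_trans (ler_norm _) _.
rewrite -(@ler_pXn2r _ 2) ?nnegrE ?mulr_ge0 ?l2_ge0 //.
by rewrite real_normK ?num_real // exprMn !l2_sq cauchy_schwarz.
Qed.

Lemma l2D f g : L2 f -> L2 g -> l2 (fun t => f t + g t) <= l2 f + l2 g.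
Proof.
move=> Lf Lg; rewrite -(@ler_pXn2r _ 2) ?nnegrE ?addr_ge0 ?l2_ge0 //.
rewrite l2_sq nsqD // sqrrD !l2_sq.
by have := Re_inner2_le Lf Lg; lra.
Qed.

Lemma l2Z c f : L2 f -> l2 (fun t => c *: f t) = normc c * l2 f.
Proof.
move=> Lf; rewrite /l2 nsqZ // sqrtrM ?sqr_ge0 //.
by rewrite sqrtr_sqr ger0_norm ?normc_ge0.
Qed.

Lemma l2_0 : l2 (fun=> 0 : 'cV[C]_n) = 0.
Proof. by rewrite /l2 /nsq inner20l sqrtr0. Qed.

Lemma l2BC f g : L2 f -> L2 g -> l2 (fun t => f t - g t) = l2 (fun t => g t - f t).
Proof.
move=> Lf Lg; rewrite (_ : (fun t => g t - f t) = fun t => (-1) *: (f t - g t)).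
  rewrite l2Z; last exact: L2B.
  by rewrite /ComplexField.Normc.normc /= !oppr0 expr0n addr0 sqrrN expr1n sqrtr1 mul1r.
by apply/funext => t; rewrite scaleN1r opprB.
Qed.

Lemma L2dist_l2 f g : L2 f -> L2 g -> L2dist f g = (l2 (fun t => f t - g t))%:E.
Proof. by move=> Lf Lg; rewrite /L2dist L2norm_nsq //; exact: L2B. Qed.

End Vector.
End InnerProduct.

(** * The Riesz-Fischer theorem for real functions *)

Section Completeness.
Context {R : realType}.
Local Notation mu := (@arc_length R).

Lemma ge0_integrable (f : R -> R) : measurable_fun setT f ->
  (forall t, 0 <= f t) -> (\int[mu]_t (f t)%:E < +oo)%E ->
  mu.-integrable setT (EFin \o f).
Proof.
move=> mf f0 fi; apply/integrableP; split; first exact/measurable_EFinP.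
under eq_integral do rewrite /= ger0_norm ?f0 //.
exact: fi.
Qed.

Lemma limn_einf_le (u : (\bar R)^nat) (c : \bar R) :
  (forall n, (u n <= c)%E) -> (limn_einf u <= c)%E.
Proof.
move=> uc; rewrite limn_einf_lim; apply: lime_le; first exact: is_cvg_einfs.
near=> n; apply: le_trans (uc n); apply: ereal_inf_lbound; exists n => //=.
Unshelve. all: by end_near. Qed.

Lemma half_geometric_sum n :
  \sum_(0 <= j < n) ((2^-1 : R) ^+ j)%:E = (2 - 2 * (2^-1) ^+ n)%:E :> \bar R.
Proof.
elim: n => [|n IH]; first by rewrite big_nil expr0 mulr1 subrr.
rewrite big_nat_recr //= IH -EFinD; congr EFin.
by rewrite exprS; field.
Qed.

(** The integrals of the absolute increments are at most $2^{-j}$, hence summable; so the sum of the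
    absolute increments is integrable, finite almost everywhere, and the telescoping series
    converges absolutely there. *)
Lemma ae_cvg_of_sq_increments (w : nat -> R -> R) :
  (forall j, measurable_fun setT (w j)) ->
  (forall j, (\int[mu]_t ((w j.+1 t - w j t) ^+ 2)%:E <= ((4^-1) ^+ j)%:E)%E) ->
  {ae mu, forall t, cvgn (fun j => w j t)}.
Proof.
move=> mw wi.
pose d j t := `|w j.+1 t - w j t|.
have md j : measurable_fun setT (fun t => (d j t)%:E).
  apply/measurable_EFinP; apply: measurableT_comp => //.
  exact: measurable_funB.
have d0 j t : (0 <= (d j t)%:E)%E by rewrite lee_fin normr_ge0.
have id j : (\int[mu]_t (d j t)%:E <= ((2^-1) ^+ j)%:E)%E.
  (* The weighted inequality $|x|\le(2^jx^2+2^{-j})/2$: the weight makes both halves of the integral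
     at most $2^{-j}/2$. *)
  pose h t := (2 ^+ j * (w j.+1 t - w j t) ^+ 2 + (2^-1) ^+ j) / 2.
  apply: (@le_trans _ _ (\int[mu]_t (h t)%:E)%E).
    have mh : measurable_fun setT h.
      rewrite /h; apply: measurable_funM => //.
      apply: measurable_funD => //; apply: measurable_funM => //.
      by apply: measurable_funX; exact: measurable_funB.
    apply: ge0_le_integral => //.
    - exact: md.
    - exact/measurable_EFinP.
    - move=> t _; rewrite lee_fin /h /d exprVn.
      rewrite -(real_normK (num_real (w j.+1 t - w j t))).
      move: `|_| => x; have p0 : (0 : R) < 2 ^+ j by rewrite exprn_gt0.
      rewrite ler_pdivlMr // -subr_ge0.
      rewrite (_ : _ - _ = (2 ^+ j * x - 1) ^+ 2 / 2 ^+ j); last by field; rewrite gt_eqF.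
      by rewrite divr_ge0 ?sqr_ge0 // ltW.
  pose a := (2 : R) ^+ j / 2; pose b := (2^-1 : R) ^+ j / 2.
  have a0 : 0 <= a by rewrite divr_ge0 ?exprn_ge0.
  have b0 : 0 <= b by rewrite divr_ge0 ?exprn_ge0 ?invr_ge0.
  have -> : (\int[mu]_t (h t)%:E =
      \int[mu]_t (a%:E * ((w j.+1 t - w j t) ^+ 2)%:E + b%:E))%E.
    apply: eq_integral => t _; rewrite -EFinM -EFinD; congr EFin.
    by rewrite /h /a /b; field.
  have m2 : measurable_fun setT (fun t => ((w j.+1 t - w j t) ^+ 2)%:E).
    by apply/measurable_EFinP; apply: measurable_funX; exact: measurable_funB.
  rewrite ge0_integralD //; last 2 first.
  - by move=> t _; rewrite -EFinM lee_fin mulr_ge0 ?sqr_ge0.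
  - exact: measurable_funeM.
  rewrite ge0_integralZl //; last by move=> t _; rewrite lee_fin sqr_ge0.
  rewrite integral_cst //.
  have m1 : (mu setT = 1)%E by exact: probability_setT.
  apply: (@eq_ind_r _ _ (fun x => _ + b%:E * x <= _)%E _ _ m1); rewrite mule1.
  apply: (@le_trans _ _ (a%:E * ((4^-1) ^+ j)%:E + b%:E)%E).
    by rewrite leeD2r // lee_wpmul2l.
  rewrite -EFinM -EFinD lee_fin /a /b.
  rewrite (_ : (4^-1 : R) = 2^-1 * 2^-1); last by field.
  rewrite exprMn (_ : 2 ^+ j / 2 * _ = (2 * 2^-1) ^+ j * (2^-1) ^+ j / 2); last first.
    by rewrite exprMn; ring.
  by rewrite divff // expr1n; lra.
have : (\int[mu]_t (\sum_(0 <= j <oo) (d j t)%:E) < +oo)%E.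
  rewrite integral_nneseries //.
  apply: (@le_lt_trans _ _ 2%:E); last exact: ltry.
  apply: lime_le.
    by apply: is_cvg_nneseries => n _ _; exact: integral_ge0.
  near=> n; apply: (@le_trans _ _ (\sum_(0 <= j < n) ((2^-1 : R) ^+ j)%:E)).
    by apply: lee_sum => j _; exact: id.
  by rewrite half_geometric_sum lee_fin gerBl mulr_ge0 // exprn_ge0 // invr_ge0.
move=> fin.
have : mu.-integrable setT (fun t => \sum_(0 <= j <oo) (d j t)%:E)%E.
  apply/integrableP; split.
    by apply: ge0_emeasurable_sum => // j _; exact: md.
  under eq_integral do rewrite gee0_abs ?nneseries_ge0 //.
  exact: fin.
move=> /(integrable_ae measurableT); apply: filterS => t /(_ I) ft.
have : cvgn (series (fun j => d j t)).
  apply: nnseries_is_cvg => [i|]; first exact: normr_ge0.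
  by rewrite ltey_eq ft.
move=> /normed_cvg cs.
have -> : (fun j => w j t) = (fun j => w 0%N t + series (telescope (fun j => w j t)) j).
  by apply/funext => j; exact: (eq_sum_telescope (fun j => w j t)).
by apply: is_cvgD; [exact: is_cvg_cst|exact: cs].
Unshelve. all: by end_near. Qed.

(** A subsequence with rapidly decreasing increments converges almost everywhere, and Fatou's lemma
    carries the Cauchy estimate over to its limit. *)
Lemma riesz_fischer_real (u : nat -> R -> R) :
  (forall k, measurable_fun setT (u k)) ->
  (forall eps : R, 0 < eps -> exists N, forall k l, (N <= k)%N -> (N <= l)%N ->
     (\int[mu]_t ((u k t - u l t) ^+ 2)%:E <= eps%:E)%E) ->
  exists2 v : R -> R, measurable_fun setT v &
    forall eps : R, 0 < eps -> exists N, forall k, (N <= k)%N ->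
     (\int[mu]_t ((u k t - v t) ^+ 2)%:E <= eps%:E)%E.
Proof.
move=> mu_ cu.
have e4 j : 0 < (4^-1 : R) ^+ j by rewrite exprn_gt0 // invr_gt0.
pose N j := sval (cid (cu _ (e4 j))).
have HN j : forall k l, (N j <= k)%N -> (N j <= l)%N ->
     (\int[mu]_t ((u k t - u l t) ^+ 2)%:E <= ((4^-1) ^+ j)%:E)%E.
  by rewrite /N; case: cid.
(* The running maximum ensures that every [s (j + i)] lies beyond [N j], as the final estimate
   requires. *)
pose s j := \max_(i < j.+1) N i.
have sN j i : (i <= j)%N -> (N i <= s j)%N.
  by move=> ij; rewrite /s (leq_bigmax (Ordinal (ij : (i < j.+1)%N))).
pose w j := u (s j).
have mw j : measurable_fun setT (w j) by exact: mu_.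
have cw := ae_cvg_of_sq_increments mw
  (fun j => HN j _ _ (sN j.+1 j (leqnSn j)) (sN j j (leqnn j))).
(* The upper limit is defined and measurable everywhere; on the null set without convergence its
   value does not matter. *)
pose v t := fine (limn_esup (fun j => (w j t)%:E)).
have mv : measurable_fun setT v.
  apply: (measurableT_comp (fine_measurable measurableT)).
  by apply: measurable_fun_limn_esup => n; exact/measurable_EFinP.
exists v => // eps eps0.
have /cvgrPdist_lt /(_ _ eps0) : ((4^-1 : R) ^+ n @[n --> \oo] --> 0).
  by apply: cvg_expr; rewrite ger0_norm ?invr_ge0 // invf_lt1 // ltr1n.
case=> j _ /(_ j (leqnn j)) /=; rewrite sub0r normrN ger0_norm ?ltW // => je.
exists (N j) => k jk; apply: (@le_trans _ _ ((4^-1 : R) ^+ j)%:E); last by rewrite lee_fin ltW.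
have m2 (f : R -> R) : measurable_fun setT f ->
    measurable_fun setT (fun t => ((u k t - f t) ^+ 2)%:E).
  by move=> mf; apply/measurable_EFinP; apply: measurable_funX; exact: measurable_funB.
(* Almost everywhere the integrand is the limit, hence the lower limit, of the squared distances to
   the subsequence; this is the form in which Fatou's lemma applies. *)
apply: (@le_trans _ _ (\int[mu]_t limn_einf (fun i => ((u k t - w (j + i)%N t) ^+ 2)%:E))%E).
  rewrite le_eqVlt; apply/orP; left; apply/eqP; apply: ge0_ae_eq_integral => //.
  - exact: m2.
  - apply: (@eq_measurable_fun _ _ _ _ _
      (fun t => - limn_esup (fun i => - ((u k t - w (j + i)%N t) ^+ 2)%:E))%E).
      move=> t _; rewrite -limn_einfN; congr limn_einf; apply/funext => i.
      by rewrite /comp oppeK.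
    apply: measurableT_comp => //; apply: measurable_fun_limn_esup => i.
    by apply: measurableT_comp => //; exact: m2.
  - by move=> t _; rewrite lee_fin sqr_ge0.
  - move=> t _; rewrite limn_einf_lim; apply: lime_ge; first exact: is_cvg_einfs.
    near=> n; apply: le_ereal_inf_tmp => _ [i _ <-].
    by rewrite lee_fin sqr_ge0.
  apply: filterS cw => t ct _; apply/esym.
  have wv : w i t @[i --> \oo] --> v t.
    rewrite /v (_ : limn_esup _ = (limn (fun i => w i t))%:E) //.
    have cE : (w i t)%:E @[i --> \oo] --> (limn (fun i => w i t))%:E.
      by apply: cvg_EFin => //; near=> i.
    by have [_ ->] := cvg_limn_einf_sup cE.
  have cE : ((u k t - w (j + i)%N t) ^+ 2)%:E @[i --> \oo] --> ((u k t - v t) ^+ 2)%:E.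
    apply: cvg_EFin; first by near=> i.
    rewrite (_ : _ \o _ = fun i => (u k t - w (j + i)%N t) * (u k t - w (j + i)%N t)).
      rewrite expr2; have wj : w (j + i)%N t @[i --> \oo] --> v t.
        exact: (cvg_comp _ _ (cvg_addnl j) wv).
      by apply: cvgM; apply: cvgB => //; exact: cvg_cst.
    by apply/funext => i /=; rewrite expr2.
  by have [-> _] := cvg_limn_einf_sup cE.
apply: le_trans (fatou _ _ _ _) _ => //.
- by move=> i; exact: m2.
- by move=> i t _; rewrite lee_fin sqr_ge0.
apply: limn_einf_le => i; apply: HN => //.
by apply: sN; rewrite leq_addr.
Unshelve. all: by end_near. Qed.

End Completeness.

(** * Completeness of $L^2(\mathbb C^n)$ and orthogonal projections *)

Section Projection.
Context {R : realType} {n : nat}.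
Local Notation C := R[i].
Local Notation mu := (@arc_length R).
Implicit Types (f g h e : R -> 'cV[C]_n) (E : set (R -> 'cV[C]_n)).

Lemma nsq_int f : L2 f -> (\int[mu]_t (enorm (f t) ^+ 2)%:E)%E = (nsq f)%:E.
Proof.
move=> /L2P[mf fi]; rewrite nsqE /Rintegral.
have := integrable_fin_num measurableT fi.
by rewrite /=; case: (integral _ _ _).
Qed.

Lemma enorm_sq_split (x : 'cV[C]_n) :
  enorm x ^+ 2 = \sum_i (complex.Re (x i 0) ^+ 2 + complex.Im (x i 0) ^+ 2).
Proof. by rewrite enorm_sq; apply: eq_bigr => i _; rewrite normc_sq. Qed.

(** The real and imaginary parts of the coordinates are dominated by the norm, so each of them is
    Cauchy and has a limit; the limits are reassembled into [g]. *)
Lemma L2_complete (f : nat -> R -> 'cV[C]_n) : (forall k, L2 (f k)) ->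
  (forall eps : R, 0 < eps -> exists N, forall k l, (N <= k)%N -> (N <= l)%N ->
     nsq (fun t => f k t - f l t) <= eps) ->
  exists2 g, L2 g & forall eps : R, 0 < eps -> exists N, forall k, (N <= k)%N ->
     nsq (fun t => f k t - g t) <= eps.
Proof.
move=> Lf cf.
have mf k i : cmeas (fun t => f k t i 0) by have /L2P[/mxmeasP] := Lf k.
have part (p : C -> R) (i : 'I_n) :
    (forall x y, p (x - y) = p x - p y) ->
    (forall x : 'cV[C]_n, p (x i 0) ^+ 2 <= enorm x ^+ 2) ->
    (forall k, measurable_fun setT (fun t => p (f k t i 0))) ->
    exists2 v : R -> R, measurable_fun setT v &
    forall eps : R, 0 < eps -> exists N, forall k, (N <= k)%N ->
     (\int[mu]_t ((p (f k t i 0) - v t) ^+ 2)%:E <= eps%:E)%E.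
  move=> pB ple mp; apply: riesz_fischer_real => // eps /cf[N HN].
  exists N => k l Nk Nl; have Lkl := L2B (Lf k) (Lf l).
  have /L2P[mkl _] := Lkl.
  apply: (@le_trans _ _ (\int[mu]_t (enorm (f k t - f l t) ^+ 2)%:E)%E); last first.
    by rewrite nsq_int // lee_fin HN.
  apply: ge0_le_integral => //.
  - by move=> t _; rewrite lee_fin sqr_ge0.
  - by apply/measurable_EFinP; apply: measurable_funX; apply: measurable_funB; exact: mp.
  - by apply/measurable_EFinP; exact: measurable_enorm_sq.
  - move=> t _; rewrite lee_fin -pB.
    by have := ple (f k t - f l t); rewrite !mxE.
have re i : exists2 v : R -> R, measurable_fun setT v &
    forall eps : R, 0 < eps -> exists N, forall k, (N <= k)%N ->
     (\int[mu]_t ((complex.Re (f k t i 0) - v t) ^+ 2)%:E <= eps%:E)%E.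
  apply: part => [x y|x|k]; first by rewrite ReD ReN.
  - rewrite enorm_sq_split (bigD1 i) //= -addrA lerDl addr_ge0 ?sqr_ge0 //.
    by apply: sumr_ge0 => j _; rewrite addr_ge0 ?sqr_ge0.
  - by have [] := mf k i.
have im i : exists2 v : R -> R, measurable_fun setT v &
    forall eps : R, 0 < eps -> exists N, forall k, (N <= k)%N ->
     (\int[mu]_t ((complex.Im (f k t i 0) - v t) ^+ 2)%:E <= eps%:E)%E.
  apply: part => [x y|x|k]; first by rewrite ImD ImN.
  - rewrite enorm_sq_split (bigD1 i) //= addrAC lerDr addr_ge0 ?sqr_ge0 //.
    by apply: sumr_ge0 => j _; rewrite addr_ge0 ?sqr_ge0.
  - by have [] := mf k i.
pose a i := s2val (cid2 (re i)).
have ma i : measurable_fun setT (a i) by rewrite /a; case: cid2.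
have ca i : forall eps : R, 0 < eps -> exists N, forall k, (N <= k)%N ->
     (\int[mu]_t ((complex.Re (f k t i 0) - a i t) ^+ 2)%:E <= eps%:E)%E.
  by rewrite /a; case: cid2.
pose b i := s2val (cid2 (im i)).
have mb i : measurable_fun setT (b i) by rewrite /b; case: cid2.
have cb i : forall eps : R, 0 < eps -> exists N, forall k, (N <= k)%N ->
     (\int[mu]_t ((complex.Im (f k t i 0) - b i t) ^+ 2)%:E <= eps%:E)%E.
  by rewrite /b; case: cid2.
pose g t : 'cV[C]_n := \col_i Complex (a i t) (b i t).
have mg : measurable_mxfun g.
  apply/mxmeasP => i; split; under eq_fun do rewrite mxE /=.
    exact: ma.
  exact: mb.
have mfg k : measurable_mxfun (fun t => f k t - g t).
  apply/mxmeasP => i; under eq_fun do rewrite !mxE.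
  split.
    by under eq_fun do rewrite ReD ReN /=; apply: measurable_funB => //; have [] := mf k i.
  by under eq_fun do rewrite ImD ImN /=; apply: measurable_funB => //; have [] := mf k i.
have cg (eps : R) : 0 < eps -> exists N, forall k, (N <= k)%N ->
     (\int[mu]_t (enorm (f k t - g t) ^+ 2)%:E <= eps%:E)%E.
  (* There are $2n$ real components and each may contribute [d]; [n.+1] covers the case [n = 0]. *)
  move=> eps0; pose d := eps / (2 * n.+1%:R).
  have d0 : 0 < d by rewrite divr_gt0 // mulr_gt0 // ltr0n.
  pose Na i := sval (cid (ca i _ d0)); pose Nb i := sval (cid (cb i _ d0)).
  exists (maxn (\max_i Na i) (\max_i Nb i)) => k; rewrite geq_max => /andP[ka kb].
  have mRe i : measurable_fun setT (fun t => ((complex.Re (f k t i 0) - a i t) ^+ 2)%:E).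
    by apply/measurable_EFinP; apply: measurable_funX; apply: measurable_funB => //; have [] := mf k i.
  have mIm i : measurable_fun setT (fun t => ((complex.Im (f k t i 0) - b i t) ^+ 2)%:E).
    by apply/measurable_EFinP; apply: measurable_funX; apply: measurable_funB => //; have [] := mf k i.
  have -> : (\int[mu]_t (enorm (f k t - g t) ^+ 2)%:E = \int[mu]_t (\sum_(i < n)
     (((complex.Re (f k t i 0) - a i t) ^+ 2)%:E + ((complex.Im (f k t i 0) - b i t) ^+ 2)%:E)))%E.
    apply: eq_integral => t _; rewrite enorm_sq_split -sumEFin; apply: eq_bigr => i _.
    by rewrite !mxE ReD ReN ImD ImN EFinD.
  rewrite ge0_integral_sum //; last 2 first.
  - by move=> i; apply: emeasurable_funD; [exact: mRe|exact: mIm].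
  - by move=> i t _; rewrite adde_ge0 // lee_fin sqr_ge0.
  apply: (@le_trans _ _ (\sum_(i < n) (2 * d)%:E)%E); last first.
    rewrite sumEFin lee_fin sumr_const card_ord -[leLHS]mulr_natr /d.
    have -> (x m : R) : 0 < m -> 2 * (eps / (2 * m)) * x = eps * (x / m).
      by move=> m0; field; rewrite gt_eqF.
      by apply: ler_piMr; rewrite ?(ltW eps0) // ler_pdivrMr ?ltr0n // mul1r ler_nat.
    exact: ltr0Sn.
  apply: lee_sum => i _; rewrite ge0_integralD //; first last.
  - exact: mIm.
  - by move=> t _; rewrite lee_fin sqr_ge0.
  - exact: mRe.
  - by move=> t _; rewrite lee_fin sqr_ge0.
  rewrite mulr_natl mulr2n EFinD; apply: leeD.
  - rewrite /Na in ka; have := leq_trans (leq_bigmax i) ka.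
    by case: cid => /= N; apply.
  - rewrite /Nb in kb; have := leq_trans (leq_bigmax i) kb.
    by case: cid => /= N; apply.
have Lfg k (eps : R) : (\int[mu]_t (enorm (f k t - g t) ^+ 2)%:E <= eps%:E)%E ->
    L2 (fun t => f k t - g t).
  move=> h; apply/L2P; split=> //; apply: ge0_integrable.
  - exact: measurable_enorm_sq.
  - by move=> t; exact: sqr_ge0.
  - exact: le_lt_trans h (ltry _).
have Lg : L2 g.
  have [N /(_ N (leqnn N)) /Lfg] := cg 1 ltr01.
  move=> /(L2B (Lf N)); congr (L2 _).
  by apply/funext => t; rewrite opprB addrC subrK.
exists g => // eps /cg[N HN]; exists N => k /HN.
by rewrite nsq_int ?lee_fin //; exact: L2B.
Qed.

Definition subspace E : Prop :=
  [/\ forall f, E f -> L2 f, E (fun=> 0) &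
      forall (c : C) f g, E f -> E g -> E (fun t => c *: f t + g t)].

Lemma subspaceZ E c f : subspace E -> E f -> E (fun t => c *: f t).
Proof.
move=> [_ E0 El] Ef; have := El c _ _ Ef E0; congr (E _).
by apply/funext => t; rewrite addr0.
Qed.

Lemma subspaceD E f g : subspace E -> E f -> E g -> E (fun t => f t + g t).
Proof.
move=> [_ E0 El] Ef Eg; have := El 1 _ _ Ef Eg; congr (E _).
by apply/funext => t; rewrite scale1r.
Qed.

Lemma subspaceB E f g : subspace E -> E f -> E g -> E (fun t => f t - g t).
Proof.
move=> sE Ef Eg; have := subspaceD sE Ef (subspaceZ (-1) sE Eg); congr (E _).
by apply/funext => t; rewrite scaleN1r.
Qed.

Lemma subspace_sum E (I : Type) (s : seq I) (P : pred I) (F : I -> R -> 'cV[C]_n) :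
  subspace E -> (forall i, E (F i)) -> E (fun t => \sum_(i <- s | P i) F i t).
Proof.
move=> sE EF; have [_ E0 _] := sE; elim: s => [|i s IH].
  by have := E0; congr (E _); apply/funext => t; rewrite big_nil.
case Pi : (P i); last first.
  by have := IH; congr (E _); apply/funext => t; rewrite big_cons Pi.
have := subspaceD sE (EF i) IH; congr (E _).
by apply/funext => t; rewrite big_cons Pi.
Qed.

Lemma subspace_lin E (I : finType) (c : I -> C) (F : I -> R -> 'cV[C]_n) :
  subspace E -> (forall i, E (F i)) -> E (fun t => \sum_i c i *: F i t).
Proof. by move=> sE EF; apply: subspace_sum => // i; exact: subspaceZ. Qed.

Lemma L2_subspace : subspace (@L2 R n).
Proof. by split; [|exact: L2_0|exact: L2_lin]. Qed.

(* A minimizing sequence for the distance from h to E is Cauchy by the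
   parallelogram law. *)
Lemma projection E h : subspace E -> L2 h ->
  exists g, [/\ L2 g,
    forall eps : R, 0 < eps -> exists2 e, E e & l2 (fun t => e t - g t) < eps &
    forall e, E e -> inner2 (fun t => h t - g t) e = 0].
Proof.
move=> sE Lh; have [EL2 E0 El] := sE.
pose D := [set nsq (fun t => h t - e t) | e in E].
have D0 : D !=set0 by exists (nsq (fun t => h t - 0)); exists (fun=> 0).
have Dlb : has_lbound D by exists 0 => _ [e _ <-]; exact: nsq_ge0.
pose d := inf D.
have dle e : E e -> d <= nsq (fun t => h t - e t).
  by move=> Ee; apply: ge_inf => //; exists e.
have mk k : exists2 e, E e & nsq (fun t => h t - e t) < d + k.+1%:R^-1.
  have : d < d + k.+1%:R^-1 by rewrite ltrDl invr_gt0 ltr0n.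
  by move=> /(inf_lt D0) [_ [e Ee <-] lt]; exists e.
pose e k := s2val (cid2 (mk k)).
have Ee k : E (e k) by rewrite /e; case: cid2.
have ed k : nsq (fun t => h t - e k t) < d + k.+1%:R^-1 by rewrite /e; case: cid2.
have Le k : L2 (e k) by exact: EL2.
have inv_small (eps : R) : 0 < eps -> exists N, forall k, (N <= k)%N -> k.+1%:R^-1 < eps.
  move=> eps0; have /cvgrPdist_lt /(_ _ eps0) [N _ HN] := @cvg_harmonic R.
  exists N => k /HN /=; rewrite sub0r normrN ger0_norm // invr_ge0 //.
(* The midpoint of [e k] and [e l] lies in [E], so its squared distance to [h] is at least [d]; the
   parallelogram law then bounds the distance between the two. *)
have par k l : nsq (fun t => e k t - e l t) <= 2 * (k.+1%:R^-1 + l.+1%:R^-1).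
  have L1 := L2B Lh (Le k); have L2' := L2B Lh (Le l).
  pose c : C := (2^-1 : R)%:C%C.
  have c2 : c * 2%:R = 1.
    by rewrite -(rmorph_nat (real_complex R)) -rmorphM mulVf ?pnatr_eq0 // rmorph1.
  have Em : E (fun t => c *: (e k t + e l t)).
    exact: subspaceZ sE (subspaceD sE (Ee k) (Ee l)).
  have := dle _ Em.
  rewrite (_ : (fun t => h t - _) = fun t => c *: ((h t - e k t) + (h t - e l t))); last first.
    apply/funext => t; rewrite addrACA -opprD scalerBr; congr (_ - _).
    by rewrite -(mulr2n (h t)) -(scaler_nat 2 (h t)) scalerA c2 scale1r.
  rewrite nsqZ; last exact: L2D.
  rewrite normc_sq /= expr0n addr0 (_ : 2^-1 ^+ 2 = 4^-1); last by field.
  rewrite nsqD // => h1.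
  rewrite (_ : (fun t => e k t - e l t) = fun t => (h t - e l t) - (h t - e k t)); last first.
    by apply/funext => t; rewrite opprB [RHS]addrC addrA subrK.
  rewrite nsqB // (inner2_conj L1 L2') ReJ.
  have := ed k; have := ed l; move: h1.
  move: (nsq _) (nsq _) (complex.Re _) k.+1%:R^-1 l.+1%:R^-1 => A B P u v.
  lra.
have [g Lg cg] : exists2 g, L2 g & forall eps : R, 0 < eps -> exists N, forall k, (N <= k)%N ->
     nsq (fun t => e k t - g t) <= eps.
  apply: L2_complete => // eps eps0.
  have /inv_small[N HN] : 0 < eps / 4 by rewrite divr_gt0.
  exists N => k l /HN hk /HN hl; apply: le_trans (par k l) _; move: hk hl.
  by move: k.+1%:R^-1 l.+1%:R^-1 => u v; lra.
have cg2 (eps : R) : 0 < eps -> exists N, forall k, (N <= k)%N -> l2 (fun t => e k t - g t) <= eps.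
  move=> eps0; have /cg[N HN] : 0 < eps ^+ 2 by rewrite exprn_gt0.
  exists N => k /HN; rewrite -l2_sq ler_pXn2r ?nnegrE ?l2_ge0 // ltW //.
have d0 : 0 <= d by apply: lb_le_inf => // _ [x _ <-]; exact: nsq_ge0.
have Lhg := L2B Lh Lg.
have le_lim x : E x -> Num.sqrt d <= l2 (fun t => h t - g t - x t).
  move=> Ex; have Lx := EL2 _ Ex; apply/ler_addgt0Pr => eps eps0.
  have [N /(_ N (leqnn N)) HN] := cg2 _ eps0.
  have Ex' := subspaceD sE (Ee N) Ex.
  apply: (@le_trans _ _ (l2 (fun t => h t - (e N t + x t)))).
    by rewrite /l2 ler_sqrt ?nsq_ge0 // dle.
  have -> : (fun t => h t - (e N t + x t)) = (fun t => (h t - g t - x t) + (g t - e N t)).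
    by apply/funext => t; rewrite opprD [RHS]addrAC addrA [h t - g t + _]addrA subrK.
  apply: le_trans (l2D _ _) _; [exact: L2B|exact: L2B|].
  by rewrite lerD2l l2BC.
have lim_le : nsq (fun t => h t - g t) <= d.
  rewrite -l2_sq -[leRHS]sqr_sqrtr //.
  rewrite ler_pXn2r ?nnegrE ?l2_ge0 ?sqrtr_ge0 //; apply/ler_addgt0Pr => eps eps0.
  have e2 : 0 < eps / 2 by rewrite divr_gt0.
  have [N1 HN1] := cg2 _ e2.
  have /inv_small[N2 HN2] : 0 < (eps / 2) ^+ 2 by rewrite exprn_gt0.
  pose k := maxn N1 N2; have {}HN1 := HN1 k (leq_maxl _ _); have {}HN2 := HN2 k (leq_maxr _ _).
  have -> : (fun t => h t - g t) = (fun t => (h t - e k t) + (e k t - g t)).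
    by apply/funext => t; rewrite addrA subrK.
  apply: le_trans (l2D _ _) _; [exact: L2B|exact: L2B|].
  have : l2 (fun t => h t - e k t) <= Num.sqrt d + eps / 2.
    rewrite -(@ler_pXn2r _ 2) ?nnegrE ?l2_ge0 ?addr_ge0 ?sqrtr_ge0 ?(ltW e2) //.
    rewrite l2_sq sqrrD sqr_sqrtr //.
    have := ed k; have : 0 <= Num.sqrt d * (eps / 2) by rewrite mulr_ge0 ?sqrtr_ge0 // ltW.
    move: HN2; move: (nsq _) (Num.sqrt d) k.+1%:R^-1 (eps / 2) => A B u v.
    by rewrite mulr2n; lra.
  by move: HN1; move: (l2 _) (l2 _) => A B; lra.
have Re0 x : E x -> complex.Re (inner2 (fun t => h t - g t) x) = 0.
  move=> Ex; have Lx := EL2 _ Ex; set p := complex.Re _.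
  have q (s : R) : 2 * s * p <= s ^+ 2 * nsq x.
    have := le_lim _ (subspaceZ s%:C%C sE Ex).
    rewrite -(@ler_pXn2r _ 2) ?nnegrE ?l2_ge0 ?sqrtr_ge0 // l2_sq sqr_sqrtr //.
    rewrite nsqB ?nsqZ ?inner2Zr //; last exact: L2Z.
    rewrite ReM ReJ ImJ -/p /= expr0n /= addr0 sqrtr_sqr real_normK ?num_real // oppr0 mul0r subr0.
    by move: lim_le; move: (nsq _) => A; lra.
  have [//|p0] := eqVneq p 0.
  (* A linear term cannot stay below a quadratic one near 0 unless it vanishes. The 1 in the
     denominator avoids dividing by [nsq x], which may be 0. *)
  have := q (p / (nsq x + 1)); have := nsq_ge0 x; move: (nsq x) => N N0.
  have N1 : 0 < N + 1 by lra.
  rewrite -subr_ge0 (_ : _ - _ = - (p ^+ 2 * ((N + 2) / (N + 1) ^+ 2))); last by field; lra.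
  have : 0 < p ^+ 2 * ((N + 2) / (N + 1) ^+ 2).
    by rewrite mulr_gt0 ?exprn_even_gt0 //= divr_gt0 ?exprn_gt0 //; lra.
  by lra.
exists g; split=> //.
  move=> eps eps0; have e2 : 0 < eps / 2 by rewrite divr_gt0.
  have [N /(_ N (leqnn N)) HN] := cg2 _ e2.
  by exists (e N) => //; lra.
(* Testing against $ix$ gives the vanishing of the imaginary part. *)
move=> x Ex; have := Re0 _ (subspaceZ 'i%C sE Ex); rewrite inner2Zr //; last exact: EL2.
have := Re0 _ Ex; case: (inner2 _ _) => a b /= ->.
by rewrite mulr0 sub0r mulN1r opprK => ->.
Qed.

Definition l2closed E : Prop := forall g, L2 g ->
  (forall eps : R, 0 < eps -> exists2 e, E e & l2 (fun t => e t - g t) < eps) -> E g.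

(** [xget] falls back to its default only if no projection exists; [projection] yields one in the
    closure of [E], which is [E] itself here. *)
Lemma orth_projP E f : subspace E -> l2closed E -> L2 f ->
  E (orth_proj E f) /\
  forall h, E h -> inner2 (fun t => f t - orth_proj E f t) h = 0.
Proof.
move=> sE cE Lf; rewrite /orth_proj; case: xgetP => [g -> //|].
have [g [Lg ag og]] := projection sE Lf.
by move=> /(_ g) []; split=> //; exact: cE.
Qed.

(** The difference between [h] and its projection onto the closure of [E] is orthogonal to [E],
    hence null, so the approximants of the projection approximate [h]. *)
Lemma dense_of_orth0 E : subspace E ->
  (forall l, L2 l -> (forall e, E e -> inner2 l e = 0) -> l =ae (fun=> 0)) ->
  forall h, L2 h -> forall eps : R, 0 < eps -> exists2 e, E e & l2 (fun t => e t - h t) < eps.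
Proof.
move=> sE o0 h Lh eps eps0; have [g [Lg ag og]] := projection sE Lh.
have Lhg := L2B Lh Lg.
have /(o0 _ Lhg)/ae_eqP hg := og.
have [e Ee lt] := ag _ eps0; exists e; first exact: Ee.
have [EL2 _ _] := sE; have Le := EL2 _ Ee.
have [/L2P[m1 _] /L2P[m2 _]] := (L2B Le Lh, L2B Le Lg).
apply: le_lt_trans lt; rewrite /l2 ler_sqrt ?nsq_ge0 // le_eqVlt; apply/orP; left; apply/eqP.
apply: nsq_ae => //.
by apply/ae_eqP; apply: filterS hg => t /eqP; rewrite subr_eq0 => /eqP ->.
Qed.

End Projection.

(** * Trigonometric polynomials approximating indicators of arcs *)

Section FourierUniqueness.
Context {R : realType}.
Local Notation C := R[i].
Local Notation mu := (@arc_length R).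
Local Notation normc := (@ComplexField.Normc.normc R).

Lemma bernoulli_ge (x : R) m : -1 <= x -> 1 + m%:R * x <= (1 + x) ^+ m.
Proof.
move=> x1; elim: m => [|m IH]; first by rewrite mul0r addr0 expr0.
have : (1 + x) * (1 + m%:R * x) <= (1 + x) * (1 + x) ^+ m.
  by rewrite ler_wpM2l //; lra.
rewrite -exprS -natr1; apply: le_trans.
rewrite -subr_ge0 (_ : _ - _ = m%:R * x ^+ 2); last by ring.
by rewrite mulr_ge0 ?sqr_ge0.
Qed.

(** The polynomials of the Brosowski-Deutsch proof of the Stone-Weierstrass theorem. On $[0,1]$ they
    tend to 1 below $1/2$ and to 0 above, so applied to a trigonometric polynomial that crosses
    $1/2$ at the ends of an arc they approach the indicator of the arc. *)
Definition sharpen n (y : R) : R := (1 - y ^+ n) ^+ (2 ^ n).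

Lemma sharpen_bound n y : 0 <= y <= 1 -> 0 <= sharpen n y <= 1.
Proof.
move=> /andP[y0 y1]; have h : 0 <= 1 - y ^+ n by rewrite subr_ge0 exprn_ile1.
by rewrite exprn_ge0 //= exprn_ile1 // gerBl exprn_ge0.
Qed.

(** Bernoulli's inequality gives the lower bound $1-(2y)^n$. *)
Lemma sharpen_cvg1 (y : R) : 0 <= y -> y < 2^-1 -> sharpen n y @[n --> \oo] --> (1 : R).
Proof.
move=> y0 y2; have y1 : y <= 1 by lra.
apply: (@squeeze_cvgr _ _ _ _ (fun n => 1 - (2 * y) ^+ n) (fun=> 1)).
- near=> n; have /andP[_ ->] : 0 <= sharpen n y <= 1 by apply: sharpen_bound; rewrite y0.
  rewrite andbT /sharpen; have := @bernoulli_ge (- y ^+ n) (2 ^ n).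
  by rewrite lerN2 exprn_ile1 // mulrN natrX -exprMn; exact.
- rewrite -[X in _ --> X]subr0; apply: cvgB; first exact: cvg_cst.
  apply: cvg_expr; rewrite ger0_norm ?mulr_ge0 //; lra.
- exact: cvg_cst.
Unshelve. all: by end_near. Qed.

(** With $x=y^n$ one has $(1-x)^N(1+x)^N\le1$ for $N=2^n$, and Bernoulli's inequality gives
    $(1+x)^N\ge(2y)^n$; so $(2y)^{-n}$ is an upper bound. *)
Lemma sharpen_cvg0 (y : R) : 2^-1 < y -> y <= 1 -> sharpen n y @[n --> \oo] --> (0 : R).
Proof.
move=> y2 y1; have y0 : 0 <= y by lra.
apply: (@squeeze_cvgr _ _ _ _ (fun=> 0) (fun n => ((2 * y)^-1) ^+ n)).
- near=> n; have /andP[-> _] : 0 <= sharpen n y <= 1 by apply: sharpen_bound; rewrite y0.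
  rewrite /= /sharpen; set x := y ^+ n.
  have x0 : 0 <= x by exact: exprn_ge0.
  have x1 : x <= 1 by exact: exprn_ile1.
  have : (1 - x) ^+ (2 ^ n) * (1 + x) ^+ (2 ^ n) <= 1.
    by rewrite -exprMn exprn_ile1 //; nra.
  have b : (2 * y) ^+ n <= (1 + x) ^+ (2 ^ n).
    have := @bernoulli_ge x (2 ^ n); rewrite natrX -exprMn.
    move=> h; apply: le_trans (h _); [by rewrite lerDr | lra].
  have p : 0 < (2 * y) ^+ n by rewrite exprn_gt0 // mulr_gt0 //; lra.
  move=> h; rewrite exprVn -[leRHS]mul1r ler_pdivlMr //; apply: le_trans h.
  by rewrite ler_wpM2l // exprn_ge0 // subr_ge0.
- exact: cvg_cst.
- apply: cvg_expr; rewrite ger0_norm ?invr_ge0 ?mulr_ge0 // invf_lt1 ?mulr_gt0 //; lra.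
Unshelve. all: by end_near. Qed.

Lemma normc_zeta (t : R) : normc (zeta t) = 1.
Proof. by rewrite /zeta /= cos2Dsin2 sqrtr1. Qed.

Lemma zetaJ (t : R) : (zeta t)^* = (zeta t)^-1.
Proof.
have zz : zeta t * (zeta t)^* = 1 by rewrite mulJ_normc normc_zeta expr1n.
have z0 : zeta t != 0 by apply: contra_eq_neq zz => ->; rewrite mul0r eq_sym oner_neq0.
by apply: (mulfI z0); rewrite zz divff.
Qed.

Lemma zeta_neq0 (t : R) : zeta t != 0.
Proof.
apply/eqP => z0; have := normc_zeta t; rewrite z0 /= expr0n addr0 sqrtr0.
by move/esym/eqP; rewrite oner_eq0.
Qed.

Lemma zetaXJ (t : R) (k : int) : (zeta t ^ k)^* = zeta t ^ (- k).
Proof. by rewrite -exprz_inv -zetaJ; exact: fmorphXz. Qed.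

Lemma normc_zetaX (t : R) (k : int) : normc (zeta t ^ k) = 1.
Proof.
have N (n : nat) : normc (zeta t ^+ n) = 1.
  elim: n => [|n IH]; first by rewrite expr0 /= expr1n expr0n addr0 sqrtr1.
  by rewrite exprS normc_mul normc_zeta IH mulr1.
by case: k => n; rewrite ?NegzE -?zetaXJ ?normcJ; exact: N.
Qed.

Lemma cmeas_zeta : cmeas (@zeta R).
Proof.
split=> /=; apply: continuous_measurable_fun => t.
- apply: (@continuous_comp _ _ _ (fun t => 2 * pi * t) cos); last exact: continuous_cos.
  by apply: continuousM => //; exact: cst_continuous.
- apply: (@continuous_comp _ _ _ (fun t => 2 * pi * t) sin); last exact: continuous_sin.
  by apply: continuousM => //; exact: cst_continuous.
Qed.

Lemma cmeas_zetaX (k : int) : cmeas (fun t => @zeta R t ^ k).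
Proof.
have N (n : nat) : cmeas (fun t => @zeta R t ^+ n).
  elim: n => [|n IH].
    by under eq_fun do rewrite expr0; exact: cmeas_cst.
  by under eq_fun do rewrite exprS; apply: cmeasM => //; exact: cmeas_zeta.
case: k => n; first exact: N.
rewrite NegzE; under eq_fun do rewrite -zetaXJ.
by apply: cmeasJ; exact: N.
Qed.

Lemma sqint_zetaX (k : int) : sqint (fun t => @zeta R t ^ k).
Proof. by apply: (@sqint_bd _ _ 1) => [|t]; [exact: cmeas_zetaX|rewrite normc_zetaX]. Qed.

Section Annihilator.
Variable g : R -> C.
Hypothesis sg : sqint g.
Hypothesis g0 : forall k : int, fourier g k = 0.

(** Quantifying over all [k] makes the property stable under multiplication by powers of [zeta],
    hence by trigonometric polynomials; the bound on [p] keeps the integrals meaningful. *)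
Definition annihilated (p : R -> C) : Prop :=
  [/\ cmeas p, exists M, forall t, normc (p t) <= M &
      forall k : int, integralC (fun t => p t * (g t * zeta t ^ k)) = 0].

Lemma cintg_bd p k : cmeas p -> (exists M, forall t, normc (p t) <= M) ->
  cintg (fun t => p t * (g t * zeta t ^ k)).
Proof.
move=> mp [M pM]; rewrite (_ : (fun _ => _) = fun t => (p t * g t) * zeta t ^ k).
  by apply: cintgM; [exact: sqintM_bd pM|exact: sqint_zetaX].
by apply/funext => t; rewrite mulrA.
Qed.

Lemma annihilated1 : annihilated (fun=> 1).
Proof.
split; first exact: cmeas_cst.
  by exists (normc 1) => t.
by move=> k; under eq_fun do rewrite mul1r; have := g0 (- k); rewrite /fourier opprK.
Qed.

Lemma annihilatedD p q : annihilated p -> annihilated q ->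
  annihilated (fun t => p t + q t).
Proof.
move=> [mp bp zp] [mq bq zq]; split; first exact: cmeasD.
  have [[M pM] [N qN]] := (bp, bq); exists (M + N) => t.
  exact: le_trans (normc_add _ _) (lerD (pM t) (qN t)).
move=> k; under eq_fun do rewrite mulrDl.
by rewrite integralCD ?zp ?zq ?addr0 //; exact: cintg_bd.
Qed.

Lemma annihilatedZ c p : annihilated p -> annihilated (fun t => c * p t).
Proof.
move=> [mp bp zp]; split; first exact: cmeasM (cmeas_cst _) _.
  have [M pM] := bp; exists (normc c * M) => t.
  by rewrite normc_mul ler_wpM2l ?normc_ge0.
move=> k; under eq_fun do rewrite -mulrA.
by rewrite integralCZ ?zp ?mulr0 //; exact: cintg_bd.
Qed.

Lemma annihilated_zeta m p : annihilated p -> annihilated (fun t => zeta t ^ m * p t).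
Proof.
move=> [mp bp zp]; split; first exact: cmeasM (cmeas_zetaX _) _.
  by have [M pM] := bp; exists M => t; rewrite normc_mul normc_zetaX mul1r.
move=> k; rewrite -(zp (m + k)); congr integralC; apply/funext => t.
by rewrite expfzDr ?zeta_neq0 //; ring.
Qed.

Variable a : R.

(* (1 + sin (pi t) sin (pi (t - a))) / 2, which for t in (0, 1) is below 1/2
   exactly when t < a. *)
Definition arc_fun (t : R) : R :=
  (1 + (cos (pi * a) - cos (2 * pi * t - pi * a)) / 2) / 2.

Lemma arc_funE t : arc_fun t = (1 + sin (pi * t) * sin (pi * (t - a))) / 2.
Proof.
rewrite /arc_fun; congr ((1 + _) / 2).
have -> : pi * a = pi * t - pi * (t - a) by ring.
have -> : 2 * pi * t - (pi * t - pi * (t - a)) = pi * t + pi * (t - a) by ring.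
by rewrite cosB cosD; field.
Qed.

Lemma arc_fun01 t : 0 <= arc_fun t <= 1.
Proof.
have := cos_le1 (pi * a); have := cos_geN1 (pi * a).
have := cos_le1 (2 * pi * t - pi * a); have := cos_geN1 (2 * pi * t - pi * a).
rewrite /arc_fun; move: (cos _) (cos _) => x y *; apply/andP; split; lra.
Qed.

Lemma annihilated_arc p : annihilated p -> annihilated (fun t => (arc_fun t)%:C%C * p t).
Proof.
move=> zp.
(* [al], [be] and the conjugate of [be] are the Fourier coefficients of [arc_fun] of index 0, 1 and
   -1; the others are zero. *)
pose al : C := (2^-1 + cos (pi * a) / 4)%:C%C.
pose be : C := Complex (- cos (pi * a) / 8) (sin (pi * a) / 8).
have -> : (fun t => (arc_fun t)%:C%C * p t) = (fun t => al * p t +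
    (be * (zeta t ^ 1 * p t) + be^* * (zeta t ^ (-1) * p t))).
  apply/funext => t; rewrite !mulrA -!mulrDl; congr (_ * _).
  rewrite -zetaXJ expr1z /arc_fun cosB; apply/eqP; rewrite eq_complex.
  by apply/andP; split; apply/eqP => /=; field.
apply: annihilatedD; first exact: annihilatedZ.
by apply: annihilatedD; apply: annihilatedZ; exact: annihilated_zeta.
Qed.

Lemma annihilated_sharpen n : annihilated (fun t => (sharpen n (arc_fun t))%:C%C).
Proof.
have X m p : annihilated p -> annihilated (fun t => ((arc_fun t) ^+ m)%:C%C * p t).
  elim: m p => [|m IH] p zp.
    by have := zp; congr annihilated; apply/funext => t; rewrite expr0 mul1r.
  have := annihilated_arc (IH _ zp); congr annihilated; apply/funext => t.
  by rewrite exprS (rmorphM (real_complex R) (arc_fun t)) mulrA.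
rewrite /sharpen; elim: (2 ^ n)%N => [|m IH].
  by have := annihilated1; congr annihilated; apply/funext => t; rewrite expr0.
have := annihilatedD IH (annihilatedZ (-1) (X n _ IH)).
congr annihilated; apply/funext => t.
by rewrite exprS (rmorphM (real_complex R) (1 - _)) (rmorphB (real_complex R)) rmorph1; ring.
Qed.

End Annihilator.

(** The measure is Lebesgue measure on $[0,1]$, and inside that interval only the points 0, 1 and
    [a] can fail the condition. *)
Lemma ae01 (a : R) : {ae mu, forall t, [/\ 0 < t, t < 1 & t <> a]}.
Proof.
have neg (A : set R) : measurable A -> A `&` `[0, 1] `<=` [set 0] `|` [set 1] `|` [set a] ->
    mu A = 0%E.
  move=> mA sA; transitivity (\int[mu]_t (\1_A t)%:E)%E.
    by rewrite [RHS]integral_indic // setIT.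
  rewrite [LHS](@integral_uniform _ _ _ ltr01 (fun t => (\1_A t)%:E)); last 2 first.
  - by apply/measurable_EFinP; exact: measurable_indic.
  - by move=> t; rewrite lee_fin.
  have l0 : lebesgue_measure (A `&` `[0, 1]) = 0%E.
    apply: (@subset_measure0 _ _ _ lebesgue_measure _ ([set 0] `|` [set 1] `|` [set a])) => //.
    - exact: measurableI.
    - by apply: measurableU => //; exact: measurableU.
    - apply: countable_lebesgue_measure0.
      by apply: finite_set_countable; rewrite !finite_setU; do !split; exact: finite_set1.
  have i0 : (\int[lebesgue_measure]_(x in `[0%R, 1%R]) (\1_A x)%:E = 0)%E.
    by rewrite integral_indic.
  by rewrite i0 mule0.
exists (~` (`]0, 1[ `\ a)); split.
- by apply: measurableC; exact: measurableD.
- apply: neg; first by apply: measurableC; exact: measurableD.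
  move=> t [/= nt]; rewrite in_itv /= => /andP[t0 t1].
  have [->|ta] := eqVneq t a; first by right.
  have [->|tn0] := eqVneq t 0; first by left; left.
  have [->|tn1] := eqVneq t 1; first by left; right.
  exfalso; apply: nt; split; last exact/eqP.
  by rewrite in_itv /= !lt_neqAle eq_sym tn0 t0 tn1.
- move=> t /= nt [] /=; rewrite in_itv /= => /andP[t0 t1] /eqP ta; apply: nt; split=> //.
  exact/eqP.
Qed.

End FourierUniqueness.

(** * The uniqueness theorem for Fourier coefficients *)

Section RayIntegrals.
Context {R : realType}.
Local Notation C := R[i].
Local Notation mu := (@arc_length R).

Lemma sharpen_arc_cvg (a t : R) : 0 < a < 1 -> 0 < t < 1 -> t <> a ->
  sharpen n (arc_fun a t) @[n --> \oo] --> (\1_(`]-oo, a[) t : R).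
Proof.
move=> /andP[a0 a1] /andP[t0 t1] /eqP ta; have /andP[y0 y1] := arc_fun01 a t.
have st : 0 < sin (pi * t).
  by apply: sin_gt0_pi; rewrite mulr_gt0 ?pi_gt0 //= -[ltRHS]mulr1 ltr_pM2l ?pi_gt0.
move: ta; rewrite neq_lt => /orP[lt|lt]; rewrite indicE.
- rewrite mem_set /=; last by rewrite in_itv.
  apply: sharpen_cvg1 => //; rewrite arc_funE.
  have : 0 < sin (pi * (a - t)).
    by apply: sin_gt0_pi; rewrite mulr_gt0 ?pi_gt0 ?subr_gt0 //= -[ltRHS]mulr1 ltr_pM2l ?pi_gt0 //; lra.
  rewrite -(opprB t a) mulrN sinN => sa; nra.
- rewrite memNset /=; last by rewrite in_itv /=; apply/negP; rewrite -leNgt ltW.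
  apply: sharpen_cvg0 => //; rewrite arc_funE.
  have : 0 < sin (pi * (t - a)).
    by apply: sin_gt0_pi; rewrite mulr_gt0 ?pi_gt0 ?subr_gt0 //= -[ltRHS]mulr1 ltr_pM2l ?pi_gt0 //; lra.
  by move=> sa; nra.
Qed.

Lemma measurable_sharpen_arc (a : R) n :
  measurable_fun setT (fun t => sharpen n (arc_fun a t)).
Proof.
rewrite /sharpen; apply: measurable_funX; apply: measurable_funB => //.
apply: measurable_funX; rewrite /arc_fun; apply: measurable_funM => //.
apply: measurable_funD => //; apply: measurable_funM => //; apply: measurable_funB => //.
apply: continuous_measurable_fun => t.
apply: (@continuous_comp _ _ _ (fun t => 2 * pi * t - pi * a) cos); last exact: continuous_cos.
by apply: continuousB; [apply: continuousM => //; exact: cst_continuous|exact: cst_continuous].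
Qed.

(** For [0 < a < 1] this is dominated convergence with dominating function [|h|]; for other [a] the
    ray is null or of full measure. *)
Lemma integral_ray0 (h : R -> R) (a : R) : mu.-integrable setT (EFin \o h) ->
  (\int[mu]_t (h t)%:E = 0)%E ->
  (0 < a < 1 -> forall n, (\int[mu]_t (sharpen n (arc_fun a t) * h t)%:E = 0)%E) ->
  (\int[mu]_(t in `]-oo, a[) (h t)%:E = 0)%E.
Proof.
move=> ih h0 hn; have /measurable_int/measurable_EFinP mh := ih.
have mI : measurable_fun setT (fun t => (\1_(`]-oo, a[) t * h t)%:E).
  by apply/measurable_EFinP; apply: measurable_funM => //; exact: measurable_indic.
have -> : (\int[mu]_(t in `]-oo, a[) (h t)%:E = \int[mu]_t (\1_(`]-oo, a[) t * h t)%:E)%E.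
  rewrite integral_mkcond; apply: eq_integral => t _; rewrite patchE indicE.
  by case: ifP; rewrite ?mul1r ?mul0r.
have [a0|a0] := leP a 0.
  rewrite (@ae_eq_integral _ _ _ mu setT (cst 0%E)) ?integral0 //.
  apply: filterS (@ae01 R 0) => t [t0 _ _] _ /=.
  rewrite indicE memNset ?mul0r //= in_itv /=; apply/negP; rewrite -leNgt.
  exact: le_trans a0 (ltW t0).
have [a1|a1] := leP 1 a.
  rewrite -h0; apply: ae_eq_integral => //; first exact/measurable_EFinP.
  apply: filterS (@ae01 R 0) => t [_ t1 _] _ /=.
  by rewrite indicE mem_set ?mul1r //= in_itv /= (lt_le_trans t1).
have {}hn := hn (introT andP (conj a0 a1)).
have [||||_ _] := @dominated_convergence _ _ _ mu setT measurableT
  (fun n t => (sharpen n (arc_fun a t) * h t)%:E)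
  (fun t => (\1_(`]-oo, a[) t * h t)%:E) (fun t => `|h t|%:E) _ mI.
- move=> n; apply/measurable_EFinP; apply: measurable_funM => //.
  exact: measurable_sharpen_arc.
- apply: filterS (ae01 a) => t [t0 t1 ta] _.
  apply: cvg_EFin; first by near=> n.
  apply: cvgM; last exact: cvg_cst.
  by apply: sharpen_arc_cvg => //; rewrite ?a0 ?t0.
- exact: integrable_abse ih.
- apply: aeW => t n _; rewrite lee_fin normrM ler_piMl //.
  by have /andP[s0 s1] := sharpen_bound n (arc_fun01 a t); rewrite ger0_norm.
rewrite (_ : (fun n => _) = fun=> 0%E); last exact/funext.
by move=> /cvg_lim => <- //; rewrite lim_cst.
Unshelve. all: by end_near. Qed.

(** The rays are stable under intersection and generate the Borel sets, so by Dynkin's theorem the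
    integral over every Borel set vanishes. *)
Lemma ae0_of_integral_rays0 (h : R -> R) : mu.-integrable setT (EFin \o h) ->
  (\int[mu]_t (h t)%:E = 0)%E ->
  (forall a, (\int[mu]_(t in `]-oo, a[) (h t)%:E = 0)%E) ->
  {ae mu, forall t, h t = 0}.
Proof.
move=> ih h0 ha.
have ihA A : measurable A -> mu.-integrable A (EFin \o h).
  by move=> mA; apply: integrableS ih.
have key A : measurable A -> (\int[mu]_(t in A) (h t)%:E = 0)%E.
  move=> mA; have : <<s (@RGenInftyO.G R) >> A.
    exact: (eq_ind _ (fun F => F A) mA _ (RGenInftyO.measurableE R)).
  move: A {mA}; apply: (@dynkin_induction _ _ (@RGenInftyO.G R) (fun A => \int[mu]_(t in A) (h t)%:E = 0)%E).
  - exact: RGenInftyO.measurableE.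
  - move=> _ _ [x ->] [y ->]; exists (Num.min x y); apply/seteqP; split=> t /=.
      by rewrite !in_itv /= lt_min => -[-> ->].
    by rewrite !in_itv /= lt_min => /andP.
  - exact: h0.
  - by move=> _ [x ->]; exact: ha.
  - move=> S mS iS; have := h0; rewrite -(setUv S).
    rewrite integral_setU //; last 3 first.
    + exact: measurableC.
    + rewrite setUv; exact: measurable_int ih.
    + by apply/disj_setPS; rewrite setICr.
    by rewrite [X in (X + _)%E](iS) add0e.
  - move=> F mF tF iF; rewrite integral_bigcup //.
      by rewrite eseries0 // => i _ _; exact: iF.
    by apply: ihA; exact: bigcupT_measurable.
have := @integral_ae_eq _ _ _ mu setT measurableT (cst 0%E) (EFin \o h) ih.
move=> /(_ (measurable_cst _)) H; have {}H : ae_eq mu setT (EFin \o h) (cst 0%E).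
  by apply: H => A _ mA; rewrite integral0; exact: key.
by apply: filterS H => t /(_ I) [].
Qed.

(** The approximants of the arc indicators are real-valued, so the vanishing of the integrals of [g]
    against them splits into real and imaginary parts, and each part is a real function with
    vanishing ray integrals. *)
Lemma fourier_uniqueness (g : R -> C) : sqint g ->
  (forall k : int, fourier g k = 0) -> {ae mu, forall t, g t = 0}.
Proof.
move=> sg g0; have [ire iim] := sqint_cintg sg.
have ann a n : complex.Re (integralC (fun t => (sharpen n (arc_fun a t))%:C%C * g t)) = 0
    /\ complex.Im (integralC (fun t => (sharpen n (arc_fun a t))%:C%C * g t)) = 0.
  have [_ _ /(_ 0)] := annihilated_sharpen sg g0 a n.
  by under eq_fun do rewrite expr0z mulr1; move=> ->.
have z0 : integralC g = 0.
  have := g0 0; rewrite /fourier oppr0; congr (integralC _ = 0).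
  by apply/funext => t; rewrite expr0z mulr1.
have fin (h : R -> R) : mu.-integrable setT (EFin \o h) -> Rintegral mu setT h = 0 ->
    (\int[mu]_t (h t)%:E = 0)%E.
  move=> ih; rewrite /Rintegral; have := integrable_fin_num measurableT ih.
  by rewrite /=; case: (integral _ _ _) => //= r _ ->.
have sM (h : R -> R) a n : mu.-integrable setT (EFin \o h) ->
    mu.-integrable setT (EFin \o (fun t => sharpen n (arc_fun a t) * h t)).
  move=> ih; have /measurable_int/measurable_EFinP mh := ih.
  apply: le_integrable ih => //.
    by apply/measurable_EFinP; apply: measurable_funM; first exact: measurable_sharpen_arc.
  move=> t _ /=; rewrite lee_fin normrM ler_piMl //.
  by have /andP[s0 s1] := sharpen_bound n (arc_fun01 a t); rewrite ger0_norm.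
have re0 : {ae mu, forall t, complex.Re (g t) = 0}.
  have i0 := fin _ ire (congr1 (@complex.Re R) z0).
  apply: ae0_of_integral_rays0 => // a; apply: integral_ray0 => // _ n.
  apply: fin; first exact: sM.
  have [r0 _] := ann a n; apply: etrans r0; apply: eq_Rintegral => t _.
  by rewrite ReM /= mul0r subr0.
have im0 : {ae mu, forall t, complex.Im (g t) = 0}.
  have i0 := fin _ iim (congr1 (@complex.Im R) z0).
  apply: ae0_of_integral_rays0 => // a; apply: integral_ray0 => // _ n.
  apply: fin; first exact: sM.
  have [_ r0] := ann a n; apply: etrans r0; apply: eq_Rintegral => t _.
  by rewrite ImM /= mul0r addr0.
apply: filterS2 re0 im0 => t; case: (g t) => x y /= -> ->; exact: erefl.
Qed.

End RayIntegrals.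

(** * Annihilators of sets of functions *)

Section Perp.
Context {R : realType} {n : nat}.
Local Notation C := R[i].
Implicit Types (f g h : R -> 'cV[C]_n) (S : set (R -> 'cV[C]_n)).

Definition perp S : set (R -> 'cV[C]_n) :=
  [set f | L2 f /\ forall h, S h -> inner2 f h = 0].

Lemma perp_subspace S : (forall h, S h -> L2 h) -> subspace (perp S).
Proof.
move=> SL; split=> [f []//||c f g [Lf f0] [Lg g0]].
  by split=> [|h _]; [exact: L2_0|exact: inner20l].
split=> [|h Sh]; first exact: L2_lin.
have Lh := SL _ Sh; rewrite inner2Dl ?inner2Zl //; last exact: L2Z.
by rewrite f0 // g0 // mulr0 addr0.
Qed.

Lemma perp_closed S : (forall h, S h -> L2 h) -> l2closed (perp S).
Proof.
move=> SL g Lg ag; split=> // h Sh; have Lh := SL _ Sh.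
have Re0 k : L2 k -> (forall e, perp S e -> inner2 e k = 0) ->
    complex.Re (inner2 g k) <= 0.
  move=> Lk ok; apply/ler_addgt0Pr => eps eps0; rewrite add0r.
  have l1 : 0 < l2 k + 1 by rewrite ltr_wpDl ?l2_ge0.
  have [e Ee lt] := ag _ (divr_gt0 eps0 l1).
  have Le : L2 e by case: Ee.
  have -> : inner2 g k = inner2 (fun t => g t - e t) k.
    by rewrite inner2Bl // (ok e Ee) subr0.
  apply: le_trans (Re_inner2_le (L2B Lg Le) Lk) _.
  rewrite l2BC //; move: lt; rewrite ltr_pdivlMr // => /ltW.
  by apply: le_trans; rewrite ler_wpM2l ?l2_ge0 // lerDl.
(* A one-sided bound on the real part suffices, because it is available for the multiples by $1$,
   $-1$, $i$ and $-i$. *)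
have z (c : C) : complex.Re (c^* * inner2 g h) <= 0.
  rewrite -inner2Zr //; apply: Re0 => [|e [Le /(_ _ Sh) oe]]; first exact: L2Z.
  by rewrite inner2Zr // oe mulr0.
have := z 1; have := z (-1); have := z 'i%C; have := z (- 'i%C).
case: (inner2 g h) => a b /=; rewrite !oppr0 => *.
by congr Complex; lra.
Qed.

End Perp.

(** * Scalar Hardy functions and their products *)

Section Hardy.
Context {R : realType}.
Local Notation C := R[i].
Local Notation mu := (@arc_length R).
Local Notation normc := (@ComplexField.Normc.normc R).
Implicit Types (phi psi : R -> C).

Definition hardy2 phi : Prop :=
  sqint phi /\ forall k : int, k < 0 -> fourier phi k = 0.

Lemma H2_hardy n (f : R -> 'cV[C]_n) : H2 f <-> forall i, hardy2 (fun t => f t i 0).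
Proof.
split=> [[/L2_sqint sf h] i|h]; first by split=> // k; exact: h.
by split=> [|i]; [apply/L2_sqint => i; have [] := h i|have [] := h i].
Qed.

Definition cv phi : R -> 'cV[C]_1 := fun t => const_mx (phi t).

Lemma cv_L2 phi : sqint phi -> L2 (cv phi).
Proof. by move=> sf; apply/L2_sqint => i; under eq_fun do rewrite mxE. Qed.

Lemma L2_sqint1 (f : R -> 'cV[C]_1) : L2 f -> sqint (fun t => f t 0 0).
Proof. by move=> /L2_sqint. Qed.

Lemma inner2_cv (f : R -> 'cV[C]_1) phi :
  inner2 f (cv phi) = integralC (fun t => f t 0 0 * (phi t)^*).
Proof.
by congr integralC; apply/funext => t; rewrite big_ord1 !mxE.
Qed.

Lemma zetaXn (t : R) n : zeta t ^+ n =
  Complex (cos (n%:R * (2 * pi * t))) (sin (n%:R * (2 * pi * t))).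
Proof.
elim: n => [|n IH]; first by rewrite expr0 mul0r cos0 sin0.
rewrite exprS IH /zeta -[n.+1%:R]natr1 !(mulrDl n%:R) mul1r cosD sinD.
by apply/eqP; rewrite eq_complex /=; apply/andP; split; apply/eqP; ring.
Qed.

Lemma ge0_integral_derive (f F : R -> R) : continuous f -> (forall t, 0 <= f t) ->
  (forall t : R, is_derive t 1 F (f t)) -> (\int[mu]_t (f t)%:E = (F 1 - F 0)%:E)%E.
Proof.
move=> cf f0 dF; have mf := continuous_measurable_fun cf.
have cF : continuous F by move=> t; apply/differentiable_continuous/derivable1_diffP; case: (dF t).
rewrite [LHS](@integral_uniform _ _ _ ltr01 (fun t => (f t)%:E)); last 2 first.
- exact/measurable_EFinP.
- by move=> t; rewrite lee_fin.
rewrite subr0 invr1 mul1e (@continuous_FTC2 _ _ F) //.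
- exact/continuous_subspaceT.
- split.
  + by move=> x _; case: (dF x).
  + exact/cvg_at_right_filter/cF.
  + exact/cvg_at_left_filter/cF.
- by move=> x _; rewrite derive1E; case: (dF x).
Qed.

(** [ge0_integral_derive] asks for a nonnegative integrand. It applies to [1 + f], whose primitive
    [t + F t] grows by exactly 1 over the period. *)
Lemma Rintegral_sub1 (f F : R -> R) : continuous f -> (forall t, -1 <= f t) ->
  (forall t, `|f t| <= 1) ->
  (forall t : R, is_derive t 1 F (f t)) -> F 1 = F 0 -> Rintegral mu setT f = 0.
Proof.
move=> cf f1 fb dF F01; have mf := continuous_measurable_fun cf.
have fi : mu.-integrable setT (EFin \o f).
  apply: le_integrable (integrable_cst 1) => //; first exact/measurable_EFinP.
  by move=> t _ /=; rewrite lee_fin normr1.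
have : Rintegral mu setT (fun t => 1 + f t) = 1.
  have c1 : continuous (fun t => 1 + f t).
    by move=> t; apply: continuousD; [exact: cst_continuous|exact: cf].
  have p1 t : 0 <= 1 + f t by have := f1 t; lra.
  have d1 (t : R) : is_derive t 1 (fun t => t + F t) (1 + f t).
    by have := dF t => ?; exact: is_deriveD.
  by rewrite /Rintegral (ge0_integral_derive c1 p1 d1) F01 /=; ring.
rewrite RintegralD //; try exact: integrable_cst.
rewrite Rintegral_cst // (_ : fine _ = 1); last first.
  have m1 : (mu setT = 1)%E by exact: probability_setT.
  exact: (congr1 fine m1).
by rewrite mulr1; lra.
Qed.

Lemma integralC_zeta (k : int) : k != 0 -> integralC (fun t => @zeta R t ^ k) = 0.
Proof.
have lin (a : R) (t : R) : is_derive t 1 (fun t => a * t) a.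
  by apply: is_derive_eq; rewrite ?scaler0 ?add0r /GRing.scale /= ?mulr1.
have N n : (0 < n)%N -> integralC (fun t => @zeta R t ^ (n : int)) = 0.
  move=> n0; pose a : R := n%:R * (2 * pi).
  have a0 : a != 0 by rewrite mulf_neq0 ?pnatr_eq0 -?lt0n // mulf_neq0 ?gt_eqF ?pi_gt0.
  have ca m : cos (m%:R * (2 * pi)) = 1 :> R /\ sin (m%:R * (2 * pi)) = 0 :> R.
    elim: m => [|m [c s]]; first by rewrite mul0r cos0 sin0.
    rewrite -[m.+1%:R]natr1 !(mulrDl m%:R) mul1r cosD sinD c s.
    by rewrite (_ : 2 * pi = pi *+ 2) ?cos2pi ?sin2pi; [split; ring|rewrite mulr2n; ring].
  have Z t : zeta t ^ (n : int) = Complex (cos (a * t)) (sin (a * t)) by rewrite [LHS]zetaXn mulrA.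
  have caE : cos a = 1 /\ sin a = 0 by exact: ca.
  have [cos1 sin1] := caE.
  have conta : continuous (fun t : R => a * t).
    by move=> t; apply: cvgM; [exact: cvg_cst|exact: cvg_id].
  under eq_fun do rewrite Z; rewrite /integralC /=; congr Complex.
  - apply: (@Rintegral_sub1 _ (fun t => a^-1 * sin (a * t))).
    + by move=> t; apply: (@continuous_comp _ _ _ (fun t => a * t) cos); [exact: conta|exact: continuous_cos].
    + by move=> t; exact: cos_geN1.
    + by move=> t; rewrite ler_norml cos_geN1 cos_le1.
    + move=> t; have D := is_derive1_comp (is_derive_sin (a * t)) (lin a t).
      have := is_deriveZ a^-1 D; rewrite /GRing.scale /=.
      by rewrite mulrCA mulVf // mulr1.
    + by rewrite mulr1 sin1 !mulr0 sin0 mulr0.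
  - apply: (@Rintegral_sub1 _ (fun t => - a^-1 * cos (a * t))).
    + by move=> t; apply: (@continuous_comp _ _ _ (fun t => a * t) sin); [exact: conta|exact: continuous_sin].
    + by move=> t; exact: sin_geN1.
    + by move=> t; rewrite ler_norml sin_geN1 sin_le1.
    + move=> t; have D := is_derive1_comp (is_derive_cos (a * t)) (lin a t).
      have := is_deriveZ (- a^-1) D; rewrite /GRing.scale /=.
      by rewrite (_ : - a^-1 * (- sin (a * t) * a) = sin (a * t)); last by field.
    + by rewrite mulr1 cos1 mulr0 cos0.
case: k => [n|n] k0; first by apply: N; rewrite lt0n.
rewrite NegzE; under eq_fun do rewrite -zetaXJ.
by rewrite integralCJ ?N ?rmorph0 //; exact/sqint_cintg/sqint_zetaX.
Qed.

Lemma hardy2_zeta (n : nat) : hardy2 (fun t => zeta t ^+ n).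
Proof.
split; first exact: (sqint_zetaX (n : int)).
move=> k k0; rewrite /fourier -[RHS](@integralC_zeta ((n : int) - k)).
  by congr integralC; apply/funext => t; rewrite expfzDr ?zeta_neq0.
by rewrite gt_eqF // subr_gt0 (lt_le_trans k0).
Qed.

Lemma hardy2_cst1 : hardy2 (fun=> 1).
Proof. by have := hardy2_zeta 0; congr hardy2; apply/funext => t; rewrite expr0. Qed.

(* The functions h with int h psi zeta^k = 0 for all psi in H^2, k > 0 form a
   closed subspace N; a function f in H^2 minus its projection onto N has no
   nonzero Fourier coefficient. *)
Lemma hardy2_mul phi psi (k : int) : hardy2 phi -> hardy2 psi -> 0 < k ->
  integralC (fun t => phi t * psi t * zeta t ^ k) = 0.
Proof.
move=> hphi hpsi k0.
pose S : set (R -> 'cV[C]_1) := [set h | exists psi' (k' : int),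
  [/\ hardy2 psi', 0 < k' & h = cv (fun t => (psi' t * zeta t ^ k')^*)]].
have sM (psi' : R -> C) (k' : int) : hardy2 psi' -> sqint (fun t => psi' t * zeta t ^ k').
  move=> [sp _]; have := sqintM_bd sp (cmeas_zetaX k') (M := 1).
  rewrite (_ : (fun t => _ * psi' t) = fun t => psi' t * zeta t ^ k').
    by apply => t; rewrite normc_zetaX.
  by apply/funext => t; rewrite mulrC.
have SL h : S h -> L2 h.
  by move=> [psi' [k' [h2 _ ->]]]; apply: cv_L2; apply: sqintJ; exact: sM.
have Lphi : L2 (cv phi) by apply: cv_L2; case: hphi.
have [Ng og] := orth_projP (perp_subspace SL) (perp_closed SL) Lphi.
move: (orth_proj _ _) Ng og => g [Lg Ng] og.
have Ng' (psi' : R -> C) (k' : int) : hardy2 psi' -> 0 < k' ->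
    integralC (fun t => g t 0 0 * psi' t * zeta t ^ k') = 0.
  move=> h2 k0'; have Sh : S (cv (fun t => (psi' t * zeta t ^ k')^*)) by exists psi', k'.
  by have := Ng _ Sh; rewrite inner2_cv; under eq_fun do rewrite conjCK mulrA.
have sg := L2_sqint1 Lg.
have sd : sqint (fun t => phi t - g t 0 0) by apply: sqintD; [case: hphi|exact: sqintN].
have d0 : {ae mu, forall t, phi t - g t 0 0 = 0}.
  (* For [j] nonnegative, the power [zeta ^ j] lies in the annihilator and is therefore orthogonal
     to [phi - g]. For [j] negative, the coefficient of [phi] is zero by hypothesis, and that of [g]
     because the constant 1 is an admissible [psi']. *)
  apply: fourier_uniqueness => // j; have [j0|j0] := leP 0 j.
    have Nz : perp S (cv (fun t => zeta t ^ j)).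
      split; first exact/cv_L2/sqint_zetaX.
      move=> _ [psi' [k' [[sp hp] k0' ->]]]; rewrite inner2_cv.
      rewrite -(hp (- (j + k'))) ?oppr_lt0 ?ltr_wpDl //; congr integralC.
      apply/funext => t; rewrite mxE conjCK opprK expfzDr ?zeta_neq0 //; ring.
    have := og _ Nz; rewrite inner2_cv => h.
    by rewrite /fourier -[RHS]h; congr integralC; apply/funext => t; rewrite !mxE zetaXJ.
  rewrite /fourier; under eq_fun do rewrite mulrBl.
  have c1 : cintg (fun t => phi t * zeta t ^ (- j)) by apply: cintgM; [case: hphi|exact: sqint_zetaX].
  have c2 : cintg (fun t => - 1 * (g t 0 0 * zeta t ^ (- j))).
    by apply: cintgZ; apply: cintgM => //; exact: sqint_zetaX.
  rewrite (_ : (fun t => _) = fun t => phi t * zeta t ^ (- j) + - 1 * (g t 0 0 * zeta t ^ (- j))); last first.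
    by apply/funext => t; rewrite mulN1r.
  rewrite integralCD // integralCZ; last by apply: cintgM => //; exact: sqint_zetaX.
  rewrite -[X in X + _]/(fourier phi j); have [_ ->//] := hphi; rewrite add0r.
  have := Ng' _ (- j) hardy2_cst1; rewrite oppr_gt0 => /(_ j0).
  by under eq_fun do rewrite mulr1; move=> ->; rewrite mulr0.
rewrite -(Ng' _ _ hpsi k0); apply: integralC_ae.
- by apply: cmeasM (cmeas_zetaX _); apply: cmeasM; [case: hphi => -[]|case: hpsi => -[]].
- by apply: cmeasM (cmeas_zetaX _); apply: cmeasM; [case: sg|case: hpsi => -[]].
- by apply: filterS d0 => t /eqP; rewrite subr_eq0 => /eqP ->.
Qed.

End Hardy.

(** * Bounded matrix functions as multipliers of $L^2$ *)

Section BoundedSymbols.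
Context {R : realType}.
Local Notation C := R[i].
Local Notation mu := (@arc_length R).
Local Notation normc := (@ComplexField.Normc.normc R).

(** An entrywise form of essential boundedness, easier to propagate through products, blocks and
    adjoints than the operator norm in [Linf]. *)
Definition bdmx m n (F : R -> 'M[C]_(m, n)) : Prop :=
  measurable_mxfun F /\
  exists M : R, {ae mu, forall t, forall i j, normc (F t i j) <= M}.

Lemma mxmeas_entry m n (F : R -> 'M[C]_(m, n)) i j : measurable_mxfun F ->
  cmeas (fun t => F t i j).
Proof. by move=> mF; have := mF i j. Qed.

Lemma mxmeasI m n (F : R -> 'M[C]_(m, n)) :
  (forall i j, cmeas (fun t => F t i j)) -> measurable_mxfun F.
Proof. by []. Qed.

Lemma bdmx_gt0 m n (F : R -> 'M[C]_(m, n)) : bdmx F ->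
  exists2 M : R, 0 < M & {ae mu, forall t, forall i j, normc (F t i j) <= M}.
Proof.
move=> [_ [M FM]]; exists (`|M| + 1); first by rewrite ltr_wpDl.
apply: filterS FM => t h i j; apply: le_trans (h i j) _.
by apply: le_trans (ler_norm M) _; rewrite lerDl.
Qed.

Lemma enorm_delta n (j : 'I_n) : enorm (delta_mx j 0 : 'cV[C]_n) = 1.
Proof.
apply/eqP; rewrite -(@eqrXn2 _ 2) ?enorm_ge0 // enorm_sq (bigD1 j) //= big1.
  by rewrite mxE !eqxx normc_sq /= expr1n expr0n !addr0.
by move=> i ij; rewrite mxE (negbTE ij) normc_sq /= expr0n addr0.
Qed.

Lemma entry_le_norm2 m n (A : 'M[C]_(m, n)) i j : ((normc (A i j))%:E <= mx_norm2 A)%E.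
Proof.
apply: (@le_trans _ _ (enorm (A *m delta_mx j 0))%:E); last first.
  by apply: ereal_sup_ubound; exists (delta_mx j 0) => //=; rewrite enorm_delta.
rewrite lee_fin -(@ler_pXn2r _ 2) ?nnegrE ?normc_ge0 ?enorm_ge0 //.
rewrite enorm_sq (bigD1 i) //= -colE mxE lerDl.
by apply: sumr_ge0 => k _; exact: sqr_ge0.
Qed.

Lemma Linf_bdmx m n (F : R -> 'M[C]_(m, n)) : Linf F -> bdmx F.
Proof.
move=> [mF Fb]; split=> //.
have [M HM] : exists M : R, (Linf_norm F <= M%:E)%E.
  case: (Linf_norm F) Fb => [r| |] // _; first by exists r.
  by exists 0; exact: leNye.
exists M; move/ess_supP: HM; apply: filterS => t h i j.
by rewrite -lee_fin; apply: le_trans h; exact: entry_le_norm2.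
Qed.

Lemma sqintM_aebd (f g : R -> C) (M : R) : sqint f -> cmeas g ->
  {ae mu, forall t, normc (g t) <= M} -> sqint (fun t => g t * f t).
Proof.
move=> [mf jf] mg gM; have mgf := cmeasM mg mf; split=> //.
have jMf := integrableZr (M ^+ 2) jf.
apply: ge0_integrable; [exact: cmeas_normc|by move=> t; exact: sqr_ge0|].
apply: (@le_lt_trans _ _ (\int[mu]_t (M ^+ 2 * normc (f t) ^+ 2)%:E)%E).
  apply: ae_ge0_le_integral => //.
  - by move=> t _; rewrite lee_fin sqr_ge0.
  - by apply/measurable_EFinP; exact: cmeas_normc.
  - by move=> t _; rewrite lee_fin mulr_ge0 ?sqr_ge0.
  - exact: measurable_int jMf.
  - apply: filterS gM => t gM _; rewrite lee_fin normc_mul exprMn ler_wpM2r ?sqr_ge0 //.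
    by rewrite lerXn2r ?nnegrE ?normc_ge0 // (le_trans (normc_ge0 _) gM).
have /integrableP[_] := jMf; apply: le_lt_trans; apply: ge0_le_integral => //.
- by move=> t _; rewrite lee_fin mulr_ge0 ?sqr_ge0.
- exact: measurable_int jMf.
- by apply: measurableT_comp => //; exact: measurable_int jMf.
- by move=> t _; exact: lee_abs.
Qed.

Lemma bdmx_sqint m n (F : R -> 'M[C]_(m, n)) i j (f : R -> C) : bdmx F ->
  sqint f -> sqint (fun t => F t i j * f t).
Proof.
move=> [mF [M FM]] sf; apply: (@sqintM_aebd _ (fun t => F t i j) M sf (mxmeas_entry i j mF)).
by apply: filterS FM => t.
Qed.

Lemma bdmx_L2 m n (F : R -> 'M[C]_(m, n)) f : bdmx F -> L2 f ->
  L2 (fun t => F t *m f t).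
Proof.
move=> bF /L2_sqint sf; apply/L2_sqint => i; under eq_fun do rewrite mxE.
by apply: sqint_sum => j; exact: bdmx_sqint.
Qed.

Lemma normc_sum (I : Type) (s : seq I) (P : pred I) (F : I -> C) :
  normc (\sum_(i <- s | P i) F i) <= \sum_(i <- s | P i) normc (F i).
Proof.
elim/big_ind2 : _ => [|x a y b xa yb|//]; first by rewrite /= expr0n addr0 sqrtr0.
exact: le_trans (normc_add _ _) (lerD xa yb).
Qed.

Lemma entry_le_enorm n (x : 'cV[C]_n) i : normc (x i 0) <= enorm x.
Proof.
rewrite -(@ler_pXn2r _ 2) ?nnegrE ?normc_ge0 ?enorm_ge0 //.
rewrite enorm_sq (bigD1 i) //= lerDl.
by apply: sumr_ge0 => k _; exact: sqr_ge0.
Qed.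

Lemma bdmx_l2 m n (F : R -> 'M[C]_(m, n)) : bdmx F ->
  exists2 K : R, 0 < K & forall f, L2 f -> l2 (fun t => F t *m f t) <= K * l2 f.
Proof.
move=> bF; have [M M0 FM] := bdmx_gt0 bF.
(* Each of the [m] coordinates of $Ff$ is at most $nM|f|$; the added 1 keeps the constant positive
   when a size is 0. *)
pose K2 := m%:R * (n%:R * M) ^+ 2 + 1.
have K20 : 0 < K2 by rewrite ltr_wpDl // mulr_ge0 ?sqr_ge0.
exists (Num.sqrt K2) => [|f Lf]; first by rewrite sqrtr_gt0.
have LFf := bdmx_L2 bF Lf.
rewrite /l2 -sqrtrM ?(ltW K20) // ler_sqrt ?mulr_ge0 ?nsq_ge0 ?(ltW K20) //.
have /L2P[mf jf] := Lf; have /L2P[mFf jFf] := LFf.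
rewrite -lee_fin -nsq_int // EFinM -nsq_int // -ge0_integralZl //; last 3 first.
- by apply/measurable_EFinP; exact: measurable_enorm_sq.
- by move=> t _; rewrite lee_fin sqr_ge0.
- by rewrite lee_fin ltW.
apply: ae_ge0_le_integral => //.
- by move=> t _; rewrite lee_fin sqr_ge0.
- by apply/measurable_EFinP; exact: measurable_enorm_sq.
- by move=> t _; rewrite -EFinM lee_fin mulr_ge0 ?sqr_ge0 // ltW.
- by apply: measurable_funeM; apply/measurable_EFinP; exact: measurable_enorm_sq.
apply: filterS FM => t Ft _; rewrite -EFinM lee_fin.
rewrite enorm_sq; apply: (@le_trans _ _ (\sum_(i < m) (n%:R * M * enorm (f t)) ^+ 2)).
  apply: ler_sum => i _; rewrite lerXn2r ?nnegrE ?normc_ge0 ?mulr_ge0 ?enorm_ge0 ?(ltW M0) //.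
  rewrite mxE; apply: le_trans (normc_sum _ _ _) _.
  apply: (@le_trans _ _ (\sum_(j < n) M * enorm (f t))).
    apply: ler_sum => j _; rewrite normc_mul.
    by apply: ler_pM; rewrite ?normc_ge0 ?entry_le_enorm.
  by rewrite sumr_const card_ord -[leLHS]mulr_natl mulrA.
rewrite sumr_const card_ord -[leLHS]mulr_natl exprMn mulrA ler_wpM2r ?sqr_ge0 //.
by rewrite /K2 lerDl.
Qed.

Lemma bdmxM m n p (F : R -> 'M[C]_(m, n)) (G : R -> 'M[C]_(n, p)) :
  bdmx F -> bdmx G -> bdmx (fun t => F t *m G t).
Proof.
move=> bF bG; have [[mF _] [mG _]] := (bF, bG).
have [[M M0 FM] [N N0 GN]] := (bdmx_gt0 bF, bdmx_gt0 bG); split.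
  apply: mxmeasI => i j; under eq_fun do rewrite mxE.
  by apply: cmeas_sum => k; apply: cmeasM; [exact: mxmeas_entry|exact: mxmeas_entry].
exists (n%:R * (M * N)); apply: filterS2 FM GN => t Ft Gt i j; rewrite mxE.
apply: le_trans (normc_sum _ _ _) _.
apply: (@le_trans _ _ (\sum_(k < n) M * N)).
  by apply: ler_sum => k _; rewrite normc_mul; apply: ler_pM; rewrite ?normc_ge0.
by rewrite sumr_const card_ord -[leLHS]mulr_natl.
Qed.

Lemma bdmx_tr m n (F : R -> 'M[C]_(m, n)) : bdmx F -> bdmx (fun t => (F t)^T).
Proof.
move=> [mF [M FM]]; split; first by apply: mxmeasI => i j; under eq_fun do rewrite mxE; exact: mxmeas_entry.
by exists M; apply: filterS FM => t h i j; rewrite mxE.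
Qed.

Lemma bdmx_cj m n (F : R -> 'M[C]_(m, n)) : bdmx F -> bdmx (fun t => cjmx (F t)).
Proof.
move=> [mF [M FM]]; split.
  by apply: mxmeasI => i j; under eq_fun do rewrite mxE; apply: cmeasJ; exact: mxmeas_entry.
by exists M; apply: filterS FM => t h i j; rewrite mxE normcJ.
Qed.

Lemma bdmx_adj m n (F : R -> 'M[C]_(m, n)) : bdmx F -> bdmx (fun t => (F t)^t*).
Proof. by move=> bF; exact: bdmx_cj (bdmx_tr bF). Qed.

(** The rows of a unitary matrix are unit vectors, so its entries are at most 1 in modulus. *)
Lemma unitary_bdmx n (V : R -> 'M[C]_n) : measurable_mxfun V ->
  {ae mu, forall t, V t \is unitarymx} -> bdmx V.
Proof.
move=> mV uV; split=> //; exists 1; apply: filterS uV => t /unitarymxP VV i j.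
have := congr1 (fun A : 'M[C]_n => complex.Re (A i i)) VV.
rewrite !mxE eqxx /= Re_sum (bigD1 j) //= !mxE Re_mulJ => h.
rewrite -(@ler_pXn2r _ 2) ?nnegrE ?normc_ge0 // expr1n -[leRHS]h lerDl.
by apply: sumr_ge0 => k _; rewrite !mxE Re_mulJ sqr_ge0.
Qed.

Lemma bdmx0 m n : bdmx (fun=> 0 : 'M[C]_(m, n)).
Proof.
split; first by apply: mxmeasI => i j; exact: cmeas_cst.
by exists 0; apply: aeW => t i j; rewrite mxE /= expr0n addr0 sqrtr0.
Qed.

Lemma bdmx_conform m n m' n' (F : R -> 'M[C]_(m, n)) : bdmx F ->
  bdmx (fun t => conform_mx (0 : 'M[C]_(m', n')) (F t)).
Proof.
move=> bF; have [em|nm] := eqVneq m m'; last first.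
  by under eq_fun do rewrite nonconform_mx ?nm //; exact: bdmx0.
have [en|nn] := eqVneq n n'; last first.
  by under eq_fun do rewrite nonconform_mx ?nn ?orbT //; exact: bdmx0.
by subst m' n'; under eq_fun do rewrite conform_mx_id.
Qed.

Lemma bdmx_block m1 m2 n1 n2 (A : R -> 'M[C]_(m1, n1)) (B : R -> 'M[C]_(m1, n2))
    (D : R -> 'M[C]_(m2, n1)) (E : R -> 'M[C]_(m2, n2)) :
  bdmx A -> bdmx B -> bdmx D -> bdmx E ->
  bdmx (fun t => block_mx (A t) (B t) (D t) (E t)).
Proof.
move=> bA bB bD bE.
have [mA _] := bA; have [mB _] := bB; have [mD _] := bD; have [mE _] := bE.
have [[a a0 Ha] [b b0 Hb]] := (bdmx_gt0 bA, bdmx_gt0 bB).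
have [[c c0 Hc] [e e0 He]] := (bdmx_gt0 bD, bdmx_gt0 bE); split.
  apply: mxmeasI => i j.
  case: (split_ordP i) => i' ->; case: (split_ordP j) => j' ->.
  - by under eq_fun do rewrite block_mxEul; exact: mxmeas_entry.
  - by under eq_fun do rewrite block_mxEur; exact: mxmeas_entry.
  - by under eq_fun do rewrite block_mxEdl; exact: mxmeas_entry.
  - by under eq_fun do rewrite block_mxEdr; exact: mxmeas_entry.
exists (a + b + c + e); near=> t => i j.
have At : forall i j, normc (A t i j) <= a by near: t.
have Bt : forall i j, normc (B t i j) <= b by near: t.
have Dt : forall i j, normc (D t i j) <= c by near: t.
have Et : forall i j, normc (E t i j) <= e by near: t.
case: (split_ordP i) => i' ->; case: (split_ordP j) => j' ->.
- by rewrite block_mxEul; have := At i' j'; lra.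
- by rewrite block_mxEur; have := Bt i' j'; lra.
- by rewrite block_mxEdl; have := Dt i' j'; lra.
- by rewrite block_mxEdr; have := Et i' j'; lra.
Unshelve. all: by end_near. Qed.

Definition dotp n (x y : 'cV[C]_n) : C := \sum_i x i 0 * (y i 0)^*.

Lemma dotp_mx n (x y : 'cV[C]_n) : dotp x y = (y^t* *m x) 0 0.
Proof. by rewrite mxE; apply: eq_bigr => i _; rewrite !mxE mulrC. Qed.

Lemma adj_mul m n p (A : 'M[C]_(m, n)) (B : 'M[C]_(n, p)) :
  (A *m B)^t* = B^t* *m A^t*.
Proof. by rewrite trmx_mul map_mxM. Qed.

Lemma adjK m n (A : 'M[C]_(m, n)) : (A^t*)^t* = A.
Proof. by apply/matrixP => i j; rewrite !mxE conjCK. Qed.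

Lemma dotp_adj m n (A : 'M[C]_(m, n)) x y : dotp (A *m x) y = dotp x (A^t* *m y).
Proof. by rewrite !dotp_mx adj_mul adjK mulmxA. Qed.

Lemma inner2_adj m n (A : R -> 'M[C]_(m, n)) f g :
  inner2 (fun t => A t *m f t) g = inner2 f (fun t => (A t)^t* *m g t).
Proof. by congr integralC; apply/funext => t; exact: dotp_adj. Qed.

End BoundedSymbols.

(** * The spaces $H^2$, $H^2_-$ and their sums with $L^2$ *)

Section HardyModules.
Context {R : realType}.
Local Notation C := R[i].
Local Notation mu := (@arc_length R).

Definition hardymx m n (F : R -> 'M[C]_(m, n)) : Prop :=
  bdmx F /\ forall i j, hardy2 (fun t => F t i j).

Lemma bdmx_entry_sqint m n (F : R -> 'M[C]_(m, n)) i j : bdmx F ->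
  sqint (fun t => F t i j).
Proof.
move=> bF; have := bdmx_sqint i j bF (sqint_cst 1).
by under eq_fun do rewrite mulr1.
Qed.

Lemma Hinf_hardymx m n (F : R -> 'M[C]_(m, n)) : Hinf F -> hardymx F.
Proof.
move=> [/Linf_bdmx bF h]; split=> // i j; split; first exact: bdmx_entry_sqint.
by move=> k; exact: h.
Qed.

(** Entrywise this is [hardy2_mul]: a Fourier coefficient of index [k < 0] is an integral against
    the positive power [zeta ^ (- k)]. *)
Lemma hardymx_H2 m n (F : R -> 'M[C]_(m, n)) f : hardymx F -> H2 f ->
  H2 (fun t => F t *m f t).
Proof.
move=> [bF hF] Hf; have [Lf _] := Hf; split; first exact: bdmx_L2.
have /H2_hardy hf := Hf; move=> i k k0.
rewrite /fourier.
have ci j : cintg (fun t => (F t i j * f t j 0) * zeta t ^ (- k)).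
  apply: cintgM; last exact: sqint_zetaX.
  by apply: bdmx_sqint => //; have [] := hf j.
transitivity (\sum_(j < n) integralC (fun t => (F t i j * f t j 0) * zeta t ^ (- k))).
  rewrite -integralC_sum //; congr integralC; apply/funext => t.
  by rewrite mxE mulr_suml.
by rewrite big1 // => j _; apply: hardy2_mul; rewrite ?oppr_gt0.
Qed.

(** Written as an annihilator, $H^2$ inherits linearity and closedness from [perp]. *)
Lemma H2_perp n : @H2 R n = perp [set h : R -> 'cV[C]_n | exists i (k : int),
  k < 0 /\ h = fun t => zeta t ^ k *: delta_mx i 0].
Proof.
have E (f : R -> 'cV[C]_n) i (k : int) :
    inner2 f (fun t => zeta t ^ k *: delta_mx i 0) = fourier (fun t => f t i 0) k.
  congr integralC; apply/funext => t; rewrite (bigD1 i) //= big1.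
    by rewrite !mxE !eqxx mulr1 zetaXJ addr0.
  by move=> j ji; rewrite !mxE (negbTE ji) mulr0 conjC0 mulr0.
apply/seteqP; split=> f [Lf h]; split=> //.
  by move=> _ [i [k [k0 ->]]]; rewrite E h.
by move=> i k k0; rewrite -E; apply: h; exists i, k.
Qed.

Lemma delta_zeta_L2 n (k : int) (i : 'I_n) :
  L2 (fun t => @zeta R t ^ k *: delta_mx i 0 : 'cV[C]_n).
Proof.
apply/L2_sqint => j; under eq_fun do rewrite !mxE mulrC.
by apply: sqintZ; exact: sqint_zetaX.
Qed.

Lemma H2_subspace n : subspace (@H2 R n).
Proof. by rewrite H2_perp; apply: perp_subspace => _ [i [k [_ ->]]]; exact: delta_zeta_L2. Qed.

Lemma H2_closed n : l2closed (@H2 R n).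
Proof. by rewrite H2_perp; apply: perp_closed => _ [i [k [_ ->]]]; exact: delta_zeta_L2. Qed.

Lemma H2_L2W n (f : R -> 'cV[C]_n) : H2 f -> L2 f. Proof. by case. Qed.

Lemma H2minus_subspace n : subspace (@H2minus R n).
Proof. by apply: (@perp_subspace _ _ (@H2 R n)); exact: H2_L2W. Qed.

Lemma H2minus_closed n : l2closed (@H2minus R n).
Proof. by apply: (@perp_closed _ _ (@H2 R n)); exact: H2_L2W. Qed.

(** The antiunitary involution $f\mapsto\overline{\zeta f}$. The factor $\bar\zeta$ accounts for the
    constants, which lie in $H^2$ but not in $H^2_-$. *)
Definition flip n (f : R -> 'cV[C]_n) : R -> 'cV[C]_n :=
  fun t => (zeta t)^* *: cjmx (f t).

Lemma flipK n (f : R -> 'cV[C]_n) : flip (flip f) = f.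
Proof.
apply/funext => t; apply/matrixP => i j; rewrite !mxE rmorphM /= !conjCK mulrA.
by rewrite -[X in X * _]mulrC mulJ_normc normc_zeta expr1n mul1r.
Qed.

Lemma flip_enorm n (f : R -> 'cV[C]_n) t : enorm (flip f t) ^+ 2 = enorm (f t) ^+ 2.
Proof.
rewrite !enorm_sq; apply: eq_bigr => i _.
by rewrite !mxE normc_mul !normcJ normc_zeta mul1r.
Qed.

Lemma flip_L2 n (f : R -> 'cV[C]_n) : L2 f -> L2 (flip f).
Proof.
move=> /L2_sqint sf; apply/L2_sqint => i; under eq_fun do rewrite !mxE.
apply: (@sqintM_bd _ _ _ 1); first by apply: sqintJ.
  by apply: cmeasJ; exact: cmeas_zeta.
by move=> t; rewrite normcJ normc_zeta.
Qed.

Lemma flip_l2 n (f : R -> 'cV[C]_n) : l2 (flip f) = l2 f.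
Proof.
rewrite /l2 !nsqE; congr Num.sqrt; apply: eq_Rintegral => t _.
exact: flip_enorm.
Qed.

Lemma flipB n (f g : R -> 'cV[C]_n) : flip (fun t => f t - g t) = fun t => flip f t - flip g t.
Proof.
by apply/funext => t; apply/matrixP => i j; rewrite !mxE rmorphB mulrBr.
Qed.

Lemma flip_mul m n (A : R -> 'M[C]_(m, n)) f :
  flip (fun t => A t *m f t) = fun t => cjmx (A t) *m flip f t.
Proof. by apply/funext => t; rewrite /flip /cjmx map_mxM -scalemxAr. Qed.

(** The inner product with a function $g$ of $H^2$ is, coordinate by coordinate, the conjugate of
    the integral of $fg\zeta$, which vanishes by [hardy2_mul]. *)
Lemma H2_flip n (f : R -> 'cV[C]_n) : H2 f -> H2minus (flip f).
Proof.
move=> Hf; have [Lf _] := Hf; split; first exact: flip_L2.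
move=> g Hg; have [Lg _] := Hg; have /H2_hardy hf := Hf; have /H2_hardy hg := Hg.
rewrite inner2E //; last exact: flip_L2.
rewrite big1 // => i _.
have sf : sqint (fun t => f t i 0) by have [] := hf i.
have sg : sqint (fun t => zeta t ^ 1 * g t i 0).
  apply: (@sqintM_bd _ _ _ 1); [by have [] := hg i|exact: cmeas_zetaX|].
  by move=> t; rewrite normc_zetaX.
transitivity ((integralC (fun t => f t i 0 * (zeta t ^ 1 * g t i 0)))^*).
  rewrite -integralCJ; last exact: cintgM.
  congr integralC; apply/funext => t; rewrite !mxE expr1z.
  by rewrite (rmorphM _ (f t i 0)) (rmorphM _ (zeta t)) /= mulrA [in LHS](mulrC (zeta t)^*).
rewrite (_ : (fun t => _) = fun t => f t i 0 * g t i 0 * zeta t ^ 1); last first.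
  by apply/funext => t; rewrite [X in _ * X]mulrC mulrA.
by rewrite hardy2_mul ?rmorph0.
Qed.

Lemma H2minus_flip n (y : R -> 'cV[C]_n) : H2minus y -> H2 (flip y).
Proof.
move=> [Ly y0]; split=> [|i k k0]; first exact: flip_L2.
(* The coefficient of index [k] of the flipped function is the conjugate of the inner product of [y]
   with this vector, and [- k - 1] is nonnegative for [k < 0]. *)
have Hz : H2 (fun t => @zeta R t ^ (- k - 1) *: delta_mx i 0 : 'cV[C]_n).
  have [m ->] : exists m : nat, - k - 1 = m.
    by exists (absz (- k - 1)); rewrite gez0_abs // subr_ge0 -gtz0_ge1 oppr_gt0.
  apply/H2_hardy => j; have [->|ji] := eqVneq j i.
    by under eq_fun do rewrite !mxE !eqxx mulr1; exact: hardy2_zeta.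
  under eq_fun do rewrite !mxE (negbTE ji) mulr0.
  split=> [|l l0]; first exact: sqint0.
  by rewrite /fourier; under eq_fun do rewrite mul0r; exact: integralC0.
have sy : sqint (fun t => y t i 0) by move: Ly => /L2_sqint.
have := y0 _ Hz; move/(congr1 Num.conj); rewrite rmorph0; apply: etrans.
rewrite /inner2 -integralCJ; last by apply: L2_cintg => //; case: Hz.
congr integralC; apply/funext => t; rewrite (bigD1 i) //= big1.
  rewrite !mxE !eqxx mulr1 addr0 (rmorphM Num.conj) /= conjCK expfzDr ?zeta_neq0 //.
  by rewrite exprN1 -zetaJ; move: (zeta t ^ (- k)) ((zeta t)^*) ((y t i 0)^*) => A B D; ring.
by move=> j ji; rewrite !mxE (negbTE ji) mulr0 conjC0 mulr0.
Qed.

Section Mixed.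
Context {p q : nat}.
Implicit Types f g : R -> 'cV[C]_(p + q).

Lemma usub_lin (c : C) f g : (fun t => usubmx (c *: f t + g t)) =
  (fun t => c *: usubmx (f t) + usubmx (g t)).
Proof. by apply/funext => t; rewrite linearP. Qed.

Lemma usub_L2 f : L2 f -> L2 (fun t => usubmx (f t)).
Proof. by move=> /L2_sqint sf; apply/L2_sqint => i; under eq_fun do rewrite mxE. Qed.

Lemma dsub_L2 f : L2 f -> L2 (fun t => dsubmx (f t)).
Proof. by move=> /L2_sqint sf; apply/L2_sqint => i; under eq_fun do rewrite mxE. Qed.

Lemma col_L2 (f1 : R -> 'cV[C]_p) (f2 : R -> 'cV[C]_q) : L2 f1 -> L2 f2 ->
  L2 (fun t => col_mx (f1 t) (f2 t)).
Proof.
move=> /L2_sqint s1 /L2_sqint s2; apply/L2_sqint => i.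
case: (split_ordP i) => i' ->.
  by under eq_fun do rewrite col_mxEu.
by under eq_fun do rewrite col_mxEd.
Qed.

Lemma H2_L2_subspace : subspace (@H2_L2 R p q).
Proof.
have [_ H0 Hl] := H2_subspace p; split=> [f []//||c f g [Lf Hf] [Lg Hg]].
  split; first exact: L2_0.
  by have := H0; congr (H2 _); apply/funext => t; rewrite linear0.
split; first exact: L2_lin.
by rewrite /= usub_lin; exact: Hl.
Qed.

Lemma H2minus_L2_subspace : subspace (@H2minus_L2 R p q).
Proof.
have [_ H0 Hl] := H2minus_subspace p; split=> [f []//||c f g [Lf Hf] [Lg Hg]].
  split; first exact: L2_0.
  by have := H0; congr (H2minus _); apply/funext => t; rewrite linear0.
split; first exact: L2_lin.
by rewrite /= usub_lin; exact: Hl.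
Qed.

Lemma H2minus_L2_closed : l2closed (@H2minus_L2 R p q).
Proof.
move=> g Lg ag; split=> //; apply: H2minus_closed; first exact: usub_L2.
move=> eps /ag[e [Le He] lt]; exists (fun t => usubmx (e t)) => //.
apply: le_lt_trans lt; have LB := L2B Le Lg.
rewrite /l2 ler_sqrt ?nsq_ge0 //.
rewrite (_ : (fun t => usubmx (e t) - usubmx (g t)) = fun t => usubmx (e t - g t)); last first.
  by apply/funext => t; rewrite linearB.
have /L2P[m1 _] := LB; have /L2P[m2 _] := usub_L2 LB.
rewrite -lee_fin -!nsq_int //; last exact: usub_L2.
apply: ge0_le_integral => //.
- by move=> t _; rewrite lee_fin sqr_ge0.
- by apply/measurable_EFinP; exact: measurable_enorm_sq.
- by apply/measurable_EFinP; exact: measurable_enorm_sq.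
- move=> t _; rewrite lee_fin !enorm_sq big_split_ord /=.
  under eq_bigr do rewrite mxE.
  by rewrite lerDl; apply: sumr_ge0 => i _; exact: sqr_ge0.
Qed.

Lemma flip_usub f : (fun t => usubmx (flip f t)) = flip (fun t => usubmx (f t)).
Proof. by apply/funext => t; apply/matrixP => i j; rewrite !mxE. Qed.

Lemma H2_L2_flip f : H2_L2 f -> H2minus_L2 (flip f).
Proof.
move=> [Lf Hf]; split; first exact: flip_L2.
by rewrite /= flip_usub; exact: H2_flip.
Qed.

Lemma H2minus_L2_flip f : H2minus_L2 f -> H2_L2 (flip f).
Proof.
move=> [Lf Hf]; split; first exact: flip_L2.
by rewrite /= flip_usub; exact: H2minus_flip.
Qed.

End Mixed.

Lemma GammaP m1 m2 n1 n2 (Psi : R -> 'M[C]_(m1 + m2, n1 + n2))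
  (f : R -> 'cV[C]_(n1 + n2)) : bdmx Psi -> L2 f ->
  H2minus_L2 (Gamma Psi f) /\
  forall g, H2minus_L2 g -> inner2 (Gamma Psi f) g = inner2 (fun t => Psi t *m f t) g.
Proof.
move=> bP Lf; have LP := bdmx_L2 bP Lf.
have [HG oG] := orth_projP H2minus_L2_subspace H2minus_L2_closed LP.
split=> // g Hg; have := oG _ Hg; rewrite inner2Bl //; try by [case: HG|case: Hg].
by move/eqP; rewrite subr_eq0 => /eqP.
Qed.

Lemma orth_H2_H2minus (f : R -> 'cV[C]_1) : L2 f ->
  H2 (orth_proj (@H2 R 1) f) /\ H2minus (fun t => f t - orth_proj (@H2 R 1) f t).
Proof.
move=> Lf; have [Hp op] := orth_projP (H2_subspace 1) (@H2_closed 1) Lf.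
by split=> //; split=> //; apply: L2B => //; case: Hp.
Qed.

End HardyModules.

(** * Pointwise structure of thematic functions *)

Section ThematicLayer.
Context {R : realType}.
Local Notation C := R[i].
Local Notation mu := (@arc_length R).
Local Notation normc := (@ComplexField.Normc.normc R).

(* The first column v of a thematic matrix function V and the remaining rows T
   of its adjoint, so that V^* f = (v^* f, T f). *)
Definition layer p q (v : R -> 'cV[C]_(p.+1 + q)) (T : R -> 'M[C]_(p + q, p.+1 + q)) : Prop :=
  [/\ bdmx v, bdmx T,
    {ae mu, forall t, [/\ (v t)^t* *m v t = 1%:M, T t *m v t = 0,
       T t *m (T t)^t* = 1%:M & v t *m (v t)^t* + (T t)^t* *m T t = 1%:M]},
    forall x, H2 x -> H2_L2 (fun t => v t *m x t) &
    forall h, H2_L2 h -> forall eps : R, 0 < eps ->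
      exists2 f, H2_L2 f & l2 (fun t => T t *m f t - h t) < eps].

(** On the zero set of [v] every function $v^tf$ is at distance 1 from the constant 1, so the
    squared $L^2$ distance is at least the measure of that set; co-outerness makes this distance
    arbitrarily small. *)
Lemma coouter_col_neq0 p (v : R -> 'cV[C]_p) : Hinf v -> coouter_fun v ->
  {ae mu, forall t, v t != 0}.
Proof.
move=> /Hinf_hardymx[bv _] [_ dv].
pose S := (fun t => enorm (v t) ^+ 2) @^-1` [set 0].
have mS : measurable S.
  rewrite -[S]setTI; apply: (measurable_enorm_sq _ measurableT) => //.
  by case: bv.
have H1 : H2 (cv (fun=> 1 : C)).
  by apply/H2_hardy => i; under eq_fun do rewrite mxE; exact: hardy2_cst1.
have L1 : L2 (cv (fun=> 1 : C)) by case: H1.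
have S0 : mu S = 0%E.
  apply/eqP; rewrite eq_le; apply/andP; split; last exact: measure_ge0.
  apply/lee_addgt0Pr => eps eps0; rewrite add0e.
  have [|g [f Hf ->]] := dv _ H1 (Num.sqrt eps); first by rewrite sqrtr_gt0.
  have Lf : L2 (fun t => (v t)^T *m f t).
    by apply: bdmx_L2; [exact: bdmx_tr|case: Hf].
  have LB := L2B Lf L1; have /L2P[mB _] := LB.
  rewrite L2dist_l2 // lte_fin /l2 ltr_sqrt // => lt.
  apply: (@le_trans _ _ (nsq (fun t => (v t)^T *m f t - cv (fun=> 1) t))%:E); last first.
    by rewrite lee_fin ltW.
  rewrite -nsq_int // -[S]setIT; apply: (@le_trans _ _ (\int[mu]_t (\1_S t)%:E)%E).
    by rewrite le_eqVlt; apply/orP; left; apply/eqP; rewrite [RHS]integral_indic.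
  apply: ge0_le_integral => //.
  - by apply/measurable_EFinP; exact: measurable_indic.
  - by apply/measurable_EFinP; exact: measurable_enorm_sq.
  - move=> t _; rewrite lee_fin indicE; have [tS|_] := boolP (t \in S); last exact: sqr_ge0.
    move: tS; rewrite inE /S /= enorm_sq => /eqP; rewrite psumr_eq0; last by move=> i _; exact: sqr_ge0.
    move=> /allP vt; have -> : v t = 0.
      apply/matrixP => i j; rewrite ord1 mxE.
      have := vt i (mem_index_enum i); rewrite sqrf_eq0 => /eqP.
      exact: ComplexField.Normc.eq0_normc.
    rewrite trmx0 mul0mx sub0r enorm_sq big_ord1 !mxE normc_sq ReN ImN /=.
    by rewrite sqrrN expr1n lerDl sqr_ge0.
exists S; split=> // t /= /negP; rewrite negbK => /eqP vt; rewrite /S /= vt.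
by rewrite enorm_sq big1 // => i _; rewrite mxE normc_sq /= expr0n addr0.
Qed.

(** The square matrix with columns [v1] and [Vc] is invertible, since [v1] is nonzero and orthogonal
    to the isometry [Vc]. Being orthogonal to all its columns, [X l] vanishes; together with
    [Y l = 0] this kills [l], because [X] stacked on [Y] is isometric. It makes the lower right
    block of a thematic function pointwise injective. *)
Lemma orth_block_eq0 p q (v1 : 'cV[C]_p.+1) (Vc : 'M[C]_(p.+1, p)) (X : 'M[C]_(p.+1, q))
    (Y : 'M[C]_q) (l : 'cV[C]_q) :
  v1 != 0 -> Vc^t* *m Vc = 1%:M -> Vc^t* *m v1 = 0 -> v1^t* *m (X *m l) = 0 ->
  Vc^t* *m X = 0 -> X^t* *m X + Y^t* *m Y = 1%:M -> Y *m l = 0 -> l = 0.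
Proof.
move=> v0 VV Vv vX VX XY Yl.
have vV : v1^t* *m Vc = 0 by rewrite -[LHS]adjK adj_mul adjK Vv trmx0 map_mx0.
pose B : 'M[C]_(p.+1, 1 + p) := row_mx v1 Vc.
pose a := (v1^t* *m v1) 0 0.
have a0 : a != 0.
  rewrite /a -dotp_mx /dotp; apply: contra v0 => /eqP /(congr1 (@complex.Re R)).
  rewrite Re_sum; under eq_bigr do rewrite Re_mulJ.
  move=> /eqP; rewrite psumr_eq0; last by move=> i _; exact: sqr_ge0.
  move=> /allP vt; apply/eqP/matrixP => i j; rewrite ord1 mxE.
  have := vt i (mem_index_enum i); rewrite sqrf_eq0 => /eqP.
  exact: ComplexField.Normc.eq0_normc.
have aE : v1^t* *m v1 = a%:M by rewrite [LHS]mx11_scalar.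
have BB : B^t* *m (B *m block_mx (a^-1)%:M 0 0 1%:M) = 1%:M.
  rewrite mulmxA /B tr_row_mx map_col_mx mul_col_row aE VV Vv vV mulmx_block.
  rewrite !mulmx0 !mul0mx !addr0 !add0r mulmx1 -scalar_mxM divff //.
  by rewrite -scalar_mx_block.
have [BU _] := mulmx1_unit BB.
have Bx : B^t* *m (X *m l) = 0.
  by rewrite /B tr_row_mx map_col_mx mul_col_mx vX mulmxA VX mul0mx col_mx0.
have Xl : X *m l = 0 by rewrite -[LHS](mulKmx BU) Bx mulmx0.
by rewrite -[l]mul1mx -XY mulmxDl -!mulmxA Xl Yl !mulmx0 addr0.
Qed.

End ThematicLayer.

(** * From thematic functions to layers, and density of the tails *)

Section ThematicDensity.
Context {R : realType}.
Local Notation C := R[i].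
Local Notation mu := (@arc_length R).

Lemma bdmx_col m1 m2 n (A : R -> 'M[C]_(m1, n)) (B : R -> 'M[C]_(m2, n)) :
  bdmx A -> bdmx B -> bdmx (fun t => col_mx (A t) (B t)).
Proof.
move=> bA bB; have [mA _] := bA; have [mB _] := bB.
have [[a a0 Ha] [b b0 Hb]] := (bdmx_gt0 bA, bdmx_gt0 bB); split.
  apply: mxmeasI => i j; case: (split_ordP i) => i' ->.
    by under eq_fun do rewrite col_mxEu; exact: mxmeas_entry.
  by under eq_fun do rewrite col_mxEd; exact: mxmeas_entry.
exists (a + b); apply: filterS2 Ha Hb => t At Bt i j; case: (split_ordP i) => i' ->.
  by rewrite col_mxEu; have := At i' j; lra.
by rewrite col_mxEd; have := Bt i' j; lra.
Qed.

Lemma bdmx_row m n1 n2 (A : R -> 'M[C]_(m, n1)) (B : R -> 'M[C]_(m, n2)) :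
  bdmx A -> bdmx B -> bdmx (fun t => row_mx (A t) (B t)).
Proof.
move=> bA bB; have := bdmx_tr (bdmx_col (bdmx_tr bA) (bdmx_tr bB)).
by under eq_fun do rewrite tr_col_mx !trmxK.
Qed.

(** The columns of [V] are regrouped as the first one, [v], and the remaining ones, which form the
    adjoint of [T]; the identities are then the blocks of $V^*V=1$ and $VV^*=1$. *)
Lemma thematic_unitary p q (v1 : 'cV[C]_p.+1) (v2 : 'cV[C]_q) (Vc : 'M[C]_(p.+1, p))
    (E : 'M[C]_(p.+1 + q, q)) (V : 'M[C]_(p.+1 + q)) :
  let v := col_mx v1 v2 in
  let T := col_mx (row_mx Vc^T (0 : 'M[C]_(p, q))) ((rsubmx V : 'M[C]_(p.+1 + q, q))^t*) in
  V \is unitarymx ->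
  V = conform_mx 0 (row_mx (block_mx v1 (cjmx Vc) v2 0 : 'M[C]_(p.+1 + q, p.+1)) E) ->
  [/\ V^t* = (col_mx (v^t*) T : 'M[C]_(1 + (p + q), p.+1 + q)), v^t* *m v = 1%:M, T *m v = 0,
      T *m T^t* = 1%:M & v *m v^t* + T^t* *m T = 1%:M].
Proof.
move=> v T uV; rewrite conform_mx_id => VE.
have rV : rsubmx V = E by rewrite VE row_mxKr.
have TE : T^t* = row_mx (col_mx (cjmx Vc) 0) E.
  rewrite /T rV tr_col_mx tr_row_mx map_row_mx map_col_mx.
  by rewrite [X in row_mx _ X]adjK trmxK trmx0 map_mx0.
have VE' : V = (row_mx v (T^t*) : 'M[C]_(p.+1 + q, 1 + (p + q))).
  rewrite TE VE block_mxEh row_mxA; exact/esym/castmx_id.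
have VA : V^t* = (col_mx (v^t*) T : 'M[C]_(1 + (p + q), p.+1 + q)).
  have h := congr1 (fun A : 'M[C]_(p.+1 + q, 1 + (p + q)) => A^t*) VE'.
  by apply: etrans h _; rewrite tr_row_mx map_col_mx; congr col_mx; exact: adjK.
have VV : V *m V^t* = 1%:M by exact/unitarymxP.
have VV' : V^t* *m V = 1%:M by exact: mulmx1C.
have e1 : (col_mx (v^t*) T : 'M[C]_(1 + (p + q), p.+1 + q)) *m
    (row_mx v (T^t*) : 'M[C]_(p.+1 + q, 1 + (p + q))) = 1%:M by rewrite -VA -VE'.
have e2 : (row_mx v (T^t*) : 'M[C]_(p.+1 + q, 1 + (p + q))) *m
    (col_mx (v^t*) T : 'M[C]_(1 + (p + q), p.+1 + q)) = 1%:M by rewrite -VA -VE'.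
rewrite mul_row_col in e2; rewrite mul_col_row (scalar_mx_block 1) in e1.
by have [? _ ? ?] := eq_block_mx e1; split.
Qed.

Lemma L2dense_l2 m (Z Y : set (R -> 'cV[C]_m)) g (eps : R) :
  (forall f, Z f -> L2 f) -> (forall f, Y f -> L2 f) -> L2dense Z Y -> Y g -> 0 < eps ->
  exists2 f, Z f & l2 (fun t => f t - g t) < eps.
Proof.
move=> ZL YL ZY Yg /(ZY _ Yg)[f Zf lt]; exists f => //.
by rewrite -lte_fin -L2dist_l2 //; [exact: ZL|exact: YL].
Qed.

Lemma l2_col p q (f1 : R -> 'cV[C]_p) (f2 : R -> 'cV[C]_q) : L2 f1 -> L2 f2 ->
  l2 (fun t => col_mx (f1 t) (f2 t)) <= l2 f1 + l2 f2.
Proof.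
move=> L1 L2'; have Lc := col_L2 L1 L2'.
rewrite -(@ler_pXn2r _ 2) ?nnegrE ?addr_ge0 ?l2_ge0 //.
rewrite sqrrD !l2_sq (_ : nsq (fun t => col_mx _ _) = nsq f1 + nsq f2).
  by rewrite addrAC lerDl mulrn_wge0 // mulr_ge0 ?l2_ge0.
have /L2P[_ i1] := L1; have /L2P[_ i2] := L2'.
rewrite !nsqE -RintegralD //; apply: eq_Rintegral => t _.
rewrite !enorm_sq big_split_ord /=.
by congr (_ + _); apply: eq_bigr => i _; rewrite ?col_mxEu ?col_mxEd.
Qed.

(** For the density of the tails, let $X$ and $Y$ be the upper and lower blocks of the last [q]
    columns. The tail of $(f_1,f_2)$ is $(V_c^tf_1,\ X^*f_1+Y^*f_2)$: co-outerness of [Vc] lets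
    $f_1$ approximate the upper part, and the free $L^2$ function $f_2$ then repairs the lower
    one. *)
Lemma thematic_layer p q (V : R -> 'M[C]_(p.+1 + q)) : thematic V ->
  exists (v : R -> 'cV[C]_(p.+1 + q)) (T : R -> 'M[C]_(p + q, p.+1 + q)),
    layer v T /\ {ae mu, forall t,
      (V t)^t* = (col_mx ((v t)^t*) (T t) : 'M[C]_(1 + (p + q), p.+1 + q))}.
Proof.
case=> _ mV uV [v1 [v2 [Vc [E [[Hv1 cv1] Lv2 [iVc cVc] /ae_eqP VE]]]]].
pose v t := col_mx (v1 t) (v2 t).
pose E' t : 'M[C]_(p.+1 + q, q) := rsubmx (V t).
pose T t := col_mx (row_mx (Vc t)^T (0 : 'M[C]_(p, q))) ((E' t)^t*).
have hv1 := Hinf_hardymx Hv1; have [bv1 _] := hv1.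
have [HVc _] := iVc; have hVc := Hinf_hardymx HVc; have [bVc _] := hVc.
have bV := unitary_bdmx mV uV.
have bE' : bdmx E'.
  have [mV' [M HM]] := bV; split.
    by apply: mxmeasI => i j; under eq_fun do rewrite mxE; exact: mxmeas_entry.
  by exists M; apply: filterS HM => t h i j; rewrite mxE.
have bv : bdmx v by apply: bdmx_col => //; exact: Linf_bdmx.
have bT : bdmx T.
  apply: bdmx_col; last exact: bdmx_adj.
  by apply: bdmx_row; [exact: bdmx_tr|exact: bdmx0].
have U : {ae mu, forall t, [/\ (V t)^t* = (col_mx ((v t)^t*) (T t) : 'M[C]_(1 + (p + q), p.+1 + q)),
      (v t)^t* *m v t = 1%:M, T t *m v t = 0,
      T t *m (T t)^t* = 1%:M & v t *m (v t)^t* + (T t)^t* *m T t = 1%:M]}.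
  by apply: filterS2 uV VE => t; exact: thematic_unitary.
exists v, T; split; last by apply: filterS U => t [].
split=> //; first by apply: filterS U => t [].
  move=> x Hx; have Lx := H2_L2W Hx; split; first exact: bdmx_L2.
  have := hardymx_H2 hv1 Hx; congr (H2 _); apply/funext => t.
  by rewrite /v mul_col_mx col_mxKu.
move=> h [Lh Hh] eps eps0; have e2 : 0 < eps / 2 by rewrite divr_gt0.
have [_ dVc] := cVc.
have [f1 Hf1 lt1] : exists2 f1 : R -> 'cV[C]_p.+1, H2 f1 &
    l2 (fun t => (Vc t)^T *m f1 t - usubmx (h t)) < eps / 2.
  have [||_ [f1 Hf1 ->] lt] := L2dense_l2 _ _ dVc Hh e2.
  - move=> _ [f Hf ->]; apply: bdmx_L2; first exact: bdmx_tr.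
    exact: H2_L2W.
  - exact: H2_L2W.
  - by exists f1.
have Lf1 := H2_L2W Hf1.
pose X t := usubmx (E' t); pose Y t := dsubmx (E' t).
have bX : bdmx X.
  have [mE' [M HM]] := bE'; split.
    by apply: mxmeasI => i j; under eq_fun do rewrite mxE; exact: mxmeas_entry.
  by exists M; apply: filterS HM => t H i j; rewrite mxE.
have bY : bdmx Y.
  have [mE' [M HM]] := bE'; split.
    by apply: mxmeasI => i j; under eq_fun do rewrite mxE; exact: mxmeas_entry.
  by exists M; apply: filterS HM => t H i j; rewrite mxE.
(* The corrections that $f_2$ can make to the lower part; they must be shown to be dense in
   $L^2$. *)
pose D : set (R -> 'cV[C]_q) := [set g | exists2 f2, L2 f2 & g = fun t => (Y t)^t* *m f2 t].
have sD : subspace D.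
  split.
  - by move=> _ [f2 Lf2 ->]; apply: bdmx_L2 => //; exact: bdmx_adj.
  - by exists (fun=> 0); [exact: L2_0|apply/funext => t; rewrite mulmx0].
  - move=> c _ _ [f Lf ->] [g Lg ->]; exists (fun t => c *: f t + g t); first exact: L2_lin.
    by apply/funext => t; rewrite mulmxDr scalemxAr.
have v1n0 := coouter_col_neq0 Hv1 cv1.
(* Orthogonality of [l] to the range of $Y^*$ means $Yl=0$, by testing against $Y^*Yl$; pointwise
   injectivity of [Y] finishes. *)
have oD l : L2 l -> (forall e, D e -> inner2 l e = 0) -> l =ae (fun=> 0).
  move=> Ll ol; have LYl := bdmx_L2 bY Ll.
  have Yl0 : (fun t => Y t *m l t) =ae (fun=> 0).
    apply: nsq_eq0 => //; rewrite /nsq inner2_adj ol //.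
    by exists (fun t => Y t *m l t).
  apply/ae_eqP; move/ae_eqP: Yl0 => Yl0.
  apply: filterS3 U v1n0 Yl0 => t [_ vv Tv TT VV] v0 Yl.
  have EE : E' t = col_mx (X t) (Y t) by rewrite vsubmxK.
  have ETv : (E' t)^t* *m v t = 0.
    by have := congr1 (@dsubmx _ p q 1) Tv; rewrite /T mul_col_mx col_mxKd linear0.
  have vE : (v t)^t* *m E' t = 0 by rewrite -[LHS]adjK adj_mul adjK ETv trmx0 map_mx0.
  have Vv : (Vc t)^T *m v1 t = 0.
    have := congr1 (@usubmx _ p q 1) Tv.
    by rewrite /T mul_col_mx col_mxKu linear0 /v mul_row_col mul0mx addr0.
  have [VVc VcE EE1] : [/\ (Vc t)^T *m cjmx (Vc t) = 1%:M,
      row_mx (Vc t)^T (0 : 'M[C]_(p, q)) *m E' t = 0 & (E' t)^t* *m E' t = 1%:M].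
    move: TT; rewrite {2}/T tr_col_mx map_row_mx adjK tr_row_mx map_col_mx trmxK trmx0 map_mx0.
    rewrite /T mul_col_row (scalar_mx_block p) => /eq_block_mx[h1 h2 _ h4]; split=> //.
    by move: h1; rewrite mul_row_col mulmx0 addr0.
  have cT : (cjmx (Vc t))^t* = (Vc t)^T by apply/matrixP => i j; rewrite !mxE conjCK.
  apply: (@orth_block_eq0 _ _ _ (v1 t) (cjmx (Vc t)) (X t) (Y t)) => //.
  - by rewrite cT.
  - by rewrite cT.
  - have := congr1 (fun A => A *m l t) vE.
    rewrite /= mul0mx EE -mulmxA mul_col_mx Yl /v tr_col_mx map_row_mx mul_row_col mulmx0 addr0.
    exact.
  - by rewrite cT; move: VcE; rewrite EE mul_row_col mul0mx addr0.
  - by rewrite -EE1 EE tr_col_mx map_row_mx mul_row_col.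
have LXf := bdmx_L2 (bdmx_adj bX) Lf1.
have Lh2 := dsub_L2 Lh.
have [_ [f2 Lf2 ->] lt2] := dense_of_orth0 sD oD (L2B Lh2 LXf) e2.
have Lf : L2 (fun t => col_mx (f1 t) (f2 t)) by exact: col_L2.
exists (fun t => col_mx (f1 t) (f2 t)).
  split=> //; have := Hf1; congr (H2 _); apply/funext => t.
  by rewrite col_mxKu.
have LY := bdmx_L2 (bdmx_adj bY) Lf2.
have LV := bdmx_L2 (bdmx_tr bVc) Lf1.
have -> : (fun t => T t *m col_mx (f1 t) (f2 t) - h t) = (fun t =>
    col_mx ((Vc t)^T *m f1 t - usubmx (h t))
      ((Y t)^t* *m f2 t - (dsubmx (h t) - (X t)^t* *m f1 t))).
  apply/funext => t; rewrite -[in LHS](vsubmxK (h t)) /T mul_col_mx opp_col_mx add_col_mx.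
  rewrite mul_row_col mul0mx addr0 -[E' t](vsubmxK (E' t)) tr_col_mx map_row_mx mul_row_col.
  by congr col_mx; rewrite opprB [RHS]addrA [in RHS](addrC (_ *m _)).
apply: le_lt_trans (l2_col _ _) _.
- by apply: L2B => //; exact: usub_L2.
- by apply: L2B => //; exact: L2B.
by rewrite [ltRHS](splitr eps) ltrD.
Qed.

End ThematicDensity.

(** * Finite linear combinations, orthonormalization and the geometry of a layer *)

Section Combinations.
Context {R : realType}.
Local Notation C := R[i].
Local Notation mu := (@arc_length R).
Local Notation normc := (@ComplexField.Normc.normc R).

Definition comb n N (c : 'rV[C]_N) (f : 'I_N -> R -> 'cV[C]_n) : R -> 'cV[C]_n :=
  fun t => \sum_i c 0 i *: f i t.

Lemma comb_sub n N E (c : 'rV[C]_N) (f : 'I_N -> R -> 'cV[C]_n) : subspace E ->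
  (forall i, E (f i)) -> E (comb c f).
Proof. by move=> sE Ef; exact: (subspace_lin (fun i => c 0 i) sE Ef). Qed.

Lemma comb_L2 n N (c : 'rV[C]_N) (f : 'I_N -> R -> 'cV[C]_n) :
  (forall i, L2 (f i)) -> L2 (comb c f).
Proof. by move=> Lf; apply: comb_sub => //; exact: L2_subspace. Qed.

Lemma comb_mulmx n N M (c : 'rV[C]_M) (A : 'M[C]_(M, N)) (f : 'I_N -> R -> 'cV[C]_n) :
  comb c (fun i => comb (row i A) f) = comb (c *m A) f.
Proof.
apply/funext => t; rewrite /comb.
under eq_bigr do rewrite scaler_sumr.
rewrite exchange_big /=; apply: eq_bigr => j _.
rewrite mxE scaler_suml; apply: eq_bigr => i _.
by rewrite !mxE scalerA.
Qed.

Lemma comb_mx n m N (c : 'rV[C]_N) (f : 'I_N -> R -> 'cV[C]_n) (A : R -> 'M[C]_(m, n)) t :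
  A t *m comb c f t = comb c (fun i t => A t *m f i t) t.
Proof. by rewrite /comb mulmx_sumr; apply: eq_bigr => i _; rewrite scalemxAr. Qed.

Lemma inner2_suml n (I : finType) (F : I -> R -> 'cV[C]_n) g : (forall i, L2 (F i)) -> L2 g ->
  inner2 (fun t => \sum_i F i t) g = \sum_i inner2 (F i) g.
Proof.
move=> LF Lg; rewrite /inner2 -integralC_sum; last by move=> i; exact: L2_cintg.
congr integralC; apply/funext => t; rewrite exchange_big /=.
by apply: eq_bigr => i _; rewrite summxE mulr_suml.
Qed.

Lemma inner2_combl n N (c : 'rV[C]_N) (f : 'I_N -> R -> 'cV[C]_n) g : (forall i, L2 (f i)) ->
  L2 g -> inner2 (comb c f) g = \sum_i c 0 i * inner2 (f i) g.
Proof.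
move=> Lf Lg; rewrite (inner2_suml (F := fun i t => c 0 i *: f i t)) //.
  by apply: eq_bigr => i _; rewrite inner2Zl.
by move=> i; exact: L2Z.
Qed.

Lemma inner2_comb n N (c d : 'rV[C]_N) (f : 'I_N -> R -> 'cV[C]_n) : (forall i, L2 (f i)) ->
  inner2 (comb c f) (comb d f) = (c *m (\matrix_(i, j) inner2 (f i) (f j)) *m d^t*) 0 0.
Proof.
move=> Lf; have Ld := comb_L2 d Lf; rewrite inner2_combl // -mulmxA mxE.
apply: eq_bigr => i _; congr (_ * _); rewrite mxE inner2_conj // inner2_combl // rmorph_sum.
by apply: eq_bigr => j _; rewrite !mxE rmorphM /= mulrC -inner2_conj.
Qed.

Definition orthonormal n N (f : 'I_N -> R -> 'cV[C]_n) : Prop :=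
  forall i j, inner2 (f i) (f j) = (i == j)%:R.

Definition indep n N (f : 'I_N -> R -> 'cV[C]_n) : Prop :=
  forall c : 'rV[C]_N, comb c f =ae (fun=> 0) -> c = 0.

Definition rnsq N (c : 'rV[C]_N) : R := \sum_i normc (c 0 i) ^+ 2.

Lemma rnsq_ge0 N (c : 'rV[C]_N) : 0 <= rnsq c.
Proof. by apply: sumr_ge0 => i _; exact: sqr_ge0. Qed.

Lemma rnsq_eq0 N (c : 'rV[C]_N) : rnsq c = 0 -> c = 0.
Proof.
move=> /eqP; rewrite psumr_eq0; last by move=> i _; exact: sqr_ge0.
move=> /allP h; apply/matrixP => i j; rewrite ord1 mxE.
have := h j (mem_index_enum j); rewrite sqrf_eq0 => /eqP.
exact: ComplexField.Normc.eq0_normc.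
Qed.

Lemma nsq_orthonormal n N (c : 'rV[C]_N) (f : 'I_N -> R -> 'cV[C]_n) :
  (forall i, L2 (f i)) -> orthonormal f -> nsq (comb c f) = rnsq c.
Proof.
move=> Lf of1; rewrite /nsq inner2_comb // (_ : (\matrix_(i, j) _) = 1%:M); last first.
  by apply/matrixP => i j; rewrite !mxE.
rewrite mulmx1 mxE Re_sum; apply: eq_bigr => i _.
by rewrite !mxE Re_mulJ.
Qed.

(** The Gram matrix is diagonalized by a unitary [P]. Its eigenvalues are the squared norms of the
    combinations given by the rows of [P], positive by independence, and [A] is [P] with row [i]
    divided by the square root of eigenvalue [i]. *)
Lemma gram_schmidt n N (f : 'I_N -> R -> 'cV[C]_n) : (forall i, L2 (f i)) -> indep f ->
  exists A : 'M[C]_N, orthonormal (fun i => comb (row i A) f).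
Proof.
move=> Lf If; pose G : 'M[C]_N := \matrix_(i, j) inner2 (f i) (f j).
have GA : G^t* = G by apply/matrixP => i j; rewrite !mxE -inner2_conj.
have nG : G \is normalmx by apply/normalmxP; rewrite GA.
pose P := spectralmx G; pose d := spectral_diag G.
have uP : P \is unitarymx by exact: spectral_unitarymx.
have PP : P *m P^t* = 1%:M by exact/unitarymxP.
have GE : G = P^t* *m diag_mx d *m P.
  by rewrite -(invmx_unitary uP); exact/orthomx_spectralP.
have PG : P *m G *m P^t* = diag_mx d.
  by rewrite GE !mulmxA PP mul1mx -mulmxA PP mulmx1.
have rowE (A B : 'M[C]_N) i j : (row i A *m G *m (row j B)^t*) 0 0 = (A *m G *m B^t*) i j.
  by rewrite -row_mul !mxE; apply: eq_bigr => k _; rewrite !mxE.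
have dE i : d 0 i = (nsq (comb (row i P) f))%:C%C.
  by rewrite -inner2ff inner2_comb // rowE PG mxE eqxx mulr1n.
have d0 i : 0 < nsq (comb (row i P) f).
  rewrite lt_def nsq_ge0 andbT; apply/eqP => h0.
  have := If _ (nsq_eq0 (comb_L2 _ Lf) h0) => /(congr1 (fun r => r *m P^t*)).
  rewrite -row_mul PP mul0mx => /(congr1 (fun r : 'rV[C]_N => r 0 i)).
  by rewrite !mxE eqxx => /eqP; rewrite oner_eq0.
pose s i : C := (Num.sqrt (nsq (comb (row i P) f)))^-1%:C%C.
pose A := \matrix_(i, j) (s i * P i j); exists A => i j.
rewrite inner2_comb // rowE.
have -> : (A *m G *m A^t*) i j = s i * (P *m G *m P^t*) i j * (s j)^*.
  have AP : A = diag_mx (\row_i s i) *m P.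
    by apply/matrixP => k l; rewrite mul_diag_mx !mxE.
  have APJ : A^t* = P^t* *m diag_mx (\row_i (s i)^*).
    by apply/matrixP => k l; rewrite mul_mx_diag !mxE rmorphM mulrC.
  have -> : A *m G *m A^t* = diag_mx (\row_i s i) *m ((P *m G *m P^t*) *m diag_mx (\row_i (s i)^*)).
    by rewrite APJ AP !mulmxA.
  have r1 k : (\row_i s i) 0 k = s k by rewrite mxE.
  have r2 k : (\row_i (s i)^*) 0 k = (s k)^* by rewrite mxE.
  by rewrite mul_diag_mx mxE mul_mx_diag r1 mxE r2 mulrA.
rewrite PG mxE; have [->|ij] := eqVneq i j; last by rewrite mulr0n mulr0 mul0r.
rewrite mulr1n dE /s; have := d0 j; move: (nsq _) => x x0.
have sx : Num.sqrt x != 0 by rewrite gt_eqF // sqrtr_gt0.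
apply/eqP; rewrite eq_complex /=; apply/andP; split; apply/eqP; rewrite ?(mul0r, mulr0, subr0, addr0, oppr0) //.
by rewrite -[X in _ * X * _](sqr_sqrtr (ltW x0)); field.
Qed.

Lemma layer_nsq p q (v : R -> 'cV[C]_(p.+1 + q)) T F : layer v T -> L2 F ->
  nsq F = nsq (fun t => (v t)^t* *m F t) + nsq (fun t => T t *m F t).
Proof.
move=> [bv bT U _ _] LF.
have L1 := bdmx_L2 (bdmx_adj bv) LF; have L2' := bdmx_L2 bT LF.
have L3 := bdmx_L2 bv L1; have L4 := bdmx_L2 (bdmx_adj bT) L2'.
have e1 : inner2 (fun t => (v t)^t* *m F t) (fun t => (v t)^t* *m F t) =
    inner2 F (fun t => v t *m ((v t)^t* *m F t)).
  by rewrite inner2_adj; congr inner2; apply/funext => t; rewrite adjK.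
have e2 := inner2_adj T F (fun t => T t *m F t).
have L5 := L2D L3 L4; have [/L2P[m1 _] /L2P[m2 _]] := (LF, L5).
rewrite /nsq e1 e2 -ReD -inner2Dr // (inner2_conj L5 LF) ReJ.
congr complex.Re; apply: inner2_ae => //.
apply/ae_eqP; apply: filterS U => t [_ _ _ VV].
by rewrite !mulmxA -mulmxDl VV mul1mx.
Qed.

Lemma nsq_flip n (f : R -> 'cV[C]_n) : nsq (flip f) = nsq f.
Proof. by rewrite -!l2_sq flip_l2. Qed.

Lemma cj_adj m n (A : 'M[C]_(m, n)) : cjmx (A^t*) = A^T.
Proof. by apply/matrixP => i j; rewrite !mxE conjCK. Qed.

Lemma flip_lin_mul m n (A : R -> 'M[C]_(m, n)) G :
  (fun t => cjmx (A t) *m G t) = flip (fun t => A t *m flip G t).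
Proof. by rewrite flip_mul flipK. Qed.

(** The left factors of the factorization have thematic transposes, so they act through the
    conjugates of [w] and [S]; [flip] reduces the statement to [layer_nsq]. *)
Lemma colayer_nsq p q (w : R -> 'cV[C]_(p.+1 + q)) S G : layer w S -> L2 G ->
  nsq G = nsq (fun t => (w t)^T *m G t) + nsq (fun t => cjmx (S t) *m G t).
Proof.
move=> lw LG; rewrite -nsq_flip (layer_nsq lw (flip_L2 LG)); congr (_ + _).
  by rewrite -nsq_flip flip_mul flipK; congr nsq; apply/funext => t; rewrite cj_adj.
by rewrite -nsq_flip flip_mul flipK.
Qed.

Lemma colayer_mem p q (w : R -> 'cV[C]_(p.+1 + q)) S y : layer w S -> H2minus y ->
  H2minus_L2 (fun t => cjmx (w t) *m y t).
Proof.
move=> [_ _ _ wH _] Hy; rewrite flip_lin_mul; apply: H2_L2_flip.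
by apply: wH; exact: H2minus_flip.
Qed.

Lemma colayer_dense p q (w : R -> 'cV[C]_(p.+1 + q)) S k (eps : R) : layer w S ->
  H2minus_L2 k -> 0 < eps ->
  exists2 g, H2minus_L2 g & l2 (fun t => cjmx (S t) *m g t - k t) < eps.
Proof.
move=> [_ bS _ _ dS] Hk eps0; have [f Hf lt] := dS _ (H2minus_L2_flip Hk) _ eps0.
exists (flip f); first exact: H2_L2_flip.
apply: le_lt_trans lt; rewrite -[in leRHS]flip_l2 flipB flipK flip_mul //.
Qed.

End Combinations.

(** * Stability of the estimates under small errors *)

Section Perturbation.
Context {R : realType}.
Local Notation C := R[i].
Local Notation mu := (@arc_length R).
Local Notation normc := (@ComplexField.Normc.normc R).

Lemma l2_sum n (I : Type) (s : seq I) (F : I -> R -> 'cV[C]_n) : (forall i, L2 (F i)) ->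
  l2 (fun t => \sum_(i <- s) F i t) <= \sum_(i <- s) l2 (F i).
Proof.
move=> LF; elim: s => [|i s IH].
  by under eq_fun do rewrite big_nil; rewrite big_nil l2_0.
under eq_fun do rewrite big_cons; rewrite big_cons.
apply: le_trans (l2D _ _) _; first exact: LF.
  by apply: subspace_sum => //; exact: L2_subspace.
by rewrite lerD2l.
Qed.

Lemma l2_comb_le n N (c : 'rV[C]_N) (e : 'I_N -> R -> 'cV[C]_n) (d : R) : 0 <= d ->
  (forall i, L2 (e i)) -> (forall i, l2 (e i) <= d) ->
  l2 (comb c e) <= N%:R * d * Num.sqrt (rnsq c).
Proof.
move=> d0 Le ed; apply: le_trans (l2_sum _ _) _ => [i|]; first exact: L2Z.
apply: (@le_trans _ _ (\sum_(i < N) d * Num.sqrt (rnsq c))).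
  apply: ler_sum => i _; rewrite l2Z // mulrC; apply: ler_pM; rewrite ?l2_ge0 ?normc_ge0 //.
  rewrite -(@ler_pXn2r _ 2) ?nnegrE ?normc_ge0 ?sqrtr_ge0 // sqr_sqrtr ?rnsq_ge0 //.
  by rewrite /rnsq (bigD1 i) //= lerDl sumr_ge0 // => j _; exact: sqr_ge0.
by rewrite sumr_const card_ord -[leLHS]mulr_natl mulrA.
Qed.

(** The form changes by at most $4M\eta\|h\|^2$, because $\|l'\|\le3\|h\|$; the ratio of the squared
    norms of $h'$ and $h$ lies between $1-2\eta$ and $1+3\eta$; the squared norm of $l'$ exceeds the
    bound for that of $l$ by at most $5\eta\|h\|^2$. The constant $14+4M+3s$ lets one extra
    $\varepsilon$ absorb each of these losses, and $2\varepsilon\le s$ keeps the factor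
    $s-2\varepsilon$ nonnegative. *)
Lemma perturbed_form m n (Psi : R -> 'M[C]_(m, n)) (M s eps eta : R)
    (h h' : R -> 'cV[C]_n) (l l' : R -> 'cV[C]_m) :
  bdmx Psi -> (forall f, L2 f -> l2 (fun t => Psi t *m f t) <= M * l2 f) -> 0 < M ->
  L2 h -> L2 h' -> L2 l -> L2 l' ->
  0 < eps -> eps <= 1 -> 2 * eps <= s -> 0 < eta -> (14 + 4 * M + 3 * s) * eta <= eps ->
  l2 (fun t => h' t - h t) <= eta * l2 h -> l2 (fun t => l' t - l t) <= eta * l2 h ->
  (s - eps) * nsq h <= complex.Re (inner2 (fun t => Psi t *m h t) l) ->
  nsq l <= (1 + eps) * nsq h ->
  (s - 2 * eps) * nsq h' <= complex.Re (inner2 (fun t => Psi t *m h' t) l') /\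
  nsq l' <= (1 + 2 * eps) * nsq h'.
Proof.
move=> bP PM M0 Lh Lh' Ll Ll' e0 e1 es eta0 etae dh dl form ln.
have Ldh := L2B Lh' Lh; have Ldl := L2B Ll' Ll.
have hE : h' = fun t => h t + (h' t - h t) by apply/funext => t; rewrite addrC subrK.
have lE : l' = fun t => l t + (l' t - l t) by apply/funext => t; rewrite addrC subrK.
have b1 : l2 h' <= (1 + eta) * l2 h.
  by rewrite {1}hE; apply: le_trans (l2D _ _) _ => //; rewrite mulrDl mul1r lerD2l.
have b2 : (1 - eta) * l2 h <= l2 h'.
  have : l2 h <= l2 h' + l2 (fun t => h t - h' t).
    have {1}-> : h = fun t => h' t + (h t - h' t) by apply/funext => t; rewrite addrC subrK.
    by apply: l2D => //; exact: L2B.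
  by rewrite (l2BC Lh Lh') mulrBl mul1r; move: (l2 _) (l2 _) (l2 _) dh => x y z; lra.
have c1 : l2 l' <= l2 l + eta * l2 h.
  by rewrite {1}lE; apply: le_trans (l2D _ _) _ => //; rewrite lerD2l.
have LPh := bdmx_L2 bP Lh; have LPd := bdmx_L2 bP Ldh.
have fE : complex.Re (inner2 (fun t => Psi t *m h' t) l') =
    complex.Re (inner2 (fun t => Psi t *m h t) l) +
    complex.Re (inner2 (fun t => Psi t *m h t) (fun t => l' t - l t)) +
    complex.Re (inner2 (fun t => Psi t *m (h' t - h t)) l').
  rewrite -!ReD -inner2Dr //; congr complex.Re.
  rewrite -[in X in _ = X + _]lE -inner2Dl //; congr inner2; apply/funext => t.
  by rewrite -mulmxDr [in X in _ = _ *m X]addrC subrK.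
have d1 : - (M * l2 h * (eta * l2 h)) <=
    complex.Re (inner2 (fun t => Psi t *m h t) (fun t => l' t - l t)).
  have := Re_inner2_le LPh (L2N Ldl); rewrite inner2Nr // ReN.
  have -> : l2 (fun t => - (l' t - l t)) = l2 (fun t => l' t - l t).
    by rewrite l2BC //; congr l2; apply/funext => t; rewrite opprB.
  move=> H; rewrite lerNl; apply: le_trans H _; apply: ler_pM; rewrite ?l2_ge0 //.
  exact: PM.
have d2 : - (M * (eta * l2 h) * l2 l') <=
    complex.Re (inner2 (fun t => Psi t *m (h' t - h t)) l').
  have := Re_inner2_le LPd (L2N Ll'); rewrite inner2Nr // ReN.
  have -> : l2 (fun t => - l' t) = l2 l'.
    have := l2BC (@L2_0 R m) Ll'.
    have -> : (fun t => 0 - l' t) = (fun t => - l' t) by apply/funext => t; rewrite sub0r.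
    by have -> : (fun t => l' t - 0) = l' by apply/funext => t; rewrite subr0.
  move=> H; rewrite lerNl; apply: le_trans H _; apply: ler_pM; rewrite ?l2_ge0 //.
  by apply: le_trans (PM _ Ldh) _; rewrite ler_pM2l.
rewrite fE; move: form ln b1 b2 c1 d1 d2; rewrite -!l2_sq.
have := l2_ge0 h; have := l2_ge0 h'; have := l2_ge0 l; have := l2_ge0 l'.
move: (complex.Re _) (complex.Re _) (complex.Re _) (l2 h) (l2 h') (l2 l) (l2 l').
move=> x y z a b k k' k'0 k0 b0 a0 form ln b1 b2 c1 d1 d2 {fE hE lE dh dl LPh LPd Ldh Ldl Lh Lh' Ll Ll' PM}.
have eta1 : 14 * eta <= eps by nra.
have kb : k <= 2 * a.
  rewrite -(@ler_pXn2r _ 2) ?nnegrE ?mulr_ge0 //; apply: le_trans ln _.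
  by rewrite exprMn ler_wpM2r ?sqr_ge0 //; lra.
have k'b : k' <= 3 * a by nra.
have a2 : 0 <= a ^+ 2 by exact: sqr_ge0.
have b2u : b ^+ 2 <= (1 + 3 * eta) * a ^+ 2.
  apply: (@le_trans _ _ (((1 + eta) * a) ^+ 2)).
    by rewrite ler_pXn2r ?nnegrE // mulr_ge0 //; lra.
  by rewrite exprMn ler_wpM2r //; nra.
have b2l : (1 - 2 * eta) * a ^+ 2 <= b ^+ 2.
  apply: (@le_trans _ _ (((1 - eta) * a) ^+ 2)).
    by rewrite exprMn ler_wpM2r //; nra.
  by rewrite ler_pXn2r ?nnegrE // mulr_ge0 //; lra.
split.
- have : M * (eta * a) * k' <= M * (eta * a) * (3 * a).
    by rewrite ler_wpM2l // !mulr_ge0 // ltW.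
  have : (s - 2 * eps) * b ^+ 2 <= (s - 2 * eps) * ((1 + 3 * eta) * a ^+ 2).
    by rewrite ler_wpM2l //; lra.
  have : (s - 2 * eps) * ((1 + 3 * eta) * a ^+ 2) <= (s - eps - 4 * M * eta) * a ^+ 2.
    rewrite mulrA ler_wpM2r //; nra.
  rewrite !expr2 in form *; nra.
- have : k' ^+ 2 <= (k + eta * a) ^+ 2.
    by rewrite ler_pXn2r ?nnegrE // addr_ge0 // mulr_ge0 // ltW.
  have : (k + eta * a) ^+ 2 <= (1 + eps + 5 * eta) * a ^+ 2.
    have : k * (eta * a) <= 2 * a * (eta * a) by rewrite ler_wpM2r // mulr_ge0 // ltW.
    rewrite sqrrD exprMn mulr2n; have : eta ^+ 2 * a ^+ 2 <= eta * a ^+ 2.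
      by rewrite ler_wpM2r //; nra.
    rewrite (_ : 2 * a * (eta * a) = 2 * eta * a ^+ 2); last by ring.
    by rewrite !mulrDl; move: ln; rewrite !mulrDl; lra.
  have : (1 + eps + 5 * eta) * a ^+ 2 <= (1 + 2 * eps) * ((1 - 2 * eta) * a ^+ 2).
    by rewrite [leRHS]mulrA ler_wpM2r //; nra.
  have : (1 + 2 * eps) * ((1 - 2 * eta) * a ^+ 2) <= (1 + 2 * eps) * b ^+ 2.
    by rewrite ler_wpM2l //; lra.
  by move=> h1 h2 h3 h4; apply: le_trans h4 (le_trans h3 (le_trans h2 h1)).
Qed.

End Perturbation.

(** * Families of pairs and the splitting of the form along one layer *)

Section LayerStep.
Context {R : realType}.
Local Notation C := R[i].
Local Notation mu := (@arc_length R).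
Local Notation normc := (@ComplexField.Normc.normc R).

(** The partner of a combination is the same combination of partners, so the estimates are preserved
    by any change of basis. [K] is only a lower bound for the size of the family, because the
    dimensions lost in a layer are bounded but not known exactly. *)
Definition good (s eps : R) m1 m2 n1 n2 (Psi : R -> 'M[C]_(m1 + m2, n1 + n2)) (K : nat) : Prop :=
  exists D (f : 'I_D -> R -> 'cV[C]_(n1 + n2)) (g : 'I_D -> R -> 'cV[C]_(m1 + m2)),
  [/\ (K <= D)%N, forall i, H2_L2 (f i), forall i, H2minus_L2 (g i), orthonormal f &
    forall c, (s - eps) * nsq (comb c f) <=
                complex.Re (inner2 (fun t => Psi t *m comb c f t) (comb c g)) /\
              nsq (comb c g) <= (1 + eps) * nsq (comb c f)].

(** What is used of the Fredholm property, with the projection eliminated: two functions have the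
    same $\mathbb P_+$ exactly when they differ by an element of $H^2_-$. The [z] are independent
    solutions of $T_uz=0$, and the [e] span $H^2$ together with the range of $T_u$. *)
Definition toeplitz_data (u : R -> C) (a b : nat) : Prop :=
  (exists z : 'I_a -> R -> 'cV[C]_1, (forall l, H2 (z l)) /\
     (forall l, H2minus (fun t => u t *: z l t)) /\ indep z) /\
  (exists e : 'I_b -> R -> 'cV[C]_1, (forall s, H2 (e s)) /\
     forall f, H2 f -> exists (g : 'rV[C]_b) (x : R -> 'cV[C]_1),
       H2 x /\ H2minus (fun t => u t *: x t - (f t - comb g e t))).

Section OneLayer.
Context {p q p' q' : nat}.
Variables (v : R -> 'cV[C]_(p.+1 + q)) (T : R -> 'M[C]_(p + q, p.+1 + q)).
Variables (w : R -> 'cV[C]_(p'.+1 + q')) (S : R -> 'M[C]_(p' + q', p'.+1 + q')).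
Variables (u : R -> C) (tau : R).
Variables (Psi : R -> 'M[C]_(p'.+1 + q', p.+1 + q)) (Psi' : R -> 'M[C]_(p' + q', p + q)).
Hypotheses (lv : layer v T) (lw : layer w S).
Hypotheses (mu_ : cmeas u) (u1 : {ae mu, forall t, normc (u t) = 1}).
Hypotheses (bP : bdmx Psi) (bP' : bdmx Psi').
(** The product of $W^*$, the block diagonal matrix of $\tau u$ and $\Psi'$, and $V^*$, multiplied
    out. The pair [w], [S] belongs to $W^t$, so the blocks of $W^*$ are $\bar w$ and $S^t$. *)
Hypothesis PE : {ae mu, forall t, Psi t =
  (tau%:C%C * u t) *: (cjmx (w t) *m (v t)^t*) + (S t)^T *m Psi' t *m T t}.

Lemma unimodular_L2 n (f : R -> 'cV[C]_n) : L2 f -> L2 (fun t => u t *: f t).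
Proof.
move=> /L2_sqint sf; apply/L2_sqint => i; under eq_fun do rewrite mxE.
apply: (sqintM_aebd (M := 1)) => //.
by apply: filterS u1 => t ->.
Qed.

Lemma unimodular_nsq n (f : R -> 'cV[C]_n) : L2 f -> nsq (fun t => u t *: f t) = nsq f.
Proof.
move=> Lf; have /L2P[m1 _] := unimodular_L2 Lf; have /L2P[m2 _] := Lf.
rewrite !nsqE; apply: Rintegral_ae; [exact: measurable_enorm_sq|exact: measurable_enorm_sq|].
apply: filterS u1 => t ut; rewrite !enorm_sq; apply: eq_bigr => i _.
by rewrite mxE normc_mul ut mul1r.
Qed.

Lemma layer_form F G : L2 F -> L2 G ->
  {ae mu, forall t, (w t)^T *m G t = u t *: ((v t)^t* *m F t)} ->
  [/\ nsq F = nsq (fun t => (v t)^t* *m F t) + nsq (fun t => T t *m F t),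
      nsq G = nsq (fun t => (v t)^t* *m F t) + nsq (fun t => cjmx (S t) *m G t) &
      complex.Re (inner2 (fun t => Psi t *m F t) G) = tau * nsq (fun t => (v t)^t* *m F t) +
        complex.Re (inner2 (fun t => Psi' t *m (T t *m F t)) (fun t => cjmx (S t) *m G t))].
Proof.
move=> LF LG wG; have [bv bT _ _ _] := lv; have [bw bS _ _ _] := lw.
have La := bdmx_L2 (bdmx_adj bv) LF; have Lua := unimodular_L2 La.
have LwG := bdmx_L2 (bdmx_tr bw) LG.
have /L2P[mua _] := Lua; have /L2P[mwG _] := LwG.
have LTF := bdmx_L2 bT LF; have LPTF := bdmx_L2 bP' LTF.
split; first exact: layer_nsq.
  rewrite (colayer_nsq lw LG) -(unimodular_nsq La); congr (_ + _).
  by apply: nsq_ae => //; apply/ae_eqP.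
have LtA : L2 (fun t => cjmx (w t) *m (tau%:C%C *: (u t *: ((v t)^t* *m F t)))).
  by apply: bdmx_L2; [exact: bdmx_cj|exact: L2Z].
have LtB : L2 (fun t => (S t)^T *m (Psi' t *m (T t *m F t))).
  by apply: bdmx_L2; first exact: bdmx_tr.
have LD := L2D LtA LtB.
have [/L2P[m1 _] /L2P[m2 _]] := (bdmx_L2 bP LF, LD); have /L2P[mG _] := LG.
have -> : inner2 (fun t => Psi t *m F t) G = inner2 (fun t =>
    cjmx (w t) *m (tau%:C%C *: (u t *: ((v t)^t* *m F t))) +
    (S t)^T *m (Psi' t *m (T t *m F t))) G.
  apply: inner2_ae => //; apply/ae_eqP; apply: filterS PE => t ->.
  by rewrite mulmxDl -!scalemxAr -!scalemxAl scalerA !mulmxA.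
rewrite inner2Dl // ReD; congr (_ + complex.Re _); last first.
  rewrite inner2_adj; congr inner2; apply/funext => t; congr (_ *m _).
  by apply/matrixP => i j; rewrite !mxE.
rewrite inner2_adj.
have -> : (fun t => (cjmx (w t))^t* *m G t) = (fun t => (w t)^T *m G t).
  by apply/funext => t; congr (_ *m _); apply/matrixP => i j; rewrite !mxE conjCK.
rewrite inner2Zl // -(unimodular_nsq La).
have -> : inner2 (fun t => u t *: ((v t)^t* *m F t)) (fun t => (w t)^T *m G t) =
    inner2 (fun t => u t *: ((v t)^t* *m F t)) (fun t => u t *: ((v t)^t* *m F t)).
  rewrite (inner2_conj LwG Lua) [RHS](inner2_conj Lua Lua); congr (_^*).
  by apply: inner2_ae => //; apply/ae_eqP.
by rewrite inner2ff -rmorphM /=.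
Qed.

End OneLayer.

Lemma combB n N (c : 'rV[C]_N) (f g : 'I_N -> R -> 'cV[C]_n) t :
  comb c (fun i t => f i t - g i t) t = comb c f t - comb c g t.
Proof. by rewrite /comb -sumrB; apply: eq_bigr => i _; rewrite scalerBr. Qed.

Lemma combD n N (c : 'rV[C]_N) (f g : 'I_N -> R -> 'cV[C]_n) t :
  comb c (fun i t => f i t + g i t) t = comb c f t + comb c g t.
Proof. by rewrite /comb -big_split; apply: eq_bigr => i _; rewrite scalerDr. Qed.

Lemma combZ n N (c : 'rV[C]_N) (f : 'I_N -> R -> 'cV[C]_n) (k : R -> C) t :
  comb c (fun i t => k t *: f i t) t = k t *: comb c f t.
Proof. by rewrite /comb scaler_sumr; apply: eq_bigr => i _; rewrite !scalerA mulrC. Qed.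

Definition join n N M (f : 'I_N -> R -> 'cV[C]_n) (g : 'I_M -> R -> 'cV[C]_n)
  (k : 'I_(N + M)) := match fintype.split k with inl i => f i | inr j => g j end.

Lemma join_ind n N M (P : (R -> 'cV[C]_n) -> Prop) (f : 'I_N -> R -> 'cV[C]_n)
    (g : 'I_M -> R -> 'cV[C]_n) : (forall i, P (f i)) -> (forall j, P (g j)) ->
  forall k, P (join f g k).
Proof. by move=> Pf Pg k; rewrite /join; case: fintype.split. Qed.

Lemma comb_join n N M (c : 'rV[C]_(N + M)) (f : 'I_N -> R -> 'cV[C]_n)
    (g : 'I_M -> R -> 'cV[C]_n) t :
  comb c (join f g) t = comb (lsubmx c) f t + comb (rsubmx c) g t.
Proof.
rewrite /comb big_split_ord /=; congr (_ + _); apply: eq_bigr => i _; rewrite mxE /join.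
  by rewrite -[lshift M i]/(unsplit (inl i)) unsplitK.
by rewrite -[rshift N i]/(unsplit (inr i)) unsplitK.
Qed.

End LayerStep.

(** * Passage of a family through one layer *)

Section InductionStep.
Context {R : realType}.
Local Notation C := R[i].
Local Notation mu := (@arc_length R).
Local Notation normc := (@ComplexField.Normc.normc R).

Lemma l2_ae n (f g : R -> 'cV[C]_n) : L2 f -> L2 g -> {ae mu, forall t, f t = g t} -> l2 f = l2 g.
Proof. by move=> /L2P[mf _] /L2P[mg _] fg; congr Num.sqrt; apply: nsq_ae => //; exact/ae_eqP. Qed.

Lemma dim_count K D g a b : (K <= D)%N -> (g <= b)%N -> (K + a - b <= D - g + a)%N.
Proof. by lia. Qed.

(* Lift the given families through the two layers approximately; the scalar
   components of the lifts are then matched exactly (w^T G = u v^* F) by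
   corrections v x and conj(w) y, which costs at most b = dim coker T_u dimensions
   and gains the a = dim ker T_u vectors v z. *)
Lemma layer_step p q p' q' (v : R -> 'cV[C]_(p.+1 + q)) T (w : R -> 'cV[C]_(p'.+1 + q')) S
    (u : R -> C) (tau s eps : R) (Psi : R -> 'M[C]_(p'.+1 + q', p.+1 + q))
    (Psi' : R -> 'M[C]_(p' + q', p + q)) a b K :
  layer v T -> layer w S -> cmeas u -> {ae mu, forall t, normc (u t) = 1} ->
  bdmx Psi -> bdmx Psi' ->
  {ae mu, forall t, Psi t =
    (tau%:C%C * u t) *: (cjmx (w t) *m (v t)^t*) + (S t)^T *m Psi' t *m T t} ->
  toeplitz_data u a b -> s <= tau -> 0 < eps -> eps <= 1 -> 2 * eps <= s ->
  good s eps Psi' K -> good s (2 * eps) Psi (K + a - b).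
Proof.
move=> lv lw mu_ u1 bP bP' PE [[z [Hz [Huz Iz]]] [e [He cok]]] st eps0 eps1 es.
move=> [D [h [l [KD Hh Hl oh est]]]].
have [bv bT Uv vH dT] := lv; have [bw bS Uw wH dS] := lw.
have [M M0 PM] := bdmx_l2 bP'.
pose eta := eps / (14 + 4 * M + 3 * s).
have den0 : 0 < 14 + 4 * M + 3 * s by lra.
have eta0 : 0 < eta by rewrite divr_gt0.
have etae : (14 + 4 * M + 3 * s) * eta <= eps by rewrite /eta mulrC divfK // gt_eqF.
have eta1 : eta < 1.
  rewrite /eta ltr_pdivrMr // mul1r; lra.
(* [l2_comb_le] loses a factor [D]; the successor covers the empty family. *)
pose dl := eta / D.+1%:R.
have dl0 : 0 < dl by rewrite divr_gt0 // ltr0Sn.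
have Ddl : D%:R * dl <= eta.
  by rewrite /dl mulrCA ler_piMr ?(ltW eta0) // ler_pdivrMr ?ltr0Sn // mul1r ler_nat.
pose f0 i := s2val (cid2 (dT _ (Hh i) _ dl0)).
have Hf0 i : H2_L2 (f0 i) by rewrite /f0; case: cid2.
have f0h i : l2 (fun t => T t *m f0 i t - h i t) < dl by rewrite /f0; case: cid2.
pose g0 i := s2val (cid2 (colayer_dense lw (Hl i) dl0)).
have Hg0 i : H2minus_L2 (g0 i) by rewrite /g0; case: cid2.
have g0l i : l2 (fun t => cjmx (S t) *m g0 i t - l i t) < dl by rewrite /g0; case: cid2.
have Lf0 i : L2 (f0 i) by case: (Hf0 i).
have Lg0 i : L2 (g0 i) by case: (Hg0 i).
have Lh i : L2 (h i) by case: (Hh i).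
have Ll i : L2 (l i) by case: (Hl i).
(* The defect in the matching condition $w^tG=u\,v^*F$. Adding $vx$ to $F$ and $\bar wy$ to $G$
   removes it exactly when $y=ux-\rho$; since $y$ must lie in $H^2_-$, this asks for $T_ux=\mathbb
   P_+\rho$. *)
pose rho i t := (w t)^T *m g0 i t - u t *: ((v t)^t* *m f0 i t).
have Lrho i : L2 (rho i).
  apply: L2B; first by apply: bdmx_L2 => //; exact: bdmx_tr.
  by apply: unimodular_L2 => //; apply: bdmx_L2 => //; exact: bdmx_adj.
pose pr i := orth_proj (@H2 R 1) (rho i).
have Hpr i : H2 (pr i) by have [] := orth_H2_H2minus (Lrho i).
have Hrp i : H2minus (fun t => rho i t - pr i t) by have [] := orth_H2_H2minus (Lrho i).
pose ga i := sval (cid (cok _ (Hpr i))).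
have cok' i : exists x, H2 x /\ H2minus (fun t => u t *: x t - (pr i t - comb (ga i) e t)).
  by rewrite /ga; case: cid.
pose x i := sval (cid (cok' i)).
have Hx i : H2 (x i) by rewrite /x; case: cid => ? [].
have Hux i : H2minus (fun t => u t *: x i t - (pr i t - comb (ga i) e t)).
  by rewrite /x; case: cid => ? [].
(* Row [i] records the component of $\mathbb P_+\rho_i$ outside the range of $T_u$; the Toeplitz
   equation is solved for the combinations in the left kernel. *)
pose Ga : 'M[C]_(D, b) := \matrix_(i, j) ga i 0 j.
pose phi := join (fun i t => f0 i t + v t *m x i t) (fun j t => v t *m z j t).
pose gam := join (fun i t => g0 i t + cjmx (w t) *m (u t *: x i t - rho i t))
                 (fun j t => cjmx (w t) *m (u t *: z j t)).
have Hphi k : H2_L2 (phi k).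
  apply: join_ind => i; last exact: vH.
  by apply: (subspaceD _ (Hf0 i) (vH _ (Hx i))); exact: H2_L2_subspace.
have Lx i : L2 (x i) by case: (Hx i).
have Lz i : L2 (z i) by case: (Hz i).
have Lphi k : L2 (phi k) by case: (Hphi k).
(* The total correction on the side of $F$: particular solutions for the lifted part, kernel vectors
   for the new part. [y] is the corresponding correction on the side of $G$. *)
pose X (c : 'rV[C]_(D + a)) t := comb (lsubmx c) x t + comb (rsubmx c) z t.
pose y (c : 'rV[C]_(D + a)) t := u t *: X c t - comb (lsubmx c) rho t.
have HX c : H2 (X c).
  apply: subspaceD; first exact: H2_subspace.
    by apply: comb_sub => //; exact: H2_subspace.
  by apply: comb_sub => //; exact: H2_subspace.
have phiE c t : comb c phi t = comb (lsubmx c) f0 t + v t *m X c t.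
  by rewrite comb_join combD -!comb_mx -addrA -mulmxDr.
have gamE c t : comb c gam t = comb (lsubmx c) g0 t + cjmx (w t) *m y c t.
  rewrite comb_join combD -(comb_mx _ (fun i t => u t *: x i t - rho i t)) -(comb_mx _ (fun i t => u t *: z i t)).
  by rewrite -addrA -mulmxDr (combB _ (fun i t => u t *: x i t) rho) !combZ /y /X scalerDr addrAC.
(* Once the cokernel terms cancel, [y c] is built from the functions $ux-\mathbb P_+\rho$ corrected
   by them, $\rho-\mathbb P_+\rho$ and $uz$, all in $H^2_-$. *)
have Hy c : lsubmx c *m Ga = 0 -> H2minus (y c).
  move=> c0; have sub := H2minus_subspace 1.
  have e0 t : comb (lsubmx c) (fun i t => comb (ga i) e t) t = 0.
    have -> : comb (lsubmx c) (fun i t => comb (ga i) e t) t = comb (lsubmx c *m Ga) e t.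
      rewrite -comb_mulmx /comb; apply: eq_bigr => i _; congr (_ *: _); apply: eq_bigr => j _.
      by rewrite !mxE.
    by rewrite c0 /comb big1 // => j _; rewrite mxE scale0r.
  have yE : y c = fun t => comb (lsubmx c) (fun i t => u t *: x i t - (pr i t - comb (ga i) e t)) t
     - comb (lsubmx c) (fun i t => rho i t - pr i t) t + comb (rsubmx c) (fun j t => u t *: z j t) t.
    apply/funext => t; rewrite (combB _ (fun i t => u t *: x i t)) (combB _ pr) (combB _ rho pr) e0 subr0 !combZ /y /X scalerDr.
    by rewrite opprB addrA subrK addrAC.
  rewrite yE; apply: subspaceD => //; last exact: comb_sub.
  by apply: subspaceB => //; exact: comb_sub.
have Hgam c : lsubmx c *m Ga = 0 -> H2minus_L2 (comb c gam).
  move=> c0; rewrite (_ : comb c gam = fun t => comb (lsubmx c) g0 t + cjmx (w t) *m y c t); last exact/funext.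
  apply: subspaceD; first exact: H2minus_L2_subspace.
    by apply: comb_sub => //; exact: H2minus_L2_subspace.
  by apply: (colayer_mem lw); exact: Hy.
have near_h c : l2 (fun t => T t *m comb c phi t - comb (lsubmx c) h t) <= eta * l2 (comb (lsubmx c) h).
  have LTf i : L2 (fun t => T t *m f0 i t) by exact: bdmx_L2.
  have Lph := comb_L2 c Lphi.
  have Lh' := comb_L2 (lsubmx c) Lh.
  rewrite (@l2_ae _ _ (comb (lsubmx c) (fun i t => T t *m f0 i t - h i t))).
  - rewrite {2}/l2 nsq_orthonormal //.
    apply: le_trans (l2_comb_le _ (ltW dl0) _ _) _ => [i|i|].
    + exact: L2B.
    + exact: ltW.
    + by rewrite ler_wpM2r ?sqrtr_ge0.
  - by apply: L2B => //; exact: bdmx_L2.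
  - by apply: comb_L2 => i; exact: L2B.
  - apply: filterS Uv => t [_ Tv _ _].
    by rewrite phiE mulmxDr mulmxA Tv mul0mx addr0 combB comb_mx.
have near_l c : lsubmx c *m Ga = 0 ->
    l2 (fun t => cjmx (S t) *m comb c gam t - comb (lsubmx c) l t) <= eta * l2 (comb (lsubmx c) h).
  move=> c0.
  have LSg i : L2 (fun t => cjmx (S t) *m g0 i t) by apply: bdmx_L2 => //; exact: bdmx_cj.
  have Lga : L2 (comb c gam) by case: (Hgam _ c0).
  have Ll' := comb_L2 (lsubmx c) Ll.
  rewrite (@l2_ae _ _ (comb (lsubmx c) (fun i t => cjmx (S t) *m g0 i t - l i t))).
  - rewrite {2}/l2 nsq_orthonormal //.
    apply: le_trans (l2_comb_le _ (ltW dl0) _ _) _ => [i|i|].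
    + exact: L2B.
    + exact: ltW.
    + by rewrite ler_wpM2r ?sqrtr_ge0.
  - by apply: L2B => //; apply: bdmx_L2 => //; exact: bdmx_cj.
  - by apply: comb_L2 => i; exact: L2B.
  - apply: filterS Uw => t [_ Sw _ _].
    have Sw' : cjmx (S t) *m cjmx (w t) = 0 by rewrite -map_mxM Sw map_mx0.
    by rewrite gamE mulmxDr mulmxA Sw' mul0mx addr0 combB (comb_mx _ _ (fun t => cjmx (S t))).
have match_uv c : lsubmx c *m Ga = 0 -> {ae mu, forall t,
    (w t)^T *m comb c gam t = u t *: ((v t)^t* *m comb c phi t)}.
  move=> c0; apply: filterS2 Uv Uw => t [vv _ _ _] [ww _ _ _].
  have ww' : (w t)^T *m cjmx (w t) = 1%:M.
    by rewrite -cj_adj /cjmx -map_mxM ww map_mx1.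
  rewrite gamE phiE !mulmxDr !mulmxA ww' vv !mul1mx.
  rewrite (comb_mx _ _ (fun t => (w t)^T)) (comb_mx _ _ (fun t => (v t)^t*)) /y.
  rewrite /rho (combB _ (fun i t => (w t)^T *m g0 i t)) !combZ !scalerDr.
  by rewrite opprB addrCA [X in _ + X = _]addrC subrK addrC.
have estF c : lsubmx c *m Ga = 0 ->
    (s - 2 * eps) * nsq (comb c phi) <=
       complex.Re (inner2 (fun t => Psi t *m comb c phi t) (comb c gam)) /\
    nsq (comb c gam) <= (1 + 2 * eps) * nsq (comb c phi).
  move=> c0; have LF := comb_L2 c Lphi; have LG : L2 (comb c gam) by case: (Hgam _ c0).
  have [-> -> ->] := layer_form lv lw mu_ u1 bP bP' PE LF LG (match_uv _ c0).
  have [e1 e2] := est (lsubmx c).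
  have LT := bdmx_L2 bT LF; have LS := bdmx_L2 (bdmx_cj bS) LG.
  have [] := perturbed_form bP' PM M0 (comb_L2 _ Lh) LT (comb_L2 _ Ll) LS eps0 eps1 es eta0 etae
    (near_h c) (near_l _ c0) e1 e2.
  have := nsq_ge0 (fun t => (v t)^t* *m comb c phi t).
  move: (nsq _) (nsq _) (nsq _) (complex.Re _) => E B A F A0 h1 h2; split.
    have : (s - 2 * eps) * A <= tau * A by rewrite ler_wpM2r // (le_trans _ st) // gerBl mulr_ge0 // ltW.
    by rewrite mulrDr; move: h1; lra.
  have : 0 <= 2 * eps * A by rewrite !mulr_ge0 // ltW.
  by rewrite mulrDr mulrDl mul1r; move: h2; lra.
(* [B] parametrizes the admissible coefficients: the left kernel of [Ga] on the lifted part,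
   everything on the kernel part. As [Ga] has rank at most [b], at least $K-b+a$ dimensions
   remain. *)
pose r := \rank (kermx Ga).
pose Kb := row_base (kermx Ga).
have KG : Kb *m Ga = 0 by apply/sub_kermxP; rewrite eq_row_base.
pose B : 'M[C]_(r + a, D + a) := block_mx Kb 0 0 1%:M.
have BG c : lsubmx (c *m B) *m Ga = 0.
  rewrite -[c](hsubmxK) /B mul_row_block !mulmx0 addr0 row_mxKl.
  by rewrite -mulmxA KG mulmx0.
(* If a combination vanishes, so does its tail; the corresponding combination of [h] then has norm
   at most [eta] times itself, hence is zero because [eta < 1]. What is left is $v$ times a
   combination of [z], which is removed by $v^*$ and the independence of [z]. *)
have ind : indep (fun k => comb (row k B) phi).
  move=> c; rewrite comb_mulmx => F0.
  set c' := c *m B in F0; have c0 : lsubmx c' *m Ga = 0 by exact: BG.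
  have Lh' := comb_L2 (lsubmx c') Lh.
  have lc : lsubmx c' = 0.
    apply: rnsq_eq0; rewrite -(@nsq_orthonormal _ _ _ _ _ Lh oh) -l2_sq.
    have := near_h c'; rewrite (@l2_ae _ _ (fun t => 0 - comb (lsubmx c') h t)).
    - rewrite -(l2BC Lh' (L2_0 (n := _))).
      have -> : (fun t => comb (lsubmx c') h t - 0) = comb (lsubmx c') h by apply/funext => t; rewrite subr0.
      have := l2_ge0 (comb (lsubmx c') h); move: (l2 _) => k k0 hk.
      have k1 : (1 - eta) * k <= 0 by rewrite mulrBl mul1r subr_le0.
      have kz : k <= 0 by rewrite -(pmulr_rle0 _ (_ : 0 < 1 - eta)) // subr_gt0.
      have -> : k = 0 by apply/eqP; rewrite eq_le kz k0.
      by rewrite expr0n.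
    - by apply: L2B => //; apply: bdmx_L2 => //; exact: comb_L2.
    - by apply: L2B => //; exact: L2_0.
    - by move/ae_eqP: F0; apply: filterS => t ->; rewrite mulmx0.
  have rc : rsubmx c' = 0.
    apply: Iz; move/ae_eqP: F0 => F0; apply/ae_eqP; apply: filterS2 F0 Uv => t.
    rewrite phiE /X lc => F0 [vv _ _ _].
    have z0 n' (k : 'I_D -> R -> 'cV[C]_n') : comb 0 k t = 0.
      by rewrite /comb big1 // => i _; rewrite mxE scale0r.
    move: F0; rewrite !z0 !add0r => /(congr1 (fun A => (v t)^t* *m A)).
    by rewrite mulmxA vv mul1mx mulmx0.
  have cB : c *m B = 0 by rewrite -/c' -[c']hsubmxK lc rc row_mx0.
  move: cB; rewrite -[c]hsubmxK /B mul_row_block !mulmx0 addr0 add0r mulmx1 -[RHS]row_mx0.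
  move=> /eq_row_mx[lK ->]; rewrite (_ : lsubmx c = 0) ?row_mx0 //.
  by apply: (row_free_inj (row_base_free (kermx Ga))); rewrite lK mul0mx.
have Lrow k : L2 (comb (row k B) phi) by exact: comb_L2.
have [A oA] := gram_schmidt Lrow ind.
have combE n' (c : 'rV[C]_(r + a)) (k : 'I_(D + a) -> R -> 'cV[C]_n') :
    comb c (fun i => comb (row i A) (fun i => comb (row i B) k)) = comb (c *m A *m B) k.
  by rewrite !comb_mulmx.
exists (r + a)%N, (fun i => comb (row i A) (fun i => comb (row i B) phi)),
  (fun i => comb (row i A) (fun i => comb (row i B) gam)); split => //.
- have Gr : (\rank Ga <= b)%N by exact: rank_leq_col.
  by rewrite /r mxrank_ker; exact: dim_count.
- move=> i; rewrite comb_mulmx; apply: comb_sub => //; exact: H2_L2_subspace.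
- by move=> i; rewrite comb_mulmx; exact: Hgam.
- by move=> c; rewrite !combE; exact: estF.
Qed.

End InductionStep.

(** * From a thematic factor and a Fredholm symbol to one induction step *)

Section FredholmData.
Context {R : realType}.
Local Notation C := R[i].
Local Notation mu := (@arc_length R).
Local Notation normc := (@ComplexField.Normc.normc R).

Lemma H2minus_ae n (f g : R -> 'cV[C]_n) : H2minus g -> L2 f -> f =ae g -> H2minus f.
Proof.
move=> [Lg og] Lf fg; split=> // h Hh; rewrite -(og h Hh).
have [/L2P[mf _] /L2P[mg _]] := (Lf, Lg); have /L2P[mh _] := H2_L2W Hh.
exact: inner2_ae.
Qed.

Lemma unimodular_normc (u : R -> C) : unimodular_fun u ->
  cmeas u /\ {ae mu, forall t, normc (u t) = 1}.
Proof.
move=> [mu_ u1]; split.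
  have := mxmeas_entry 0 0 mu_; congr cmeas; apply/funext => t.
  by rewrite mxE eqxx mulr1n.
by apply: filterS u1 => t; rewrite normcE => -[].
Qed.

Lemma toeplitz_data_of_fredholm (u : R -> C) (k : nat) : unimodular_fun u ->
  fredholm_of_index (@H2 R 1) (@H2 R 1) (toeplitz u) k%:Z ->
  exists a b, a = (k + b)%N /\ toeplitz_data u a b.
Proof.
move=> /unimodular_normc[mu_ u1] [_ _ [a [b [[z [Hz zu]] [e [He ec]] kab]]]].
have Lu n (f : R -> 'cV[C]_n) : L2 f -> L2 (fun t => u t *: f t) by exact: unimodular_L2.
have [_ H20 _] := H2_subspace (R := R) 1.
exists a, b; split.
  by apply/eqP; rewrite -eqz_nat PoszD kab subrK.
have proj x : H2 x -> H2 (toeplitz u x) /\ H2minus (fun t => u t *: x t - toeplitz u x t).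
  by move=> Hx; apply: orth_H2_H2minus; apply: Lu; exact: H2_L2W.
(* [orth_proj] is defined by a choice, so even the image of 0 has to be computed, up to a null
   set. *)
have t0 : toeplitz u (fun=> 0) =ae (fun=> 0).
  have [Ht [Lm om]] := proj _ H20; have := om _ Ht.
  rewrite inner2Bl; [|by apply: Lu; exact: L2_0|exact: H2_L2W|exact: H2_L2W].
  rewrite (_ : (fun t => u t *: 0) = fun=> 0); last by apply/funext => t; rewrite scaler0.
  rewrite inner20l sub0r inner2ff => /eqP; rewrite oppr_eq0 => /eqP[h0].
  by apply: nsq_eq0 => //; exact: H2_L2W.
split; [exists z; split; [|split]|exists e; split=> //].
- by move=> l; have [] := Hz l.
- move=> l; have [Hl /ae_eqP tl] := Hz l; have [_ Hm] := proj _ Hl.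
  apply: H2minus_ae Hm _ _; first exact/Lu/H2_L2W.
  by apply/ae_eqP; apply: filterS tl => t ->; rewrite subr0.
(* Uniqueness of the coordinates of the zero function is linear independence. *)
- move=> c /ae_eqP c0; have [c' [_ uc]] := zu (fun=> 0) (conj H20 t0).
  rewrite -(uc c) ?(uc 0) //=; apply/ae_eqP.
    by apply: aeW => t; rewrite big1 ?subr0 // => i _; rewrite mxE scale0r.
  by apply: filterS c0 => t; rewrite /comb => ->; rewrite subr0.
- move=> f Hf; have [c [[Hr [x Hx tx]] _]] := ec _ Hf.
  exists c, x; split=> //; have [_ Hm] := proj _ Hx.
  apply: H2minus_ae Hm _ _; first by apply: L2B; [exact/Lu/H2_L2W|exact: H2_L2W].
  by move/ae_eqP: tx => tx; apply/ae_eqP; apply: filterS tx => t ->.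
Qed.

Lemma thematic_bdmx p q (V : R -> 'M[C]_(p + q)) : thematic V -> bdmx V.
Proof. by case=> _ mV uV _; exact: unitary_bdmx. Qed.

Lemma bdmx_scalar1 (u : R -> C) (tau : R) : cmeas u -> {ae mu, forall t, normc (u t) = 1} ->
  bdmx (fun t => (tau%:C%C * u t)%:M : 'M[C]_1).
Proof.
move=> mu_ u1; split.
  apply: mxmeasI => i j; rewrite !ord1; under eq_fun do rewrite mxE eqxx mulr1n.
  by apply: cmeasM => //; exact: cmeas_cst.
exists (normc tau%:C%C); apply: filterS u1 => t ut i j.
by rewrite !ord1 mxE eqxx mulr1n normc_mul ut mulr1.
Qed.

(** [P] and [P'] stand for differences such as [n1 - j], which equal the successors of the next
    sizes only propositionally; hence the size equations. The index gives [a = k + b], so that the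
    count [K + a - b] of [layer_step] becomes [K + k]. *)
Lemma one_step P P' p q p' q' (V : R -> 'M[C]_(P + q)) (W : R -> 'M[C]_(P' + q'))
    (u : R -> C) (tau s eps : R) (Psi' : R -> 'M[C]_(p' + q', p + q)) k K :
  P = p.+1 -> P' = p'.+1 -> thematic V -> thematic (fun z => (W z)^T) ->
  unimodular_fun u -> fredholm_of_index (@H2 R 1) (@H2 R 1) (toeplitz u) k%:Z ->
  bdmx Psi' -> s <= tau -> 0 < eps -> eps <= 1 -> 2 * eps <= s ->
  good s eps Psi' K ->
  good s (2 * eps) (fun z => (W z)^t* *m conform_mx 0
    (block_mx ((tau%:C%C * u z)%:M : 'M[C]_1) 0 0 (Psi' z)) *m (V z)^t*) (K + k).
Proof.
move=> eP eP'; subst P P' => tV tW uu fu bP' st e0 e1 es gd.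
have [mu_ u1] := unimodular_normc uu.
have [a [b [ab td]]] := toeplitz_data_of_fredholm uu fu.
have [v [T [lv VE]]] := thematic_layer tV.
have [w [S [lw WE]]] := thematic_layer tW.
have bW : bdmx W by have := bdmx_tr (thematic_bdmx tW); under eq_fun do rewrite trmxK.
have -> : (K + k)%N = (K + a - b)%N by rewrite ab; lia.
apply: (layer_step lv lw mu_ u1 _ bP' _ td st e0 e1 es gd).
  apply: bdmxM; last exact/bdmx_adj/thematic_bdmx.
  apply: bdmxM; first exact: bdmx_adj.
  apply: bdmx_conform; apply: bdmx_block => //; try exact: bdmx0.
  exact: (bdmx_scalar1 _ mu_ u1).
apply: filterS2 VE WE => t VE WE.
have WE' : (W t)^t* = (row_mx (cjmx (w t)) (S t)^T : 'M[C]_(p'.+1 + q', 1 + (p' + q'))).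
  have h := congr1 (fun A : 'M[C]_(1 + (p' + q'), p'.+1 + q') => A^T) WE.
  apply: etrans (etrans h _); first by apply/matrixP => i j; rewrite !mxE.
  by rewrite tr_col_mx; congr row_mx; apply/matrixP => i j; rewrite !mxE.
transitivity ((row_mx (cjmx (w t)) (S t)^T : 'M[C]_(p'.+1 + q', 1 + (p' + q'))) *m
    (block_mx ((tau%:C%C * u t)%:M : 'M[C]_1) 0 0 (Psi' t) : 'M[C]_(1 + (p' + q'), 1 + (p + q))) *m
    (col_mx ((v t)^t*) (T t) : 'M[C]_(1 + (p + q), p.+1 + q))).
  by rewrite conform_mx_id VE WE'.
rewrite mul_row_block !mulmx0 addr0 add0r mul_row_col.
by rewrite mul_mx_scalar -scalemxAl.
Qed.

End FredholmData.

(** * Peeling the thematic factorization *)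

Section Chain.
Context {R : realType}.
Local Notation C := R[i].
Local Notation mu := (@arc_length R).
Local Notation normc := (@ComplexField.Normc.normc R).

Lemma diag_recr (d : nat -> C) j :
  diag_mx (\row_(i < j.+1) d i) = castmx (addn1 j, addn1 j)
    (block_mx (diag_mx (\row_(i < j) d i)) 0 0 ((d j)%:M : 'M[C]_1)).
Proof.
apply/matrixP => i k; rewrite castmxE /=.
have [iE kE] := (cast_ordKV (addn1 j) i, cast_ordKV (addn1 j) k).
rewrite -[in LHS]iE -[in LHS]kE.
move: (cast_ord _ i) (cast_ord _ k) => {iE kE i k} i k.
case: (split_ordP i) => i' ->; case: (split_ordP k) => k' ->.
- by rewrite block_mxEul !mxE -!val_eqE.
- rewrite block_mxEur !mxE -val_eqE /= ord1 addn0.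
  by rewrite (ltn_eqF (ltn_ord i')).
- rewrite block_mxEdl !mxE -val_eqE /= ord1 addn0.
  by rewrite (gtn_eqF (ltn_ord k')).
- by rewrite block_mxEdr !mxE -val_eqE /= !ord1 addn0 !eqxx.
Qed.

Lemma conform_block_cast a a' m n (e : a = a') M N (X : 'M[C]_a) (B : 'M[C]_(m, n)) :
  conform_mx (0 : 'M[C]_(M, N)) (block_mx (castmx (e, e) X) 0 0 B) = conform_mx 0 (block_mx X 0 0 B).
Proof. by subst a'; rewrite castmx_id. Qed.

Lemma conform_block_conform a m n m' n' M N (X : 'M[C]_a) (B : 'M[C]_(m, n)) :
  m = m' -> n = n' ->
  conform_mx (0 : 'M[C]_(M, N)) (block_mx X 0 0 (conform_mx (0 : 'M[C]_(m', n')) B)) =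
  conform_mx 0 (block_mx X 0 0 B).
Proof. by move=> em en; subst m' n'; rewrite conform_mx_id. Qed.

Lemma conform_block_assoc a b m n M N (X : 'M[C]_a) (Y : 'M[C]_b) (B : 'M[C]_(m, n)) :
  conform_mx (0 : 'M[C]_(M, N)) (block_mx (block_mx X 0 0 Y) 0 0 B) =
  conform_mx 0 (block_mx X 0 0 (block_mx Y 0 0 B)).
Proof.
have := @block_mxA _ a b m a b n X 0 0 0 Y 0 0 0 B.
by rewrite /= !row_mx0 !col_mx0 => ->; rewrite conform_castmx.
Qed.

Lemma adj_block m1 m2 n1 n2 (A : 'M[C]_(m1, n1)) (B : 'M[C]_(m2, n2)) :
  (block_mx A 0 0 B)^t* = block_mx (A^t*) 0 0 (B^t*).
Proof. by rewrite tr_block_mx map_block_mx !trmx0 !map_mx0. Qed.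

(** The factors with index [j] are the identity on the first [j] coordinates, so they act only on
    the corner formed by [d j] and [B]; absorbing them moves [d j] from the diagonal into the
    remaining block. *)
Lemma id_block_step M N j P Q p q (W : 'M[C]_P) (V : 'M[C]_Q) (d : nat -> C)
    (B : 'M[C]_(p, q)) :
  M = (j + P)%N -> N = (j + Q)%N -> P = (1 + p)%N -> Q = (1 + q)%N ->
  (conform_mx (0 : 'M[C]_M) (block_mx (1%:M : 'M[C]_j) 0 0 W))^t* *m
  conform_mx (0 : 'M[C]_(M, N)) (block_mx (diag_mx (\row_(i < j.+1) d i)) 0 0 B) *m
  (conform_mx (0 : 'M[C]_N) (block_mx (1%:M : 'M[C]_j) 0 0 V))^t* =
  conform_mx (0 : 'M[C]_(M, N)) (block_mx (diag_mx (\row_(i < j) d i)) 0 0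
    (W^t* *m conform_mx (0 : 'M[C]_(P, Q)) (block_mx ((d j)%:M : 'M[C]_1) 0 0 B) *m V^t*)).
Proof.
move=> eM eN eP eQ; subst M N P Q.
rewrite diag_recr conform_block_cast conform_block_assoc !conform_mx_id !adj_block !mulmx_block.
have -> : (1%:M : 'M[C]_j)^t* = 1%:M by rewrite trmx1 map_mx1.
by rewrite !(mulmx0, mul0mx, addr0, add0r) mul1mx mulmx1.
Qed.

Section Remainder.
Variables (m1 m2 n1 n2 d : nat).
Variables (V : forall j, R -> 'M[C]_(n1 - j + n2)) (W : forall j, R -> 'M[C]_(m1 - j + m2)).
Variables (c : nat -> R -> C) (E : R -> 'M[C]_(m1 + m2 - d, n1 + n2 - d)).

(* What is left of the factorized function after removing the outer j layers,
   when i layers remain. *)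
Fixpoint remainder (i j : nat) : R -> 'M[C]_(m1 - j + m2, n1 - j + n2) :=
  if i is i'.+1 then fun z => (W j z)^t* *m
    conform_mx 0 (block_mx ((c j z)%:M : 'M[C]_1) 0 0 (remainder i' j.+1 z)) *m (V j z)^t*
  else fun z => conform_mx 0 (E z).

Lemma remainderP i j z : (i + j = d)%N -> (d <= m1)%N -> (d <= n1)%N ->
  (\prod_(k < d) (id_block k (m1 + m2) (W k) z)^t*)
    *m conform_mx (0 : 'M[C]_(m1 + m2, n1 + n2))
         (block_mx (diag_mx (\row_(k < d) c k z)) 0 0 (E z))
    *m (\prod_(k < d) (id_block (rev_ord k) (n1 + n2) (V (rev_ord k)) z)^t*) =
  (\prod_(k < j) (id_block k (m1 + m2) (W k) z)^t*)
    *m conform_mx (0 : 'M[C]_(m1 + m2, n1 + n2))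
         (block_mx (diag_mx (\row_(k < j) c k z)) 0 0 (remainder i j z))
    *m (\prod_(k < j) (id_block (rev_ord k) (n1 + n2) (V (rev_ord k)) z)^t*).
Proof.
pose a k := (id_block k (m1 + m2) (W k) z)^t*.
pose b k := (id_block k (n1 + n2) (V k) z)^t*.
(* In the reversed product the largest index comes first, so the factor to be absorbed stands next
   to the middle matrix, as it does in the product on the left. *)
have bS l : \prod_(k < l.+1) b (rev_ord k) = b l *m \prod_(k < l) b (rev_ord k).
  by rewrite big_ord_recl -[LHS]/(_ *m _); congr (_ *m _); congr b; rewrite /= subn1.
rewrite -/(a _) -/(b _) => ij dm dn; elim: i j ij => [|i IH] j ij.
  by rewrite add0n in ij; subst j; rewrite /= conform_block_conform //; lia.
rewrite (IH j.+1); last by rewrite addnS.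
have [jm jn] : (j < m1)%N /\ (j < n1)%N by lia.
transitivity (\prod_(k < j.+1) a k *m conform_mx (0 : 'M[C]_(m1 + m2, n1 + n2))
         (block_mx (diag_mx (\row_(k < j.+1) c k z)) 0 0 (remainder i j.+1 z))
    *m (\prod_(k < j.+1) b (rev_ord k))); first by [].
rewrite big_ord_recr bS /= -/(a j).
have := @id_block_step (m1 + m2) (n1 + n2) j _ _ _ _ (W j z) (V j z) (fun k => c k z) (remainder i j.+1 z).
move=> /(_ _ _ _ _) <-; try lia.
by rewrite -[X in X *m _ *m _]/(_ *m _) !mulmxA.
Qed.

Lemma remainder_bdmx i j : (i + j = d)%N -> (d <= m1)%N -> (d <= n1)%N ->
  bdmx E -> (forall k, (k < d)%N -> bdmx (V k) /\ bdmx (W k)) ->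
  (forall k, (k < d)%N -> bdmx (fun z => (c k z)%:M : 'M[C]_1)) -> bdmx (remainder i j).
Proof.
move=> ij dm dn bE bVW bc; elim: i j ij => [|i IH] j ij; first exact: bdmx_conform.
have jd : (j < d)%N by lia.
have [bV bW] := bVW _ jd.
apply: bdmxM; last exact: bdmx_adj.
apply: bdmxM; first exact: bdmx_adj.
apply: bdmx_conform; apply: bdmx_block; [exact: bc|exact: bdmx0|exact: bdmx0|].
by apply: IH; rewrite addnS.
Qed.

End Remainder.

End Chain.

(** * From families of pairs to singular values *)

Section SingularValues.
Context {R : realType}.
Local Notation C := R[i].
Local Notation mu := (@arc_length R).
Local Notation normc := (@ComplexField.Normc.normc R).

Lemma good_base (s eps : R) m1 m2 n1 n2 (Psi : R -> 'M[C]_(m1 + m2, n1 + n2)) :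
  good s eps Psi 0.
Proof.
exists 0, (fun i t => 0), (fun i t => 0); split=> //; try by case.
move=> c; have -> : comb c (fun (i : 'I_0) (t : R) => (0 : 'cV[C]_(n1 + n2))) = fun=> 0.
  by apply/funext => t; rewrite /comb big_ord0.
have -> : comb c (fun (i : 'I_0) (t : R) => (0 : 'cV[C]_(m1 + m2))) = fun=> 0.
  by apply/funext => t; rewrite /comb big_ord0.
have -> : (fun t => Psi t *m 0) = (fun=> 0 : 'cV[C]_(m1 + m2)).
  by apply/funext => t; rewrite mulmx0.
by rewrite /nsq !inner20l /= !mulr0.
Qed.

Lemma good_conform (s eps : R) m1 m1' m2 n1 n1' n2 (Psi : R -> 'M[C]_(m1 + m2, n1 + n2)) K :
  m1 = m1' -> n1 = n1' -> good s eps Psi K ->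
  good s eps (fun z => conform_mx (0 : 'M[C]_(m1' + m2, n1' + n2)) (Psi z)) K.
Proof. by move=> em en; subst m1' n1'; under eq_fun do rewrite conform_mx_id. Qed.

Lemma good_ae (s eps : R) m1 m2 n1 n2 (Psi Psi' : R -> 'M[C]_(m1 + m2, n1 + n2)) K :
  bdmx Psi -> bdmx Psi' -> {ae mu, forall t, Psi t = Psi' t} -> good s eps Psi K -> good s eps Psi' K.
Proof.
move=> bP bP' PP [D [f [g [KD Hf Hg of1 est]]]]; exists D, f, g.
split; [exact: KD|exact: Hf|exact: Hg|exact: of1|move=> c].
have Lf : L2 (comb c f) by apply: comb_L2 => i; case: (Hf i).
have Lg : L2 (comb c g) by apply: comb_L2 => i; case: (Hg i).
have [/L2P[m1' _] /L2P[m2' _]] := (bdmx_L2 bP Lf, bdmx_L2 bP' Lf); have /L2P[mg _] := Lg.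
have <- : inner2 (fun t => Psi t *m comb c f t) (comb c g) =
    inner2 (fun t => Psi' t *m comb c f t) (comb c g); last exact: est.
apply: inner2_ae => //; apply/ae_eqP.
by apply: filterS PP => t ->.
Qed.

(** Linearity is given for two terms and up to a null set, so the sum is handled term by term; the
    value at 0 vanishes almost everywhere because it equals twice itself. *)
Lemma bounded_op_comb n m X Y (K : (R -> 'cV[C]_n) -> (R -> 'cV[C]_m)) N (c : 'rV[C]_N) f :
  subspace X -> bounded_op X Y K -> (forall i, X (f i)) ->
  {ae mu, forall t, K (comb c f) t = comb c (fun i => K (f i)) t}.
Proof.
move=> sX [_ lK _] Xf; have [_ X0 Xl] := sX.
have K0 : {ae mu, forall t, K (fun=> 0) t = 0}.
  have /ae_eqP := lK 1 _ _ X0 X0.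
  rewrite (_ : (fun t => 1 *: 0 + 0) = fun=> 0); last by apply/funext => t; rewrite scaler0 addr0.
  apply: filterS => t; rewrite scale1r => /eqP; rewrite -subr_eq0 opprD addrA subrr sub0r oppr_eq0.
  by move/eqP.
rewrite /comb; elim: (index_enum _) => [|i s IH].
  apply: filterS K0 => t; rewrite big_nil => <-; congr (K _ t).
  by apply/funext => r; rewrite big_nil.
have Xs : X (fun t => \sum_(j <- s) c 0 j *: f j t).
  by apply: subspace_sum => // j; exact: subspaceZ.
have /ae_eqP := lK (c 0 i) _ _ (Xf i) Xs; move: IH; apply: filterS2 => t IH h.
rewrite big_cons -IH -h; congr (K _ t).
by apply/funext => r; rewrite big_cons.
Qed.

(** An operator [Q] of rank at most [i] vanishes on a unit vector $F$ spanned by the more than [i]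
    functions of the family. There the difference of $\Gamma$ and [Q] equals $\Gamma F$, whose norm
    is bounded below by pairing it with the partner of $F$. *)
Lemma good_op_sv m1 m2 n1 n2 (Phi Psi : R -> 'M[C]_(m1 + m2, n1 + n2)) (s : R) (i K : nat) :
  Linf Phi -> is_symbol Phi Psi -> 0 < s -> (i < K)%N ->
  (forall eps, 0 < eps -> eps <= 1 -> eps <= s -> good s eps Psi K) ->
  (s%:E <= Gamma_sv i Phi)%E.
Proof.
move=> /Linf_bdmx bPhi [/Linf_bdmx bPsi GP] s0 iK gd.
apply: le_ereal_inf_tmp => _ [Q [bQ [g [Yg Qg]]] <-].
apply/lee_addgt0Pr => e e0.
(* The pairing gives $\|\Gamma F\|\ge(s-\varepsilon)/(1+\varepsilon)\ge s-\varepsilon(1+s)$, so the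
   loss is at most [e] once $\varepsilon(1+s)\le e$. *)
pose eps := Num.min 1 (Num.min s (e / (1 + s))).
have s1 : 0 < 1 + s by lra.
have eps0 : 0 < eps by rewrite !lt_min ltr01 s0 divr_gt0.
have eps1 : eps <= 1 by rewrite /eps ge_min lexx.
have epss : eps <= s by rewrite /eps !ge_min lexx orbT.
have epse : eps * (1 + s) <= e by rewrite -ler_pdivlMr // /eps !ge_min lexx !orbT.
have [D [f [h [KD Hf Hh of1 est]]]] := gd _ eps0 eps1 epss.
have Lf j : L2 (f j) by case: (Hf j).
have Lh j : L2 (h j) by case: (Hh j).
pose B : 'M[C]_(D, i) := \matrix_(j, k) sval (cid (Qg _ (Hf j))) k.
have BE j : {ae mu, forall t, Q (f j) t = \sum_(k < i) B j k *: g k t}.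
  have /ae_eqP := svalP (cid (Qg _ (Hf j))); apply: filterS => t ->.
  by apply: eq_bigr => k _; rewrite mxE.
(* The rows of [B] are coordinates of the images under [Q]; there are [D] of them in a space of
   dimension [i < D]. *)
have [c c0 cB] : exists2 c : 'rV[C]_D, c != 0 & c *m B = 0.
  have : kermx B != 0.
    rewrite -mxrank_eq0 mxrank_ker subn_eq0 -ltnNge.
    by apply: leq_ltn_trans (rank_leq_col B) _; exact: leq_trans iK KD.
  by move=> /rowV0Pn[c /sub_kermxP cB cn0]; exists c.
pose nc := Num.sqrt (rnsq c).
have nc0 : nc != 0.
  rewrite sqrtr_eq0 -ltNge lt_def rnsq_ge0 andbT.
  by apply: contra c0 => /eqP /rnsq_eq0 ->.
pose c1 := (nc^-1)%:C%C *: c.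
have c1B : c1 *m B = 0 by rewrite -scalemxAl cB scaler0.
have c1n : rnsq c1 = 1.
  rewrite /rnsq; under eq_bigr do rewrite mxE normc_mul exprMn.
  rewrite -mulr_sumr -/(rnsq c) normc_sq /= expr0n addr0 exprVn sqr_sqrtr ?rnsq_ge0 //.
  by rewrite mulVf // -(sqr_sqrtr (rnsq_ge0 c)) sqrf_eq0.
pose F := comb c1 f; pose G := comb c1 h.
have HF : H2_L2 F by apply: comb_sub => //; exact: H2_L2_subspace.
have HG : H2minus_L2 G by apply: comb_sub => //; exact: H2minus_L2_subspace.
have LF : L2 F by case: HF.
have LG : L2 G by case: HG.
have nF : nsq F = 1 by rewrite nsq_orthonormal.
have QF : {ae mu, forall t, Q F t = 0}.
  have QE := bounded_op_comb c1 (@H2_L2_subspace R n1 n2) bQ Hf.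
  have all_BE : {ae mu, forall t, forall j, Q (f j) t = \sum_(k < i) B j k *: g k t}.
    suff : {ae mu, forall t, forall j, j \in enum 'I_D -> Q (f j) t = \sum_(k < i) B j k *: g k t}.
      by apply: filterS => t H j; apply: H; rewrite mem_enum.
    elim: (enum 'I_D) => [|j r IH]; first by apply: aeW => t j; rewrite in_nil.
    move: IH (BE j); apply: filterS2 => t IH Bj k; rewrite inE => /orP[/eqP -> //|]; exact: IH.
  apply: filterS2 QE all_BE => t -> H.
  transitivity (\sum_k (c1 *m B) 0 k *: g k t); last first.
    by rewrite c1B big1 // => k _; rewrite mxE scale0r.
  rewrite /comb; under eq_bigr do rewrite H scaler_sumr.
  rewrite exchange_big /=; apply: eq_bigr => k _.
  by rewrite mxE scaler_suml; apply: eq_bigr => j _; rewrite scalerA.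
have [HGPsi GPsi] := GammaP bPsi LF; have [HGPhi _] := GammaP bPhi LF.
have LGPsi : L2 (Gamma Psi F) by case: HGPsi.
have LGPhi : L2 (Gamma Phi F) by case: HGPhi.
have [QY _ _] := bQ; have LQF : L2 (Q F) by case: (QY _ HF).
have [est1 est2] := est c1; rewrite -/F -/G nF !mulr1 in est1 est2.
rewrite -(GPsi _ HG) in est1.
(* Cauchy-Schwarz, with the norm of the partner at most $\sqrt{1+\varepsilon}\le1+\varepsilon$. *)
have key : s - eps <= l2 (Gamma Psi F) * (1 + eps).
  apply: le_trans est1 (le_trans (Re_inner2_le LGPsi LG) _).
  rewrite ler_wpM2l ?l2_ge0 // -(@ler_pXn2r _ 2) ?nnegrE ?l2_ge0 //; last by lra.
  by rewrite l2_sq; apply: le_trans est2 _; nra.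
have up : ((l2 (Gamma Psi F))%:E <= op_norm (@H2_L2 R n1 n2) (op_sub (Gamma Phi) Q))%E.
  rewrite (@l2_ae _ _ _ (op_sub (Gamma Phi) Q F)) //.
  - rewrite -L2norm_nsq; last exact: L2B.
    apply: ereal_sup_ubound; exists F => //=; split=> //.
    by rewrite L2norm_nsq // nF sqrtr1.
  - exact: L2B.
  - have /ae_eqP := GP _ HF; move: QF; apply: filterS2 => t Q0 ->.
    by rewrite /op_sub Q0 subr0.
apply: (@le_trans _ _ ((l2 (Gamma Psi F))%:E + e%:E)%E); last by rewrite leeD2r.
rewrite -EFinD lee_fin; have := l2_ge0 (Gamma Psi F); move: key; move: (l2 _) => k key k0.
have : (s - eps * (1 + s)) * (1 + eps) <= k * (1 + eps) by apply: le_trans key; nra.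
by rewrite ler_pM2r; [lra|lra].
Qed.

End SingularValues.

(** * Superoptimal values, the extended sequence and the final estimate *)

Section SuperoptimalValues.
Context {R : realType}.
Local Notation C := R[i].
Local Notation mu := (@arc_length R).

Lemma le_mx_sv m n (A : 'M[C]_(m, n)) i j : (i <= j)%N -> (mx_sv j A <= mx_sv i A)%E.
Proof.
move=> ij; apply: le_ereal_inf_tmp => _ [B Bi <-]; apply: ereal_inf_lbound; exists B => //=.
exact: leq_trans Bi ij.
Qed.

Lemma mx_sv0 m n (A : 'M[C]_(m, n)) : mx_sv 0 A = mx_norm2 A.
Proof.
apply/eqP; rewrite eq_le; apply/andP; split.
  apply: ereal_inf_lbound; exists (0 : 'M[C]_(m, n)).
    by rewrite /= mxrank0.
  by rewrite subr0.
apply: le_ereal_inf_tmp => _ [B /= + <-].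
by rewrite leqn0 mxrank_eq0 => /eqP ->; rewrite subr0.
Qed.

Lemma le_ess_sup_sv m n (F : R -> 'M[C]_(m, n)) i j : (i <= j)%N ->
  (ess_sup_sv j F <= ess_sup_sv i F)%E.
Proof.
move=> ij; apply/ess_supP; have := @ess_sup_ge _ _ _ mu (fun t => mx_sv i (F t)).
by apply: filterS => t; apply: le_trans; exact: le_mx_sv.
Qed.

Lemma Linf_norm_sv0 m n (F : R -> 'M[C]_(m, n)) : Linf_norm F = ess_sup_sv 0 F.
Proof. by rewrite /ess_sup_sv; under eq_fun do rewrite mx_sv0. Qed.

Section Omega.
Context {m1 m2 n1 n2 : nat}.
Variables (Phi : R -> 'M[C]_(m1 + m2, n1 + n2)) (t : nat -> R).

Lemma Omega_sub i j Q : (i <= j)%N -> Omega j Phi Q -> Omega i Phi Q.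
Proof.
move=> ij; rewrite -(subnK ij); elim: (j - i)%N => [//|k IH].
by rewrite addSn => -[/IH].
Qed.

Lemma Omega_le j Q Q' : Omega j Phi Q -> Omega j Phi Q' ->
  (ess_sup_sv j (sub_block Phi Q) <= ess_sup_sv j (sub_block Phi Q'))%E.
Proof.
case: j => [|j] /= [h1 h2] [h3 h4]; last exact: h2.
by rewrite -!Linf_norm_sv0; exact: h2.
Qed.

(** The sets [Omega] decrease, and [t i] is the common value of the essential supremum of $s_i$ on
    [Omega i]. An element of [Omega j] attains it as well, and $s_j\le s_i$ pointwise. *)
Lemma superopt_sv_nonincreasing i j : superopt_sv Phi t -> (i <= j)%N ->
  (j < minn m1 n1)%N -> t j <= t i.
Proof.
move=> st ij jd; have [Qi Oi ti] := st _ (leq_ltn_trans ij jd); have [Qj Oj tj] := st _ jd.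
rewrite -lee_fin ti tj; apply: le_trans (le_ess_sup_sv _ ij) _.
exact: Omega_le (Omega_sub ij Oj) Oi.
Qed.

End Omega.

(** The starting index [m] is free for the sake of the induction. Indices with [t j = 0] add no
    terms to the list but stay in the sum, which only weakens the bound on [i]. *)
Lemma nth_extended (t : nat -> R) (k : nat -> nat) l m i :
  let s := flatten [seq nseq (k j) (t j) | j <- iota m l & t j != 0] in
  (i < size s)%N -> exists r, [/\ (r < m + l)%N, nth 0 s i = t r &
    (i < \sum_(m <= j < r.+1) k j)%N].
Proof.
elim: l m i => [//|l IH] m i /=; case: ifPn => [tm|tm] /=; last first.
  move=> /IH[r [rl -> ir]]; exists r; split=> //; first by rewrite addnS.
  have [mr|rm] := ltnP m r.+1; last by move: ir; rewrite big_geq // ltnW.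
  by rewrite big_ltn // ltn_addl.
rewrite size_cat nth_cat size_nseq; case: (ltnP i (k m)) => [ik _|ki].
  exists m; split; [by rewrite addnS ltnS leq_addr|by rewrite nth_nseq ik|by rewrite big_nat1].
rewrite -ltn_subLR // => /IH[r [rl -> ir]]; exists r; split=> //; first by rewrite addnS.
have [mr|rm] := ltnP m r.+1; last by move: ir; rewrite big_geq // ltnW.
by rewrite big_ltn // -ltn_subLR.
Qed.

Lemma Gamma_sv_ge0 m1 m2 n1 n2 (Phi : R -> 'M[C]_(m1 + m2, n1 + n2)) j :
  (0 <= Gamma_sv j Phi)%E.
Proof.
apply: le_ereal_inf_tmp => _ [Q _ <-].
apply: (@le_trans _ _ (L2norm (op_sub (Gamma Phi) Q (fun=> 0)))); first exact: Lnorm_ge0.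
apply: ereal_sup_ubound; exists (fun=> 0) => //=; split; first by have [] := @H2_L2_subspace R n1 n2.
by rewrite L2norm_nsq ?lee_fin -/(l2 _) ?l2_0 //; exact: L2_0.
Qed.

Lemma conform_block0 m n M N (A : 'M[C]_0) (B : 'M[C]_(m, n)) :
  conform_mx (0 : 'M[C]_(M, N)) (block_mx A 0 0 B) = conform_mx 0 B.
Proof.
congr conform_mx; apply/matrixP => i j.
rewrite -[i in LHS](_ : rshift 0 i = i); last exact: val_inj.
by rewrite -[j in LHS](_ : rshift 0 j = j) ?block_mxEdr //; exact: val_inj.
Qed.

Section Factorization.
Context {m1 m2 n1 n2 : nat}.
Let d := minn m1 n1.
Variables (Psi : R -> 'M[C]_(m1 + m2, n1 + n2)) (t : nat -> R) (k : nat -> nat).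
Variables (V : forall j, R -> 'M[C]_(n1 - j + n2)) (W : forall j, R -> 'M[C]_(m1 - j + m2)).
Variables (u : nat -> R -> C) (E : R -> 'M[C]_(m1 + m2 - d, n1 + n2 - d)).
Hypotheses (tV : forall j, (j < d)%N -> thematic (V j)).
Hypotheses (tW : forall j, (j < d)%N -> thematic (fun z => (W j z)^T)).
Hypotheses (uu : forall j, (j < d)%N -> unimodular_fun (u j)).
Hypotheses (fu : forall j, (j < d)%N ->
  fredholm_of_index (@H2 R 1) (@H2 R 1) (toeplitz (u j)) (k j)%:Z).
Hypotheses (bE : bdmx E).

Local Notation rem := (remainder V W (fun j z => (t j)%:C%C * u j z) E).

Lemma factorization_bdmx i j : (i + j = d)%N -> bdmx (rem i j).
Proof.
move=> ij; apply: remainder_bdmx => //; try exact: geq_minl; try exact: geq_minr.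
- move=> l ld; split; first exact: thematic_bdmx (tV ld).
  by have := bdmx_tr (thematic_bdmx (tW ld)); under eq_fun do rewrite trmxK.
- by move=> l ld; have [mu_ u1] := unimodular_normc (uu ld); exact: bdmx_scalar1.
Qed.

(** Induction on the number [n] of layers from [j] to [r]. It starts at the remainder after layer
    [r] with the empty family, and each layer adds its index to the dimension. *)
Lemma good_remainder r (s : R) : (r < d)%N -> 0 < s ->
  (forall j, (j <= r)%N -> s <= t j) ->
  forall n i j eps, (j + n = r.+1)%N -> (i + j = d)%N -> 0 < eps -> eps <= 1 -> eps <= s ->
    good s eps (rem i j) (\sum_(j <= l < r.+1) k l).
Proof.
move=> rd s0 st; elim=> [|n IH] i j eps jn ij e0 e1 es.
  by rewrite big_geq; [exact: good_base|lia].
have jr : (j <= r)%N by lia.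
case: i ij => [|i] ij; first by lia.
have jd : (j < d)%N by lia.
have [jm jn1] : (j < m1)%N /\ (j < n1)%N by move: jd; rewrite leq_min => /andP.
(* Crossing a layer doubles the error, so the inner family is requested with half of it. *)
have e2 : eps = 2 * (eps / 2) by field.
rewrite e2 big_ltn ?ltnS // addnC.
apply: one_step; [by lia|by lia|exact: tV|exact: tW|exact: uu|exact: fu| |exact: st|by lra|by lra|by lra|].
  by apply: factorization_bdmx; lia.
by apply: IH; [lia|lia|lra|lra|lra].
Qed.

Hypothesis PE : {ae mu, forall z, Psi z =
  (\prod_(j < d) (id_block j (m1 + m2) (W j) z)^t*)
  *m conform_mx 0 (block_mx (diag_mx (\row_(j < d) ((t j)%:C%C * u j z))) 0 0 (E z))
  *m (\prod_(j < d) (id_block (rev_ord j) (n1 + n2) (V (rev_ord j)) z)^t*)}.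

Lemma good_factorization r (s eps : R) : bdmx Psi -> (r < d)%N -> 0 < s ->
  (forall j, (j <= r)%N -> s <= t j) -> 0 < eps -> eps <= 1 -> eps <= s ->
  good s eps Psi (\sum_(0 <= l < r.+1) k l).
Proof.
move=> bP rd s0 st e0 e1 es.
have g0 := good_remainder rd s0 st (add0n r.+1) (addn0 d) e0 e1 es.
apply: good_ae (good_conform (subn0 m1) (subn0 n1) g0) => //.
  exact/bdmx_conform/factorization_bdmx/addn0.
apply: filterS PE => z ->.
rewrite (@remainderP _ _ _ _ _ _ V W (fun j z => (t j)%:C%C * u j z) E d 0 z (addn0 d) (geq_minl _ _) (geq_minr _ _)).
by rewrite !big_ord0 mul1mx mulmx1 conform_block0.
Qed.

End Factorization.

End SuperoptimalValues.

Theorem theorem10p2 (R : realType) (m1 m2 n1 n2 : nat)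
    (Phi : R -> 'M[R[i]]_(m1 + m2, n1 + n2)) (t : nat -> R) (t' : seq R) :
  Linf Phi ->
  superopt_sv Phi t ->
  (forall j, (j < minn m1 n1)%N -> t j != 0 ->
     (Gamma_ess_norm Phi < (t j)%:E)%E) ->
  extended_t_sequence Phi t t' ->
  forall j, (j < size t')%N -> ((nth 0 t' j)%:E <= Gamma_sv j Phi)%E.
Proof.
move=> LPhi st _ [Psi [k [[sPsi _] [V [W [u [E [tV tW uf LE /ae_eqP PE]]]]] ->]]] i.
move=> /nth_extended[r [rd -> ir]]; rewrite add0n in rd.
(* The construction works with a positive level; at a level of at most 0 the nonnegativity of
   singular values suffices. *)
have [tr0|tr0] := leP (t r) 0.
  by apply: le_trans (Gamma_sv_ge0 _ _); rewrite lee_fin.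
apply: (good_op_sv LPhi sPsi tr0 ir) => eps e0 e1 es.
apply: (good_factorization tV tW _ _ (Linf_bdmx LE) PE) => //.
- by move=> j /uf[].
- by move=> j /uf[].
- by case: sPsi => /Linf_bdmx.
- by move=> j jr; exact: superopt_sv_nonincreasing st jr rd.
Qed.
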